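(* Let $G=\langle a,b \mid [a,a^{b^i}]=1,\ i\in\mathbb Z\rangle$ be the lamplighter group and let $\widehat G$ be its Malcev $\mathbb Q$-completion. Let $L=\mathbb Q[x]\rtimes\mathbb Q t$ be the rational lamplighter Lie algebra and let $\widehat L=\varprojlim_n L/L^n$ be its pronilpotent completion. Then $\widehat L$ is the Lie algebra associated to the Malcev group $\widehat G$; in other terms, $\widehat G$ is isomorphic to the group $(\widehat L,* )$, where $*$ is the Baker-Campbell-Hausdorff product on $\widehat L$.
   Context: For a group $G$, the lower central series is $G^1=G$, $G^n=[G,G^{n-1}]$ for $n\ge 2$. A Malcev group is a group $\Gamma$ such that each $\Gamma^n/\Gamma^{n+1}$ is a $\mathbb Q$-vector space and the natural map $\Gamma\to\varprojlim_n \Gamma/\Gamma^n$ is an isomorphism. The Malcev ($\mathbb Q$-)completion of a group $G$ is a group homomorphism $G\to\widehat G$ with $\widehat G$ a Malcev group, inducing isomorphisms $G^n/G^{n+1}\otimes\mathbb Q\to \widehat G^n/\widehat G^{n+1}$ for all $n\ge 1$. In the presentation of the lamplighter group, $a^{b^i}$ denotes the conjugate of $a$ by $b^i$; this group is the restricted wreath product $\mathbb Z\wr\mathbb Z$. The rational lamplighter Lie algebra $L=\mathbb Q[x]\rtimes\mathbb Q t$ is the semidirect product of the abelian Lie algebras $\mathbb Q[x]$ and $\mathbb Q t$, with $[p,t]=x\cdot p$ for every polynomial $p$. For a Lie algebra $L$, the lower central series is $L^1=L$, $L^n=[L,L^{n-1}]$, and $\widehat L=\varprojlim_n L/L^n$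 is the pronilpotent completion; $L$ is pronilpotent if $L\to\widehat L$ is an isomorphism. On a pronilpotent rational Lie algebra the Baker-Campbell-Hausdorff series $u*v=u+v+\frac12[u,v]+\cdots$ is a well-defined group law. The Malcev correspondence is the equivalence between pronilpotent rational Lie algebras and Malcev groups which sends a pronilpotent Lie algebra $E$ to the group $(E,* )$; the Lie algebra associated to a Malcev group is the one corresponding to it under this equivalence. *)

(* Defs.v *)
From HB Require Import structures.
From mathcomp Require Import all_boot all_order all_algebra.
From mathcomp Require Import boolp classical_sets.

Set Implicit Arguments.
Unset Strict Implicit.
Unset Printing Implicit Defensive.

Import GRing.Theory.

Local Open Scope classical_set_scope.
Local Open Scope quotient_scope.

Section InverseLimit.
Variables (T : nat -> choiceType) (p : forall n, T n.+1 -> T n).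

Definition compatible (f : forall n, T n) : bool :=
  `[< forall n, p (f n.+1) = f n >].

Definition invlim := {f : forall n, T n | compatible f}.

HB.instance Definition _ := Choice.on invlim.

End InverseLimit.

Section LowerCentralSeries.
Local Open Scope group_scope.
Variable gT : groupType.
Implicit Types (x y : gT) (H N : set gT).

Definition is_subgroup H : Prop :=
  [/\ H 1, forall x y, H x -> H y -> H (x * y) & forall x, H x -> H x^-1].

(* [glcs n] is the n-th term of the lower central series for n >= 1;          *)
(* [glcs 0] is, by convention, the whole group.                               *)
Fixpoint glcs (n : nat) : set gT :=
  if n is m.+1 then
    if m is 0 then setT
    else smallest is_subgroup [set [~ x, y] | x in setT & y in glcs m]
  else setT.

Lemma glcsS n : (0 < n)%N ->
  glcs n.+1 = smallest is_subgroup [set [~ x, y] | x in setT & y in glcs n].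
Proof. by case: n. Qed.

Lemma glcs_subgroup n : is_subgroup (glcs n).
Proof.
case: n => [|[|n]]; [by split | by split | rewrite glcsS //].
split=> [A [[]]//|x y Hx Hy A AH|x Hx A AH].
  by case: (AH) => -[_ AM _] _; apply: AM; [apply: Hx | apply: Hy].
by case: (AH) => -[_ _ AV] _; apply: AV; apply: Hx.
Qed.

Lemma glcs1 n : glcs n 1. Proof. by case: (glcs_subgroup n). Qed.

Lemma glcsM n x y : glcs n x -> glcs n y -> glcs n (x * y).
Proof. by case: (glcs_subgroup n) => _ h _; apply: h. Qed.

Lemma glcsV n x : glcs n x -> glcs n x^-1.
Proof. by case: (glcs_subgroup n) => _ _; apply. Qed.

Lemma glcsR n x y : glcs n y -> glcs n.+1 [~ x, y].
Proof.
case: n => [//|n] Hy; rewrite glcsS // => A [_]; apply.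
by exists x => //; exists y.
Qed.

Lemma glcs_sub n : glcs n.+1 `<=` glcs n.
Proof.
elim: n => [//|n IHn]; case: n IHn => [//|n] IHn.
rewrite glcsS // => z; apply; split; first exact: glcs_subgroup.
by move=> _ [x _ [y /IHn Hy <-]]; apply: glcsR.
Qed.

Lemma glcsRl n x y : glcs n x -> glcs n.+1 [~ x, y].
Proof. by move=> Hx; rewrite -[[~ x, y]]invgK invgR; apply/glcsV/glcsR. Qed.

Lemma glcsJ n x y : glcs n x -> glcs n (x ^ y).
Proof.
move=> Hx; have -> : x ^ y = x * [~ x, y] by rewrite mulVKg.
by apply: glcsM => //; apply/glcs_sub/glcsRl.
Qed.

Lemma glcs_congrM n x' x y' y : glcs n (x'^-1 * x) -> glcs n (y'^-1 * y) ->
  glcs n ((x' * y')^-1 * (x * y)).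
Proof.
move=> Hx Hy; have -> : (x' * y')^-1 * (x * y) = (x'^-1 * x) ^ y' * (y'^-1 * y).
  by rewrite /conjg invgM -!mulgA mulVKg.
by apply: glcsM => //; apply: glcsJ.
Qed.

Lemma glcs_congrV n x' x : glcs n (x'^-1 * x) -> glcs n (x'^-1^-1 * x^-1).
Proof.
move=> /glcsV Hx; have -> : x'^-1^-1 * x^-1 = ((x'^-1 * x)^-1) ^ x'^-1.
  by rewrite /conjg invgM !invgK -!mulgA mulgV mulg1.
exact: glcsJ.
Qed.

End LowerCentralSeries.

Arguments glcs : simpl never.

Section Cosets.
Local Open Scope group_scope.
Variables (gT : groupType) (n : nat).

Definition coset_rel (x y : gT) : bool := `[< glcs n (x^-1 * y) >].

Lemma coset_rel_refl : reflexive coset_rel.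
Proof. by move=> x; apply/asboolP; rewrite mulVg; apply: glcs1. Qed.

Lemma coset_rel_sym : symmetric coset_rel.
Proof.
suff h x y : coset_rel x y -> coset_rel y x by move=> x y; apply/idP/idP; apply: h.
by move=> /asboolP/glcsV H; apply/asboolP; rewrite invgM invgK in H.
Qed.

Lemma coset_rel_trans : transitive coset_rel.
Proof.
move=> y x z /asboolP Hxy /asboolP Hyz; apply/asboolP.
by have := glcsM Hxy Hyz; rewrite -mulgA mulVKg.
Qed.

Canonical coset_equiv :=
  EquivRel coset_rel coset_rel_refl coset_rel_sym coset_rel_trans.

(* The set underlying the quotient group Gamma / Gamma^n.                     *)
Definition gquot := {eq_quot coset_equiv}.

HB.instance Definition _ := Choice.on gquot.
HB.instance Definition _ := EqQuotient.on gquot.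

End Cosets.

Section GroupCompletion.
Local Open Scope group_scope.
Variable gT : groupType.

Definition gquot_proj n (c : gquot gT n.+1) : gquot gT n :=
  \pi_(gquot gT n) (repr c).

Definition gcompletion := invlim gquot_proj.

Lemma gquot_projE n (x : gT) : gquot_proj (\pi_(gquot gT n.+1) x) = \pi_(gquot gT n) x.
Proof.
apply/eqmodP/asboolP/glcs_sub.
by have /eqmodP/asboolP : \pi_(gquot gT n.+1) (repr (\pi_(gquot gT n.+1) x)) = \pi x
  by rewrite reprK.
Qed.

Lemma to_gcompletion_subproof (x : gT) :
  compatible gquot_proj (fun n => \pi_(gquot gT n) x).
Proof. by apply/asboolP => n; apply: gquot_projE. Qed.

Definition to_gcompletion (x : gT) : gcompletion :=
  exist _ (fun n => \pi_(gquot gT n) x) (to_gcompletion_subproof x).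

End GroupCompletion.

Section Graded.
Local Open Scope group_scope.
Variables (gT : groupType) (n : nat).

Definition glcs_type := {x : gT | `[< glcs n x >]}.
HB.instance Definition _ := Choice.on glcs_type.

Definition glcs_elt (x : gT) (Hx : glcs n x) : glcs_type :=
  exist _ x (asboolT Hx).

Lemma glcs_typeP (x : glcs_type) : glcs n (val x).
Proof. by apply/asboolP/(valP x). Qed.

Definition gr_rel (x y : glcs_type) : bool :=
  `[< glcs n.+1 ((val x)^-1 * val y) >].

Lemma gr_rel_refl : reflexive gr_rel.
Proof. by move=> x; apply/asboolP; rewrite mulVg; apply: glcs1. Qed.

Lemma gr_rel_sym : symmetric gr_rel.
Proof. by move=> x y; apply: (@coset_rel_sym gT n.+1). Qed.

Lemma gr_rel_trans : transitive gr_rel.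
Proof. by move=> y x z; apply: (@coset_rel_trans gT n.+1). Qed.

Canonical gr_equiv := EquivRel gr_rel gr_rel_refl gr_rel_sym gr_rel_trans.

(* The abelian group Gamma^n / Gamma^{n+1}, written additively.               *)
Definition gr := {eq_quot gr_equiv}.

HB.instance Definition _ := Choice.on gr.
HB.instance Definition _ := EqQuotient.on gr.

Definition gr0 : gr := \pi_gr (glcs_elt (@glcs1 gT n)).
Definition gr_add (c d : gr) : gr :=
  \pi_gr (glcs_elt (glcsM (glcs_typeP (repr c)) (glcs_typeP (repr d)))).
Definition gr_opp (c : gr) : gr :=
  \pi_gr (glcs_elt (glcsV (glcs_typeP (repr c)))).

Lemma gr_repr (x : glcs_type) :
  glcs n.+1 ((val (repr (\pi_gr x)))^-1 * val x).
Proof.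
by have /eqmodP/asboolP : \pi_gr (repr (\pi_gr x)) = \pi x by rewrite reprK.
Qed.

Lemma gr_addE (x y : glcs_type) :
  gr_add (\pi_gr x) (\pi_gr y) = \pi_gr (glcs_elt (glcsM (glcs_typeP x) (glcs_typeP y))).
Proof.
by apply/eqmodP/asboolP/glcs_congrM; apply: gr_repr.
Qed.

Lemma gr_oppE (x : glcs_type) :
  gr_opp (\pi_gr x) = \pi_gr (glcs_elt (glcsV (glcs_typeP x))).
Proof.
by apply/eqmodP/asboolP/glcs_congrV; apply: gr_repr.
Qed.

Lemma gr_addA : associative gr_add.
Proof.
elim/quotW=> x; elim/quotW=> y; elim/quotW=> z.
rewrite (gr_addE x y) (gr_addE y z) !gr_addE.
by congr (\pi _); apply: val_inj; rewrite /= mulgA.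
Qed.

Lemma gr_addC : commutative gr_add.
Proof.
elim/quotW=> x; elim/quotW=> y; rewrite !gr_addE; apply/eqmodP/asboolP => /=.
have -> : (val x * val y)^-1 * (val y * val x) = [~ val y, val x].
  by rewrite /commg /conjg invgM !mulgA.
by apply/glcsR/glcs_typeP.
Qed.

Lemma gr_add0 : left_id gr0 gr_add.
Proof.
elim/quotW=> x; rewrite gr_addE; congr (\pi _); apply: val_inj.
by rewrite /= mul1g.
Qed.

Lemma gr_addN : left_inverse gr0 gr_opp gr_add.
Proof.
elim/quotW=> x; rewrite gr_oppE gr_addE; congr (\pi _); apply: val_inj.
by rewrite /= mulVg.
Qed.

HB.instance Definition _ :=
  GRing.isZmodule.Build gr gr_addA gr_addC gr_add0 gr_addN.

End Graded.

Section GradedMap.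
Local Open Scope group_scope.
Variables (gT hT : groupType) (f : {multiplicative gT -> hT}).

Lemma group_morph1 : f 1 = 1.
Proof. by apply: (@mulgI _ (f 1)); rewrite -gmulfM !mulg1. Qed.

Lemma group_morphV x : f x^-1 = (f x)^-1.
Proof. by apply/esym/mulg1_eq; rewrite -gmulfM mulgV group_morph1. Qed.

Lemma glcs_morph n x : glcs n x -> glcs n (f x).
Proof.
elim: n x => [//|[//|n] IHn] x; rewrite {1}glcsS // => Hx.
have [h1 hM hV] := @glcs_subgroup hT n.+2.
apply: (Hx (f @^-1` (@glcs hT n.+2))); split.
  split=> [|y z|y]; rewrite /preimage /= ?group_morph1 ?gmulfM ?group_morphV.
  - exact: h1.
  - exact: hM.
  - exact: hV.
move=> _ [y _ [z /IHn Hz <-]].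
by rewrite /preimage /= !gmulfM !group_morphV; apply: glcsR.
Qed.

(* The map induced by [f] on Gamma^n / Gamma^{n+1}; see [gr_mapE].            *)
Definition gr_map n (c : gr gT n) : gr hT n :=
  \pi_(gr hT n) (glcs_elt (glcs_morph (glcs_typeP (repr c)))).

Lemma gr_mapE n x (Hx : glcs n x) :
  gr_map (\pi_(gr gT n) (glcs_elt Hx)) =
  \pi_(gr hT n) (glcs_elt (glcs_morph Hx)).
Proof.
apply/eqmodP/asboolP => /=; rewrite -group_morphV -gmulfM; apply: glcs_morph.
exact: (gr_repr (glcs_elt Hx)).
Qed.

End GradedMap.

(* The tensor product of an abelian group with Q: formal finite sums of pure  *)
(* tensors, modulo the congruence generated by biadditivity.                  *)

Section TensorQ.
Variable A : zmodType.
Local Open Scope ring_scope.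

Inductive tensor_eq : seq (A * rat) -> seq (A * rat) -> Prop :=
| tensor_refl s : tensor_eq s s
| tensor_sym s t : tensor_eq s t -> tensor_eq t s
| tensor_trans s t u : tensor_eq s t -> tensor_eq t u -> tensor_eq s u
| tensor_cat s s' t t' :
    tensor_eq s s' -> tensor_eq t t' -> tensor_eq (s ++ t) (s' ++ t')
| tensor_comm s t : tensor_eq (s ++ t) (t ++ s)
| tensor_0l q : tensor_eq [:: (0, q)] [::]
| tensor_0r a : tensor_eq [:: (a, 0)] [::]
| tensor_Dl a b q : tensor_eq [:: (a + b, q)] [:: (a, q); (b, q)]
| tensor_Dr a q r : tensor_eq [:: (a, q + r)] [:: (a, q); (a, r)].

Definition tensor_rel (s t : seq (A * rat)) : bool := `[< tensor_eq s t >].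

Lemma tensor_rel_refl : reflexive tensor_rel.
Proof. by move=> s; apply/asboolP/tensor_refl. Qed.

Lemma tensor_rel_sym : symmetric tensor_rel.
Proof. by move=> s t; apply/asboolP/asboolP; apply: tensor_sym. Qed.

Lemma tensor_rel_trans : transitive tensor_rel.
Proof.
by move=> t s u /asboolP st /asboolP tu; apply/asboolP/(tensor_trans st tu).
Qed.

Canonical tensor_equiv :=
  EquivRel tensor_rel tensor_rel_refl tensor_rel_sym tensor_rel_trans.

Definition tensorQ := {eq_quot tensor_equiv}.

HB.instance Definition _ := Choice.on tensorQ.
HB.instance Definition _ := EqQuotient.on tensorQ.

End TensorQ.

Section RationalStructure.
Local Open Scope ring_scope.

(* [sc] makes the abelian group [B] a vector space over Q.  Such a [sc] is    *)
(* unique when it exists.                                                     *)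
Record rat_scaling (B : zmodType) (sc : rat -> B -> B) : Prop := RatScaling {
  rat_scalingA : forall q r b, sc q (sc r b) = sc (q * r) b;
  rat_scaling1 : forall b, sc 1 b = b;
  rat_scalingDr : forall q b c, sc q (b + c) = sc q b + sc q c;
  rat_scalingDl : forall q r b, sc (q + r) b = sc q b + sc r b }.

(* For additive [f], the induced map A (x) Q -> B, a (x) q |-> q f(a); it does *)
(* not depend on the representative chosen by [repr], see [tensor_liftE].     *)
Definition tensor_lift (A B : zmodType) (sc : rat -> B -> B) (f : A -> B)
    (c : tensorQ A) : B :=
  \sum_(aq <- repr c) sc aq.2 (f aq.1).

Lemma tensor_liftE (A B : zmodType) (sc : rat -> B -> B) (f : A -> B) s :
    rat_scaling sc -> {morph f : a b / a + b} ->
  tensor_lift sc f (\pi_(tensorQ A) s) = \sum_(aq <- s) sc aq.2 (f aq.1).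
Proof.
move=> scP fD.
have f0 : f 0 = 0 by apply: (addrI (f 0)); rewrite -fD !addr0.
have sc0r q : sc q 0 = 0.
  by apply: (addrI (sc q 0)); rewrite -(rat_scalingDr scP) !addr0.
have sc0l b : sc 0 b = 0.
  by apply: (addrI (sc 0 b)); rewrite -(rat_scalingDl scP) !addr0.
have /eqmodP/asboolP : \pi_(tensorQ A) (repr (\pi_(tensorQ A) s)) = \pi s.
  by rewrite reprK.
rewrite /tensor_lift; move: (repr _) => s'.
elim=> {s s'} [// | s t _ -> // | s t u _ -> _ -> // | s s' t t' _ IHs _ IHt
  | s t | q | a | a b q | a q r].
- by rewrite !big_cat /= IHs IHt.
- by rewrite !big_cat /= addrC.
- by rewrite big_seq1 big_nil /= f0 sc0r.
- by rewrite big_seq1 big_nil /= sc0l.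
- by rewrite !big_cons !big_nil /= !addr0 fD (rat_scalingDr scP).
- by rewrite !big_cons !big_nil /= !addr0 (rat_scalingDl scP).
Qed.

End RationalStructure.

Lemma gr_mapD (gT hT : groupType) (f : {multiplicative gT -> hT}) n :
  {morph @gr_map gT hT f n : c d / (c + d)%R}.
Proof.
move=> c d; rewrite [RHS]gr_addE /gr_map; apply/eqmodP/asboolP => /=.
rewrite -!gmulfM -group_morphV -gmulfM; apply: glcs_morph.
exact: (gr_repr (glcs_elt (glcsM (glcs_typeP (repr c)) (glcs_typeP (repr d))))).
Qed.

(* The natural map is multiplicative, the limit being taken with its          *)
(* coordinatewise product, so it is an isomorphism iff it is bijective.       *)
Definition malcev_group (gT : groupType) : Prop :=
  (forall n, (0 < n)%N -> exists sc : rat -> gr gT n -> gr gT n, rat_scaling sc)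
  /\ bijective (@to_gcompletion gT).

Definition malcev_completion (gT hT : groupType)
    (f : {multiplicative gT -> hT}) : Prop :=
  malcev_group hT /\
  forall n, (0 < n)%N -> forall sc : rat -> gr hT n -> gr hT n, rat_scaling sc ->
    bijective (tensor_lift sc (@gr_map gT hT f n)).

Section Presentation.
Variable X : choiceType.

(* The letter (x, e) stands for x if e is true, and for x^-1 otherwise.       *)
Definition gword := seq (X * bool).

Definition gword_inv (w : gword) : gword := rev [seq (l.1, ~~ l.2) | l <- w].

Variable rels : set gword.

Inductive pres_eq : gword -> gword -> Prop :=
| pres_refl u : pres_eq u u
| pres_sym u v : pres_eq u v -> pres_eq v u
| pres_trans u v w : pres_eq u v -> pres_eq v w -> pres_eq u w
| pres_cat u u' v v' : pres_eq u u' -> pres_eq v v' -> pres_eq (u ++ v) (u' ++ v')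
| pres_cancel x e : pres_eq [:: (x, e); (x, ~~ e)] [::]
| pres_relator r : rels r -> pres_eq r [::].

Definition pres_rel (u v : gword) : bool := `[< pres_eq u v >].

Lemma pres_rel_refl : reflexive pres_rel.
Proof. by move=> u; apply/asboolP/pres_refl. Qed.

Lemma pres_rel_sym : symmetric pres_rel.
Proof. by move=> u v; apply/asboolP/asboolP; apply: pres_sym. Qed.

Lemma pres_rel_trans : transitive pres_rel.
Proof.
by move=> v u w /asboolP uv /asboolP vw; apply/asboolP/(pres_trans uv vw).
Qed.

Canonical pres_equiv :=
  EquivRel pres_rel pres_rel_refl pres_rel_sym pres_rel_trans.

Definition presented := {eq_quot pres_equiv}.

HB.instance Definition _ := Choice.on presented.
HB.instance Definition _ := EqQuotient.on presented.

Definition pres_one : presented := \pi_presented ([::] : gword).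
Definition pres_mul (c d : presented) : presented := \pi_presented (repr c ++ repr d).
Definition pres_inv (c : presented) : presented := \pi_presented (gword_inv (repr c)).

Lemma gword_inv_cat u v : gword_inv (u ++ v) = gword_inv v ++ gword_inv u.
Proof. by rewrite /gword_inv map_cat rev_cat. Qed.

Lemma gword_invK : involutive gword_inv.
Proof.
move=> u; rewrite /gword_inv map_rev revK -map_comp map_id_in // => -[x e] _ /=.
by rewrite negbK.
Qed.

Lemma pres_mulV u : pres_eq (u ++ gword_inv u) [::].
Proof.
elim: u => [|[x e] u IHu]; first exact: pres_refl.
rewrite -cat1s gword_inv_cat -catA (catA u).
apply: pres_trans (pres_cancel x e).
rewrite -[X in pres_eq _ X]/([:: (x, e)] ++ [:: (x, ~~ e)]).
apply: pres_cat; first exact: pres_refl.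
by rewrite -[X in pres_eq _ X]cat0s; apply: pres_cat => //; apply: pres_refl.
Qed.

Lemma pres_Vmul u : pres_eq (gword_inv u ++ u) [::].
Proof. by rewrite -{2}[u]gword_invK; apply: pres_mulV. Qed.

Lemma pres_eq_inv u v : pres_eq u v -> pres_eq (gword_inv u) (gword_inv v).
Proof.
move=> uv; apply: (@pres_trans _ (gword_inv u ++ (v ++ gword_inv v))).
  rewrite -[X in pres_eq X _]cats0.
  by apply: pres_cat; [apply: pres_refl | apply/pres_sym/pres_mulV].
rewrite catA -[X in pres_eq _ X]cat0s; apply: pres_cat; last exact: pres_refl.
apply: pres_trans (pres_Vmul u).
by apply: pres_cat; [apply: pres_refl | apply: pres_sym].
Qed.

Lemma pres_repr u : pres_eq (repr (\pi_presented u)) u.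
Proof.
by have /eqmodP/asboolP : \pi_presented (repr (\pi_presented u)) = \pi u
  by rewrite reprK.
Qed.

Lemma pres_mulE u v : pres_mul (\pi_presented u) (\pi_presented v) = \pi_presented (u ++ v).
Proof. by apply/eqmodP/asboolP/pres_cat; apply: pres_repr. Qed.

Lemma pres_invE u : pres_inv (\pi_presented u) = \pi_presented (gword_inv u).
Proof. by apply/eqmodP/asboolP/pres_eq_inv/pres_repr. Qed.

Lemma pres_mulA : associative pres_mul.
Proof.
by elim/quotW=> u; elim/quotW=> v; elim/quotW=> w;
rewrite (pres_mulE u v) (pres_mulE v w) !pres_mulE catA.
Qed.

Lemma pres_mul1 : left_id pres_one pres_mul.
Proof. by elim/quotW=> u; rewrite pres_mulE. Qed.

Lemma pres_1mul : right_id pres_one pres_mul.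
Proof. by elim/quotW=> u; rewrite pres_mulE cats0. Qed.

Lemma pres_mulVg : left_inverse pres_one pres_inv pres_mul.
Proof.
by elim/quotW=> u; rewrite pres_invE pres_mulE; apply/eqmodP/asboolP/pres_Vmul.
Qed.

Lemma pres_mulgV : right_inverse pres_one pres_inv pres_mul.
Proof.
by elim/quotW=> u; rewrite pres_invE pres_mulE; apply/eqmodP/asboolP/pres_mulV.
Qed.

HB.instance Definition _ := isGroup.Build presented
  pres_mulA pres_mul1 pres_1mul pres_mulVg pres_mulgV.

End Presentation.

Section LamplighterGroup.

(* The generator a is [true], the generator b is [false].                     *)
Definition word_a : gword bool := [:: (true, true)].

Definition word_b_exp (i : int) : gword bool :=
  match i with
  | Posz n => nseq n (false, true)
  | Negz n => nseq n.+1 (false, false)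
  end.

Definition word_conj (u v : gword bool) : gword bool := gword_inv v ++ u ++ v.

Definition word_comm (u v : gword bool) : gword bool :=
  gword_inv u ++ gword_inv v ++ u ++ v.

Definition lamplighter_rels : set (gword bool) :=
  [set word_comm word_a (word_conj word_a (word_b_exp i)) | i in [set: int]].

Definition lamplighter := presented lamplighter_rels.

HB.instance Definition _ := Group.on lamplighter.

End LamplighterGroup.

HB.mixin Record isLieAlgebra (F : fieldType) L of GRing.Lmodule F L := {
  lie : L -> L -> L;
  lieZDl : forall (a : F) (x y z : L),
    lie (a *: x + y)%R z = (a *: lie x z + lie y z)%R;
  lieZDr : forall (a : F) (x y z : L),
    lie z (a *: x + y)%R = (a *: lie z x + lie z y)%R;
  liexx : forall x, lie x x = 0%R;
  lie_jacobi : forall x y z,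
    (lie x (lie y z) + lie y (lie z x) + lie z (lie x y) = 0)%R }.

#[short(type="lieAlgType")]
HB.structure Definition LieAlgebra (F : fieldType) :=
  {L of isLieAlgebra F L & GRing.Lmodule F L}.

Section LieLowerCentralSeries.
Local Open Scope ring_scope.
Variables (F : fieldType) (L : lieAlgType F).
Implicit Types (x y z : L) (A : set L).

Definition is_subspace A : Prop :=
  A 0 /\ forall (a : F) x y, A x -> A y -> A (a *: x + y).

(* Same indexing convention as for [glcs].                                    *)
Fixpoint lie_lcs (n : nat) : set L :=
  if n is m.+1 then
    if m is 0 then setT
    else smallest is_subspace [set lie x y | x in setT & y in lie_lcs m]
  else setT.

Lemma lie0r x : lie x 0 = 0.
Proof.
have e := lieZDr 1 0 0 x; rewrite !scale1r addr0 in e.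
by apply: (addrI (lie x 0)); rewrite addr0 -e.
Qed.

Lemma lie0l x : lie 0 x = 0.
Proof.
have e := lieZDl 1 0 0 x; rewrite !scale1r addr0 in e.
by apply: (addrI (lie 0 x)); rewrite addr0 -e.
Qed.

Lemma lieDr x y z : lie x (y + z) = lie x y + lie x z.
Proof. by rewrite -[y]scale1r lieZDr !scale1r. Qed.

Lemma lieDl x y z : lie (x + y) z = lie x z + lie y z.
Proof. by rewrite -[x]scale1r lieZDl !scale1r. Qed.

Lemma lieNr x y : lie x (- y) = - lie x y.
Proof. by have := lieZDr (-1) y 0 x; rewrite !scaleN1r lie0r !addr0. Qed.

Lemma lieNl x y : lie (- x) y = - lie x y.
Proof. by have := lieZDl (-1) x 0 y; rewrite !scaleN1r lie0l !addr0. Qed.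

Lemma lieC x y : lie x y = - lie y x.
Proof.
apply/eqP; rewrite -addr_eq0; apply/eqP.
by have := liexx (x + y); rewrite lieDl !lieDr !liexx addr0 add0r.
Qed.

Lemma lie_lcsS n : (0 < n)%N ->
  lie_lcs n.+1 = smallest is_subspace [set lie x y | x in setT & y in lie_lcs n].
Proof. by case: n. Qed.

Lemma lie_lcs_subspace n : is_subspace (lie_lcs n).
Proof.
case: n => [|[|n]]; [by split | by split | rewrite lie_lcsS //].
split=> [A [[]]//|a x y Hx Hy A AH]; case: (AH) => -[_ h] _.
by apply: h; [apply: Hx | apply: Hy].
Qed.

Lemma lie_lcs0 n : lie_lcs n 0. Proof. by case: (lie_lcs_subspace n). Qed.

Lemma lie_lcsZD n (a : F) x y :
  lie_lcs n x -> lie_lcs n y -> lie_lcs n (a *: x + y).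
Proof. by case: (lie_lcs_subspace n) => _; apply. Qed.

Lemma lie_lcsD n x y : lie_lcs n x -> lie_lcs n y -> lie_lcs n (x + y).
Proof. by rewrite -{2}[x]scale1r; apply: lie_lcsZD. Qed.

Lemma lie_lcsZ n (a : F) x : lie_lcs n x -> lie_lcs n (a *: x).
Proof. by move=> Hx; rewrite -[_ *: _]addr0; apply/lie_lcsZD/lie_lcs0. Qed.

Lemma lie_lcsN n x : lie_lcs n x -> lie_lcs n (- x).
Proof. by rewrite -scaleN1r; apply: lie_lcsZ. Qed.

Lemma lie_lcsB n x y : lie_lcs n x -> lie_lcs n y -> lie_lcs n (x - y).
Proof. by move=> Hx Hy; apply/lie_lcsD/lie_lcsN. Qed.

Lemma lie_lcsR n x y : lie_lcs n y -> lie_lcs n.+1 (lie x y).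
Proof.
by case: n => [//|n] Hy; rewrite lie_lcsS // => A [_]; apply; exists x => //; exists y.
Qed.

Lemma lie_lcs_sub n : lie_lcs n.+1 `<=` lie_lcs n.
Proof.
elim: n => [//|n IHn]; case: n IHn => [//|n] IHn.
rewrite lie_lcsS // => z; apply; split; first exact: lie_lcs_subspace.
by move=> _ [x _ [y /IHn Hy <-]]; apply: lie_lcsR.
Qed.

Lemma lie_lcsL n x y : lie_lcs n x -> lie_lcs n (lie x y).
Proof. by move=> Hx; rewrite lieC; apply/lie_lcsN/lie_lcs_sub/lie_lcsR. Qed.

Lemma lie_lcs_le m n : (m <= n)%N -> lie_lcs n `<=` lie_lcs m.
Proof.
move=> /subnK <-; elim: (n - m)%N => [//|k IHk].
by rewrite addSn; apply: subset_trans IHk; apply: lie_lcs_sub.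
Qed.

End LieLowerCentralSeries.

Arguments lie_lcs {F L} n : simpl never.

Section LieQuotient.
Local Open Scope ring_scope.
Variables (F : fieldType) (L : lieAlgType F) (n : nat).
Implicit Types (x y z : L).

Definition lieq_rel x y : bool := `[< lie_lcs n (x - y) >].

Lemma lieq_rel_refl : reflexive lieq_rel.
Proof. by move=> x; apply/asboolP; rewrite subrr; apply: lie_lcs0. Qed.

Lemma lieq_rel_sym : symmetric lieq_rel.
Proof.
suff h x y : lieq_rel x y -> lieq_rel y x by move=> x y; apply/idP/idP; apply: h.
by move=> /asboolP/lie_lcsN; rewrite opprB => H; apply/asboolP.
Qed.

Lemma lieq_rel_trans : transitive lieq_rel.
Proof.
move=> y x z /asboolP Hxy /asboolP Hyz; apply/asboolP.
by have := lie_lcsD Hxy Hyz; rewrite addrA subrK.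
Qed.

Canonical lieq_equiv :=
  EquivRel lieq_rel lieq_rel_refl lieq_rel_sym lieq_rel_trans.

(* The quotient Lie algebra L / L^n.                                          *)
Definition lieq := {eq_quot lieq_equiv}.

HB.instance Definition _ := Choice.on lieq.
HB.instance Definition _ := EqQuotient.on lieq.

Definition lieq0 : lieq := \pi_lieq 0.
Definition lieq_opp (c : lieq) : lieq := \pi_lieq (- repr c).
Definition lieq_add (c d : lieq) : lieq := \pi_lieq (repr c + repr d).
Definition lieq_scale (a : F) (c : lieq) : lieq := \pi_lieq (a *: repr c).
Definition lieq_lie (c d : lieq) : lieq := \pi_lieq (lie (repr c) (repr d)).

Lemma lieq_eqP x y : lie_lcs n (x - y) -> \pi_lieq x = \pi_lieq y.
Proof. by move=> H; apply/eqmodP/asboolP. Qed.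

Lemma lieq_repr x : lie_lcs n (repr (\pi_lieq x) - x).
Proof.
by have /eqmodP/asboolP : \pi_lieq (repr (\pi_lieq x)) = \pi_lieq x by rewrite reprK.
Qed.

Lemma lieq_oppE x : lieq_opp (\pi_lieq x) = \pi_lieq (- x).
Proof. by apply: lieq_eqP; rewrite -opprD; apply/lie_lcsN/lieq_repr. Qed.

Lemma lieq_addE x y : lieq_add (\pi_lieq x) (\pi_lieq y) = \pi_lieq (x + y).
Proof.
by apply: lieq_eqP; rewrite opprD addrACA; apply: lie_lcsD; apply: lieq_repr.
Qed.

Lemma lieq_scaleE a x : lieq_scale a (\pi_lieq x) = \pi_lieq (a *: x).
Proof. by apply: lieq_eqP; rewrite -scalerBr; apply/lie_lcsZ/lieq_repr. Qed.

Lemma lieq_lieE x y : lieq_lie (\pi_lieq x) (\pi_lieq y) = \pi_lieq (lie x y).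
Proof.
apply: lieq_eqP; set x' := repr _; set y' := repr _.
have -> : lie x' y' - lie x y = lie (x' - x) y' + lie x (y' - y).
  by rewrite lieDl lieDr lieNl lieNr addrA subrK.
by apply: lie_lcsD; [apply: lie_lcsL | apply/lie_lcs_sub/lie_lcsR]; apply: lieq_repr.
Qed.

Lemma lieq_addA : associative lieq_add.
Proof.
elim/quotW=> x; elim/quotW=> y; elim/quotW=> z.
by rewrite (lieq_addE x y) (lieq_addE y z) !lieq_addE addrA.
Qed.

Lemma lieq_addC : commutative lieq_add.
Proof. by elim/quotW=> x; elim/quotW=> y; rewrite !lieq_addE addrC. Qed.

Lemma lieq_add0 : left_id lieq0 lieq_add.
Proof. by elim/quotW=> x; rewrite lieq_addE add0r. Qed.

Lemma lieq_addN : left_inverse lieq0 lieq_opp lieq_add.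
Proof. by elim/quotW=> x; rewrite lieq_oppE lieq_addE addNr. Qed.

HB.instance Definition _ :=
  GRing.isZmodule.Build lieq lieq_addA lieq_addC lieq_add0 lieq_addN.

Lemma lieq_scaleA a b c : lieq_scale a (lieq_scale b c) = lieq_scale (a * b) c.
Proof.
by elim/quotW: c => x; rewrite (lieq_scaleE b x) !lieq_scaleE scalerA.
Qed.

Lemma lieq_scale1 : left_id 1 lieq_scale.
Proof. by elim/quotW=> x; rewrite lieq_scaleE scale1r. Qed.

Lemma lieq_scaleDr : right_distributive lieq_scale lieq_add.
Proof.
move=> a; elim/quotW=> x; elim/quotW=> y.
by rewrite (lieq_scaleE a x) (lieq_scaleE a y) !lieq_addE lieq_scaleE scalerDr.
Qed.

Lemma lieq_scaleDl c : {morph lieq_scale^~ c : a b / a + b >-> lieq_add a b}.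
Proof.
move=> a b; elim/quotW: c => x.
by rewrite (lieq_scaleE a x) (lieq_scaleE b x) lieq_addE lieq_scaleE scalerDl.
Qed.

HB.instance Definition _ := GRing.Zmodule_isLmodule.Build F lieq
  lieq_scaleA lieq_scale1 lieq_scaleDr lieq_scaleDl.

Lemma pi_lieqZD a x y : \pi_lieq (a *: x + y) = a *: \pi_lieq x + \pi_lieq y.
Proof. by rewrite /GRing.add /GRing.scale /= lieq_scaleE lieq_addE. Qed.

Lemma lieq_lieZDl a c d e :
  lieq_lie (a *: c + d) e = a *: lieq_lie c e + lieq_lie d e.
Proof.
elim/quotW: c => x; elim/quotW: d => y; elim/quotW: e => z.
by rewrite -pi_lieqZD (lieq_lieE x z) (lieq_lieE y z) lieq_lieE lieZDl pi_lieqZD.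
Qed.

Lemma lieq_lieZDr a c d e :
  lieq_lie e (a *: c + d) = a *: lieq_lie e c + lieq_lie e d.
Proof.
elim/quotW: c => x; elim/quotW: d => y; elim/quotW: e => z.
by rewrite -pi_lieqZD (lieq_lieE z x) (lieq_lieE z y) lieq_lieE lieZDr pi_lieqZD.
Qed.

Lemma lieq_liexx c : lieq_lie c c = 0.
Proof. by elim/quotW: c => x; rewrite lieq_lieE liexx. Qed.

Lemma lieq_jacobi c d e :
  lieq_lie c (lieq_lie d e) + lieq_lie d (lieq_lie e c) +
  lieq_lie e (lieq_lie c d) = 0.
Proof.
elim/quotW: c => x; elim/quotW: d => y; elim/quotW: e => z.
rewrite (lieq_lieE y z) (lieq_lieE z x) (lieq_lieE x y).
rewrite (lieq_lieE x) (lieq_lieE y) (lieq_lieE z).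
by rewrite /GRing.add /= !lieq_addE lie_jacobi.
Qed.

HB.instance Definition _ := isLieAlgebra.Build F lieq
  lieq_lieZDl lieq_lieZDr lieq_liexx lieq_jacobi.

Lemma pi_lieq_lie x y : lie (\pi_lieq x) (\pi_lieq y) = \pi_lieq (lie x y).
Proof. exact: lieq_lieE. Qed.

End LieQuotient.

Section LieCompletion.
Local Open Scope ring_scope.
Variables (F : fieldType) (L : lieAlgType F).

Definition lieq_proj n (c : lieq L n.+1) : lieq L n := \pi_(lieq L n) (repr c).

Lemma lieq_projE n (x : L) : lieq_proj (\pi_(lieq L n.+1) x) = \pi_(lieq L n) x.
Proof. exact/lieq_eqP/lie_lcs_sub/lieq_repr. Qed.

(* The pronilpotent completion, with coordinatewise operations.               *)
Definition lie_completion := invlim lieq_proj.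

HB.instance Definition _ := Choice.on lie_completion.

Lemma lieq_projZD n a (c d : lieq L n.+1) :
  lieq_proj (a *: c + d) = a *: lieq_proj c + lieq_proj d.
Proof.
elim/quotW: c => x; elim/quotW: d => y.
by rewrite -pi_lieqZD !lieq_projE pi_lieqZD.
Qed.

Lemma lieq_proj_lie n (c d : lieq L n.+1) :
  lieq_proj (lie c d) = lie (lieq_proj c) (lieq_proj d).
Proof.
elim/quotW: c => x; elim/quotW: d => y.
by rewrite pi_lieq_lie !lieq_projE pi_lieq_lie.
Qed.

Lemma lieq_proj0 n : lieq_proj (0 : lieq L n.+1) = 0.
Proof. exact: lieq_projE. Qed.

Lemma lie_completionP (f : lie_completion) n : lieq_proj (val f n.+1) = val f n.
Proof. by move/asboolP: (valP f); apply. Qed.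

Lemma lc_zero_subproof : compatible lieq_proj (fun n => 0 : lieq L n).
Proof. by apply/asboolP => n; apply: lieq_proj0. Qed.

Lemma lc_opp_subproof (f : lie_completion) :
  compatible lieq_proj (fun n => - val f n).
Proof.
apply/asboolP => n; have := lieq_projZD (-1) (val f n.+1) 0.
by rewrite lieq_proj0 !scaleN1r !addr0 lie_completionP.
Qed.

Lemma lc_add_subproof (f g : lie_completion) :
  compatible lieq_proj (fun n => val f n + val g n).
Proof.
apply/asboolP => n; have := lieq_projZD 1 (val f n.+1) (val g n.+1).
by rewrite !scale1r !lie_completionP.
Qed.

Lemma lc_scale_subproof (a : F) (f : lie_completion) :
  compatible lieq_proj (fun n => a *: val f n).
Proof.
apply/asboolP => n; have := lieq_projZD a (val f n.+1) 0.
by rewrite lieq_proj0 !addr0 lie_completionP.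
Qed.

Lemma lc_lie_subproof (f g : lie_completion) :
  compatible lieq_proj (fun n => lie (val f n) (val g n)).
Proof. by apply/asboolP => n; rewrite lieq_proj_lie !lie_completionP. Qed.

Definition lc_zero : lie_completion :=
  exist _ (fun n => 0 : lieq L n) lc_zero_subproof.
Definition lc_opp (f : lie_completion) : lie_completion :=
  exist _ (fun n => - val f n) (lc_opp_subproof f).
Definition lc_add (f g : lie_completion) : lie_completion :=
  exist _ (fun n => val f n + val g n) (lc_add_subproof f g).
Definition lc_scale (a : F) (f : lie_completion) : lie_completion :=
  exist _ (fun n => a *: val f n) (lc_scale_subproof a f).
Definition lc_lie (f g : lie_completion) : lie_completion :=
  exist _ (fun n => lie (val f n) (val g n)) (lc_lie_subproof f g).

Lemma lie_completion_eqP (f g : lie_completion) :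
  (forall n, val f n = val g n) -> f = g.
Proof. by move=> fg; apply/val_inj/functional_extensionality_dep. Qed.

Lemma lc_addA : associative lc_add.
Proof. by move=> f g h; apply: lie_completion_eqP => n; apply: addrA. Qed.
Lemma lc_addC : commutative lc_add.
Proof. by move=> f g; apply: lie_completion_eqP => n; apply: addrC. Qed.
Lemma lc_add0 : left_id lc_zero lc_add.
Proof. by move=> f; apply: lie_completion_eqP => n; apply: add0r. Qed.
Lemma lc_addN : left_inverse lc_zero lc_opp lc_add.
Proof. by move=> f; apply: lie_completion_eqP => n; apply: addNr. Qed.

HB.instance Definition _ :=
  GRing.isZmodule.Build lie_completion lc_addA lc_addC lc_add0 lc_addN.

Lemma lc_scaleA a b f : lc_scale a (lc_scale b f) = lc_scale (a * b) f.
Proof. by apply: lie_completion_eqP => n; apply: scalerA. Qed.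
Lemma lc_scale1 : left_id 1 lc_scale.
Proof. by move=> f; apply: lie_completion_eqP => n; apply: scale1r. Qed.
Lemma lc_scaleDr : right_distributive lc_scale lc_add.
Proof. by move=> a f g; apply: lie_completion_eqP => n; apply: scalerDr. Qed.
Lemma lc_scaleDl f : {morph lc_scale^~ f : a b / a + b >-> lc_add a b}.
Proof. by move=> a b; apply: lie_completion_eqP => n; apply: scalerDl. Qed.

HB.instance Definition _ := GRing.Zmodule_isLmodule.Build F lie_completion
  lc_scaleA lc_scale1 lc_scaleDr lc_scaleDl.

Lemma lc_lieZDl a f g h :
  lc_lie (a *: f + g) h = a *: lc_lie f h + lc_lie g h.
Proof. by apply: lie_completion_eqP => n; apply: lieZDl. Qed.
Lemma lc_lieZDr a f g h :
  lc_lie h (a *: f + g) = a *: lc_lie h f + lc_lie h g.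
Proof. by apply: lie_completion_eqP => n; apply: lieZDr. Qed.
Lemma lc_liexx f : lc_lie f f = 0.
Proof. by apply: lie_completion_eqP => n; apply: liexx. Qed.
Lemma lc_jacobi f g h :
  lc_lie f (lc_lie g h) + lc_lie g (lc_lie h f) + lc_lie h (lc_lie f g) = 0.
Proof. by apply: lie_completion_eqP => n; apply: lie_jacobi. Qed.

HB.instance Definition _ := isLieAlgebra.Build F lie_completion
  lc_lieZDl lc_lieZDr lc_liexx lc_jacobi.

Lemma to_lie_completion_subproof (x : L) :
  compatible lieq_proj (fun n => \pi_(lieq L n) x).
Proof. by apply/asboolP => n; apply: lieq_projE. Qed.

Definition to_lie_completion (x : L) : lie_completion :=
  exist _ (fun n => \pi_(lieq L n) x) (to_lie_completion_subproof x).

Definition pronilpotent : Prop := bijective to_lie_completion.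

End LieCompletion.

Section BCH.
Local Open Scope ring_scope.
Variables (F : fieldType) (L : lieAlgType F).
Implicit Types (u v w : L).

(* [x1, [x2, ... [x_(m-1), x_m]]]                                             *)
Fixpoint lie_nest (s : seq L) : L :=
  match s with
  | [::] => 0
  | [:: x] => x
  | x :: s' => lie x (lie_nest s')
  end.

(* The homogeneous component of degree n of log(exp u exp v), in Dynkin's     *)
(* form: p runs over the sequences (r_1, s_1), ..., (r_k, s_k) of pairs of    *)
(* naturals with r_i + s_i > 0 and total sum n, and contributes the nested    *)
(* bracket of u^r_1 v^s_1 ... u^r_k v^s_k.                                    *)
Definition bch_index k n (p : {ffun 'I_k -> 'I_n.+1 * 'I_n.+1}) : bool :=
  [forall i, 0 < (p i).1 + (p i).2]%N &&
  (\sum_(i < k) ((p i).1 + (p i).2) == n)%N.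

Definition bch_word k n (p : {ffun 'I_k -> 'I_n.+1 * 'I_n.+1}) u v : seq L :=
  flatten [seq nseq (p i).1 u ++ nseq (p i).2 v | i <- enum 'I_k].

Definition bch_term (n : nat) u v : L :=
  \sum_(1 <= k < n.+1) ((-1) ^+ k.-1 / k%:R) *:
    \sum_(p : {ffun 'I_k -> 'I_n.+1 * 'I_n.+1} | bch_index p)
      (n * \prod_(i < k) ((p i).1`! * (p i).2`!))%:R^-1 *:
        lie_nest (bch_word p u v).

(* Convergence of the partial sums to [w] in the topology of the L^N.         *)
Definition bch_converges u v w : Prop :=
  forall N, exists M, forall m, (M <= m)%N ->
    lie_lcs N (w - \sum_(1 <= n < m.+1) bch_term n u v).

Definition bch u v : L := xget 0 [set w | bch_converges u v w].

Lemma lie_nest_lcs (s : seq L) : lie_lcs (size s) (lie_nest s).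
Proof. by elim: s => [//|x [//|y s] IHs]; apply: lie_lcsR. Qed.

Lemma lie_lcs_sum n I (r : seq I) (P : pred I) (f : I -> L) :
  (forall i, P i -> lie_lcs n (f i)) -> lie_lcs n (\sum_(i <- r | P i) f i).
Proof.
move=> H; elim/big_ind: _ => //; first exact: lie_lcs0.
by move=> x y; apply: lie_lcsD.
Qed.

Lemma bch_term_lcs n u v : lie_lcs n (bch_term n u v).
Proof.
apply: lie_lcs_sum => k _; apply/lie_lcsZ/lie_lcs_sum => p /andP[_ /eqP pn].
apply: lie_lcsZ; suff e : size (bch_word p u v) = n.
  by have := lie_nest_lcs (bch_word p u v); rewrite e.
rewrite size_flatten /shape -map_comp sumnE big_map big_enum /= -[RHS]pn.
by apply: eq_bigr => i _; rewrite size_cat !size_nseq.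
Qed.

Lemma bch_converges_ex u v : pronilpotent L -> exists w, bch_converges u v w.
Proof.
pose S m := \sum_(1 <= n < m.+1) bch_term n u v.
have SP N m : (N <= m)%N -> lie_lcs N (S m - S N).
  move=> Nm; rewrite /S (@big_cat_nat _ _ _ N.+1) //= addrAC subrr add0r.
  rewrite big_nat_cond; apply: lie_lcs_sum => n /andP[/andP[Nn _] _].
  exact: (lie_lcs_le (ltnW Nn) (bch_term_lcs n u v)).
have Sc : compatible (@lieq_proj F L) (fun n => \pi_(lieq L n) (S n)).
  by apply/asboolP => n; rewrite lieq_projE; apply/lieq_eqP/SP.
case=> g _ /(_ (exist _ (fun n => \pi_(lieq L n) (S n)) Sc)).
set w := g _ => gK; exists w => N; exists N => m Nm.
have /eqmodP/asboolP wN : \pi_(lieq L N) w = \pi_(lieq L N) (S N).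
  by rewrite -[LHS]/(val (to_lie_completion w) N) gK.
rewrite -/(S m) -(subrKA (S N)); apply: lie_lcsD => //.
by rewrite -opprB; apply/lie_lcsN/SP.
Qed.

Lemma bchP u v w : pronilpotent L -> bch_converges u v w <-> bch u v = w.
Proof.
move=> Lp; have cv : bch_converges u v (bch u v).
  by have [w' Hw'] := bch_converges_ex u v Lp; rewrite /bch; case: xgetP => // /(_ w').
split=> [cw|<- //].
apply: (bij_inj Lp); apply: lie_completion_eqP => N; apply: lieq_eqP.
have [M HM] := cv N; have [M' HM'] := cw N.
have := lie_lcsB (HM _ (leq_maxl M M')) (HM' _ (leq_maxr M M')).
by rewrite opprB addrA subrK.
Qed.

End BCH.

(* [E] is pronilpotent and [gT] is isomorphic to the group [(E, bch)]         *)
Definition malcev_lie_algebra (gT : groupType) (E : lieAlgType rat) : Prop :=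
  pronilpotent E /\
  exists phi : gT -> E,
    bijective phi /\ {morph phi : x y / (x * y)%g >-> bch x y}.

Section LamplighterLieAlgebra.
Local Open Scope ring_scope.

(* The pair (p, s) stands for p + s t.                                        *)
Definition lamplighter_lie := ({poly rat} * rat^o)%type.

HB.instance Definition _ := GRing.Lmodule.on lamplighter_lie.

(* [p + s t, q + r t] = r [p, t] - s [q, t] with [p, t] = 'X * p.             *)
Definition lamp_bracket (f g : lamplighter_lie) : lamplighter_lie :=
  (g.2 *: ('X * f.1) - f.2 *: ('X * g.1), 0).

Lemma lamp_bracketZDl a f g h :
  lamp_bracket (a *: f + g) h = a *: lamp_bracket f h + lamp_bracket g h.
Proof.
congr pair => /=; last by rewrite scaler0 addr0.
rewrite mulrDr -scalerAr scalerDr scalerDl scalerBr !scalerA opprD addrACA.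
by rewrite [h.2 * a]mulrC.
Qed.

Lemma lamp_bracketC f g : lamp_bracket f g = - lamp_bracket g f.
Proof. by congr pair; rewrite /= ?opprB ?oppr0. Qed.

Lemma lamp_bracketZDr a f g h :
  lamp_bracket h (a *: f + g) = a *: lamp_bracket h f + lamp_bracket h g.
Proof.
by rewrite lamp_bracketC lamp_bracketZDl opprD -scalerN -!lamp_bracketC.
Qed.

Lemma lamp_bracketxx f : lamp_bracket f f = 0.
Proof. by congr pair; rewrite /= subrr. Qed.

Lemma lamp_jacobi f g h :
  lamp_bracket f (lamp_bracket g h) + lamp_bracket g (lamp_bracket h f) +
  lamp_bracket h (lamp_bracket f g) = 0.
Proof.
congr pair; rewrite /= ?addr0 // !scale0r !sub0r.
rewrite !mulrBr -!scalerAr !scalerBr !scalerA.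
rewrite (mulrC g.2 h.2) (mulrC h.2 f.2) (mulrC f.2 g.2).
by rewrite !opprB [X in X + _]addrC subrKA -[X in _ + X]opprB subrr.
Qed.

HB.instance Definition _ := isLieAlgebra.Build rat lamplighter_lie
  lamp_bracketZDl lamp_bracketZDr lamp_bracketxx lamp_jacobi.

End LamplighterLieAlgebra.

(* Main.v *)
Require Import Defs.
From HB Require Import structures.
From mathcomp Require Import all_boot all_order all_algebra.
From mathcomp Require Import boolp classical_sets.
From mathcomp Require Import ring zify.

(* Everything is compared with the group M = Q[[x]] x| Q, where s in Q acts   *)
(* on Q[[x]] as multiplication by e^(-sx).                                    *)
(*                                                                            *)
(* Lie side: the completion of L is Q[[x]] x| Q t, and the nested brackets of *)
(* Dynkin's series are entries of products of triangular 3 x 3 matrices. The  *)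
(* series thus becomes an entry of log(exp U exp V), which is evaluated in    *)
(* closed form: (p, s) |-> ((e^(-sx) - 1) / (-sx) * p, s) takes the BCH       *)
(* product to the product of M.                                               *)
(*                                                                            *)
(* Group side: the lamplighter group G maps to M with a |-> (1, 0) and        *)
(* b |-> (0, 1), and its lower central series is the trace of the x-adic      *)
(* filtration. In Ghat every element has, modulo each term of the lower       *)
(* central series, a power in the image of G, and roots are unique. Hence the *)
(* elements whose powers are approximated by products of conjugates of a form *)
(* an abelian normal subgroup N, which contains the commutator subgroup and   *)
(* is identified with Q[[x]]. An element y of Ghat commutes with b modulo     *)
(* [Ghat, Ghat], so its action on N commutes with that of b, which is         *)
(* multiplication by e^x; therefore y acts by a scalar, a root of a power of  *)
(* e^x, that is by some e^(sx). The pair of s and of the commutator of y and  *)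
(* b, a cocycle, then determines y.                                           *)

Set Implicit Arguments.
Unset Strict Implicit.
Unset Printing Implicit Defensive.

Import Order.TTheory GRing.Theory Num.Theory.

Local Open Scope ring_scope.
Local Open Scope classical_set_scope.
Local Open Scope quotient_scope.

(** * Power series over Q *)

(** Both sides are recognized as the same concrete group [lamp_model], and the isomorphism is the
    resulting comparison of coordinates.

    On the Lie side, bracketing with t is multiplication by x up to sign, so the n-th term of the
    lower central series is x^(n-1) Q[[x]] for n >= 2 ([lie_lcs_coords], [coords_lie_lcs]). A nested
    bracket of u's and v's is linear in [crd u] and [crd v], with coefficients read off a product of
    matrices ([lie_nest_dynkin]); Dynkin's series is then the expansion of one entry of a matrix
    logarithm ([log_dynkin_eqm]), and summing it gives [bch_convergesP].

    On the group side, beyond the abelianization the graded pieces of the lamplighter group are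
    generated by [b, [b, ... [b, a]]], whose images in the model have leading term x^k up to sign;
    hence [lamp_filt_glcs]. The completion hypothesis only speaks of graded pieces; [iota_inj] and
    [iota_root] turn it into approximations of elements of Ghat by elements of the lamplighter
    group. They yield an abelian normal subgroup with an isomorphism [theta] onto Q[[x]], on which
    Ghat acts as prescribed ([thetaJ]). No splitting of Ghat over this subgroup is given beforehand,
    so the first coordinate p of y is reached through [kappa y], a commutator with b, whose value is
    (1 - e^(-x)) p. Multiplication by 1 - e^(-x) maps Q[[x]] bijectively onto x Q[[x]], so nothing
    is lost ([gslope_kappa_inj], [gslope_kappa_surj]). *)

Definition ps := nat -> rat.

HB.instance Definition _ := gen_eqMixin ps.
HB.instance Definition _ := gen_choiceMixin ps.

Section PowerSeriesRing.
Implicit Types f g h : ps.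

Definition ps_add f g : ps := fun n => f n + g n.
Definition ps_opp f : ps := fun n => - f n.
Definition ps_zero : ps := fun _ => 0.
Definition ps_const (a : rat) : ps := fun n => a *+ (n == 0%N).
Definition ps_mul f g : ps := fun n => \sum_(i < n.+1) f i * g (n - i)%N.

Lemma psP f g : (forall n, f n = g n) -> f = g.
Proof. exact: funext. Qed.

Lemma ps_addA : associative ps_add.
Proof. by move=> f g h; apply: psP => n; apply: addrA. Qed.
Lemma ps_addC : commutative ps_add.
Proof. by move=> f g; apply: psP => n; apply: addrC. Qed.
Lemma ps_add0 : left_id ps_zero ps_add.
Proof. by move=> f; apply: psP => n; apply: add0r. Qed.
Lemma ps_addN : left_inverse ps_zero ps_opp ps_add.
Proof. by move=> f; apply: psP => n; apply: addNr. Qed.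

HB.instance Definition _ :=
  GRing.isZmodule.Build ps ps_addA ps_addC ps_add0 ps_addN.

Definition ps_trunc N f : {poly rat} := \poly_(i < N) f i.

(* A coefficient of a product only sees truncations, so the ring axioms are   *)
(* inherited from polynomials.                                                *)
Lemma ps_mul_trunc N f g n : (n < N)%N ->
  ps_mul f g n = (ps_trunc N f * ps_trunc N g)`_n.
Proof.
move=> nN; rewrite coefM; apply: eq_bigr => i _; rewrite !coef_poly.
by rewrite !ifT //; have := ltn_ord i; lia.
Qed.

Lemma ps_mul_truncl N f (P : {poly rat}) g n : (n < N)%N ->
  (forall i, (i < N)%N -> f i = P`_i) -> ps_mul f g n = (P * ps_trunc N g)`_n.
Proof.
move=> nN fP; rewrite coefM; apply: eq_bigr => i _; rewrite coef_poly.
by rewrite ifT ?fP //; have := ltn_ord i; lia.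
Qed.

Lemma ps_mulC : commutative ps_mul.
Proof.
by move=> f g; apply: psP => n; rewrite !(ps_mul_trunc _ _ (ltnSn n)) mulrC.
Qed.

Lemma ps_mulA : associative ps_mul.
Proof.
move=> f g h; apply: psP => n; rewrite ps_mulC.
have tM a b i : (i < n.+1)%N ->
    ps_mul a b i = (ps_trunc n.+1 a * ps_trunc n.+1 b)`_i.
  by move=> iN; apply: ps_mul_trunc.
rewrite (ps_mul_truncl f (ltnSn n) (tM g h)) (ps_mul_truncl h (ltnSn n) (tM f g)).
by rewrite mulrC mulrA.
Qed.

Lemma ps_mul1 : left_id (ps_const 1) ps_mul.
Proof.
move=> f; apply: psP => n; rewrite /ps_mul big_ord_recl subn0 mul1r big1 ?addr0 //.
by move=> i _; rewrite mul0r.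
Qed.

Lemma ps_mulDl : left_distributive ps_mul ps_add.
Proof.
move=> f g h; apply: psP => n; rewrite /ps_mul /ps_add -big_split.
by apply: eq_bigr => i _; rewrite mulrDl.
Qed.

Lemma ps_1neq0 : ps_const 1 != ps_zero.
Proof. by apply/eqP => /(congr1 (@^~ 0%N))/eqP. Qed.

HB.instance Definition _ := GRing.Zmodule_isComNzRing.Build ps
  ps_mulA ps_mulC ps_mul1 ps_mulDl ps_1neq0.

Lemma psD f g n : (f + g) n = f n + g n. Proof. by []. Qed.
Lemma psN f n : (- f) n = - f n. Proof. by []. Qed.
Lemma psB f g n : (f - g) n = f n - g n. Proof. by []. Qed.
Lemma ps0 n : (0 : ps) n = 0. Proof. by []. Qed.
Lemma ps1 n : (1 : ps) n = (n == 0%N)%:R. Proof. by []. Qed.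
Lemma psM f g n : (f * g) n = \sum_(i < n.+1) f i * g (n - i)%N.
Proof. by []. Qed.
Lemma psM0 f g : (f * g) 0%N = f 0%N * g 0%N.
Proof. by rewrite psM big_ord_recl big_ord0 addr0. Qed.

Lemma ps_sum I (r : seq I) (P : pred I) (F : I -> ps) n :
  (\sum_(i <- r | P i) F i) n = \sum_(i <- r | P i) F i n.
Proof. by elim/big_rec2: _ => [//|i y z _ <-]. Qed.

Lemma psC_mul a f n : (ps_const a * f) n = a * f n.
Proof.
rewrite psM big_ord_recl subn0 big1 ?addr0 // => i _.
by rewrite /ps_const mul0r.
Qed.

Lemma ps_const_is_zmod : zmod_morphism ps_const.
Proof. by move=> a b; apply: psP => n; rewrite psB /ps_const mulrnBl. Qed.

Lemma ps_const_is_monoid : monoid_morphism ps_const.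
Proof.
split=> // a b; apply: psP => n; rewrite psC_mul /ps_const.
by rewrite mulrnAr.
Qed.

HB.instance Definition _ := GRing.isZmodMorphism.Build rat ps ps_const ps_const_is_zmod.
HB.instance Definition _ := GRing.isMonoidMorphism.Build rat ps ps_const ps_const_is_monoid.

Definition psX : ps := fun n => (n == 1%N)%:R.

Lemma psX_mul0 f : (psX * f) 0%N = 0.
Proof. by rewrite psM0 mul0r. Qed.

Lemma psX_mulS f n : (psX * f) n.+1 = f n.
Proof.
rewrite psM big_ord_recl mul0r add0r big_ord_recl /= mul1r subSS subn0.
by rewrite big1 ?addr0 // => i _; rewrite /psX /= mul0r.
Qed.

Lemma psX_inj f g : psX * f = psX * g -> f = g.
Proof. by move=> fg; apply: psP => n; rewrite -(psX_mulS f) -(psX_mulS g) fg. Qed.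

Lemma psX_exp_mul k f n : (psX ^+ k * f) n = if (n < k)%N then 0 else f (n - k)%N.
Proof.
elim: k n => [|k IHk] n; first by rewrite mul1r subn0.
rewrite exprS -mulrA; case: n => [|n]; first by rewrite psX_mul0.
by rewrite psX_mulS IHk ltnS subSS.
Qed.

Lemma psX_exp k n : (psX ^+ k) n = (n == k)%:R.
Proof.
rewrite -[_ ^+ k]mulr1 psX_exp_mul ps1; case: ltngtP => // [kn|->]; last by rewrite subnn.
by rewrite subn_eq0 leqNgt kn.
Qed.

Lemma ps_divX f : f 0%N = 0 -> exists g, f = psX * g.
Proof.
move=> f0; exists (fun n => f n.+1); apply: psP => -[|n]; first by rewrite psX_mul0.
by rewrite psX_mulS.
Qed.

(** The first n coefficients of the inverse are kept as a list, so that structural recursion can use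
    all of them to compute the next one. *)
Fixpoint ps_inv_rec f n : seq rat :=
  if n is m.+1 then
    let s := ps_inv_rec f m in
    rcons s (((m == 0%N)%:R - \sum_(i < m) s`_i * f (m - i)%N) / f 0%N)
  else [::].

Lemma size_ps_inv_rec f n : size (ps_inv_rec f n) = n.
Proof. by elim: n => //= n IHn; rewrite size_rcons IHn. Qed.

Lemma nth_ps_inv_rec f n m i : (i < n <= m)%N ->
  (ps_inv_rec f m)`_i = (ps_inv_rec f n)`_i.
Proof.
move=> /andP[iN]; elim: m => [|m IHm]; first by case: n iN.
rewrite leq_eqVlt => /predU1P[->//|]; rewrite ltnS => nm /=.
by rewrite nth_rcons size_ps_inv_rec (leq_trans iN nm) IHm.
Qed.

Lemma ps_inv f : f 0%N != 0 -> exists g, g * f = 1.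
Proof.
move=> f0; pose g : ps := fun n => (ps_inv_rec f n.+1)`_n.
exists g; apply: psP => n; rewrite psM big_ord_recr /= subnn ps1.
rewrite [g n]/g /= nth_rcons size_ps_inv_rec ltnn eqxx divfK //.
rewrite (eq_bigr (fun i : 'I_n => (ps_inv_rec f n)`_i * f (n - i)%N)) ?addrNK.
  by rewrite addrC subrK.
by move=> i _; rewrite /g (@nth_ps_inv_rec _ i.+1 n) // ltnSn ltn_ord.
Qed.

Lemma ps_unit_inj f g h : f 0%N != 0 -> f * g = f * h -> g = h.
Proof.
by move=> /ps_inv[f' ff'] e; rewrite -[g]mul1r -[h]mul1r -ff' -!mulrA e.
Qed.

Definition ps_deriv f : ps := fun n => n.+1%:R * f n.+1.

Lemma ps_derivD f g : ps_deriv (f + g) = ps_deriv f + ps_deriv g.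
Proof. by apply: psP => n; rewrite psD /ps_deriv psD mulrDr. Qed.

Lemma ps_derivM f g : ps_deriv (f * g) = ps_deriv f * g + f * ps_deriv g.
Proof.
have dT h n i : (i < n.+1)%N -> ps_deriv h i = (ps_trunc n.+2 h)^`()`_i.
  by move=> iN; rewrite coef_deriv coef_poly /ps_deriv ltnS iN mulr_natl.
apply: psP => n; rewrite psD [f * ps_deriv g]mulrC.
rewrite -[(ps_deriv f * g) n]/(ps_mul _ _ n) -[(ps_deriv g * f) n]/(ps_mul _ _ n).
rewrite (ps_mul_truncl g (ltnSn n) (dT f n)) (ps_mul_truncl f (ltnSn n) (dT g n)).
rewrite /ps_deriv -[(f * g) _]/(ps_mul f g _) (ps_mul_trunc f g (ltnSn n.+1)).
rewrite mulr_natl -coef_deriv derivM coefD [ps_trunc n.+2 f * _]mulrC.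
rewrite !coefM; congr (_ + _); apply: eq_bigr => i _; rewrite !coef_poly.
  by congr (_ * _); rewrite !ifT //; have := ltn_ord i; lia.
by congr (_ * _); rewrite !ifT //; have := ltn_ord i; lia.
Qed.

Lemma ps_deriv_const a : ps_deriv (ps_const a) = 0.
Proof. by apply: psP => n; rewrite /ps_deriv /ps_const mulr0. Qed.

Lemma ps_deriv1 : ps_deriv 1 = 0.
Proof. exact: ps_deriv_const. Qed.

Lemma psX_deriv f n : (psX * ps_deriv f) n = n%:R * f n.
Proof. by case: n => [|n]; rewrite ?psX_mul0 ?mul0r ?psX_mulS. Qed.

Lemma ps_derivXn f k : ps_deriv (f ^+ k.+1) = k.+1%:R * f ^+ k * ps_deriv f.
Proof.
elim: k => [|k IHk]; first by rewrite !mul1r.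
by rewrite exprS ps_derivM IHk exprS [k.+2%:R]mulrS; ring.
Qed.

End PowerSeriesRing.

(** * Exponential series *)

Section Exponential.
Implicit Types s r : rat.

Definition ps_exp s : ps := fun n => s ^+ n / n`!%:R.

(* (e^(sx) - 1) / (sx), equal to 1 for s = 0                                  *)
Definition ps_expq s : ps := fun n => s ^+ n / n.+1`!%:R.

Lemma fact_neq0 n : n`!%:R != 0 :> rat.
Proof. by rewrite pnatr_eq0 -lt0n fact_gt0. Qed.

Lemma ps_exp0 : ps_exp 0 = 1.
Proof.
apply: psP => -[|n]; rewrite /ps_exp ps1 ?expr0 ?fact0 ?divr1 //.
by rewrite exprS !mul0r.
Qed.

Lemma ps_exp_coef0 s : ps_exp s 0%N = 1. Proof. by rewrite /ps_exp divr1. Qed.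
Lemma ps_expq_coef0 s : ps_expq s 0%N = 1. Proof. by rewrite /ps_expq divr1. Qed.

Lemma ps_expD s r : ps_exp (s + r) = ps_exp s * ps_exp r.
Proof.
apply: psP => n; rewrite psM /ps_exp addrC exprDn mulr_suml.
apply: eq_bigr => i _; have iN : (i <= n)%N by rewrite -ltnS.
rewrite -(bin_fact iN) -mulr_natr !natrM.
have := fact_neq0 i; have := fact_neq0 (n - i); have : 'C(n, i)%:R != 0 :> rat.
  by rewrite pnatr_eq0 -lt0n bin_gt0.
by move=> h1 h2 h3; field; rewrite h1 h2 h3.
Qed.

Lemma ps_expE s : ps_exp s = 1 + ps_const s * psX * ps_expq s.
Proof.
apply: psP => n; rewrite psD -mulrA psC_mul ps1; case: n => [|n].
  by rewrite psX_mul0 mulr0 addr0 /ps_exp divr1.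
by rewrite psX_mulS add0r /ps_exp /ps_expq exprS mulrA.
Qed.

Lemma ps_deriv_exp s : ps_deriv (ps_exp s) = ps_const s * ps_exp s.
Proof.
apply: psP => n; rewrite psC_mul /ps_deriv /ps_exp factS natrM exprS.
have := fact_neq0 n; have : n.+1%:R != 0 :> rat by rewrite pnatr_eq0.
move: n.+1%:R n`!%:R => N F N0 F0; field.
by rewrite N0 F0.
Qed.

(** This is (x q)' = e^(sx) for q = (e^(sx) - 1) / (sx); on coefficients it needs no division by s
    and so covers s = 0. *)
Lemma ps_deriv_expq s : psX * ps_deriv (ps_expq s) = ps_exp s - ps_expq s.
Proof.
apply: psP => -[|n]; first by rewrite psX_mul0 psB ps_exp_coef0 ps_expq_coef0 subrr.
rewrite psX_mulS psB /ps_deriv /ps_exp /ps_expq [n.+2`!]factS natrM.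
have := fact_neq0 n.+1; have : n.+2%:R != 0 :> rat by rewrite pnatr_eq0.
have -> : n.+1%:R = n.+2%:R - 1 :> rat by rewrite [n.+2%:R]mulrS addrAC subrr add0r.
by move: n.+2%:R n.+1`!%:R => N F N0 F0; field; rewrite N0 F0.
Qed.

Lemma ps_expN s : ps_exp s * ps_exp (- s) = 1.
Proof. by rewrite -ps_expD subrr ps_exp0. Qed.

End Exponential.

(** * Congruence of power series modulo x^n *)

Definition ps_eqm n (f g : ps) : Prop := forall i, (i < n)%N -> f i = g i.

Section Congruence.
Implicit Types (f g h : ps) (n : nat).

Lemma ps_eqm_sym n f g : ps_eqm n f g -> ps_eqm n g f.
Proof. by move=> fg i iN; rewrite fg. Qed.

Lemma ps_eqm_trans n f g h : ps_eqm n f g -> ps_eqm n g h -> ps_eqm n f h.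
Proof. by move=> fg gh i iN; rewrite fg ?gh. Qed.

Lemma ps_eqmD n f f' g g' : ps_eqm n f f' -> ps_eqm n g g' -> ps_eqm n (f + g) (f' + g').
Proof. by move=> ff' gg' i iN; rewrite !psD ff' ?gg'. Qed.

Lemma ps_eqmN n f f' : ps_eqm n f f' -> ps_eqm n (- f) (- f').
Proof. by move=> ff' i iN; rewrite !psN ff'. Qed.

Lemma ps_eqmB n f f' g g' : ps_eqm n f f' -> ps_eqm n g g' -> ps_eqm n (f - g) (f' - g').
Proof. by move=> ff' gg'; apply/ps_eqmD/ps_eqmN. Qed.

Lemma ps_eqmM n f f' g g' : ps_eqm n f f' -> ps_eqm n g g' -> ps_eqm n (f * g) (f' * g').
Proof.
move=> ff' gg' i iN; rewrite !psM; apply: eq_bigr => j _.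
by rewrite ff' ?gg' //; have := ltn_ord j; lia.
Qed.

Lemma ps_eqm_sum n I (r : seq I) (P : pred I) (F F' : I -> ps) :
  (forall i, P i -> ps_eqm n (F i) (F' i)) ->
  ps_eqm n (\sum_(i <- r | P i) F i) (\sum_(i <- r | P i) F' i).
Proof.
move=> FF'; elim/big_rec2: _ => [//|i y z Pi yz].
by apply: ps_eqmD yz; apply: FF'.
Qed.

Lemma ps_eqm_le m n f g : (m <= n)%N -> ps_eqm n f g -> ps_eqm m f g.
Proof. by move=> mn fg i im; apply: fg; apply: leq_trans mn. Qed.

Lemma ps_eqmP f g : (forall n, ps_eqm n f g) -> f = g.
Proof. by move=> fg; apply: psP => n; apply: (fg n.+1). Qed.

Lemma ps_eqm_mulX n f g : ps_eqm n.+1 (psX * f) (psX * g) <-> ps_eqm n f g.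
Proof.
split=> fg i iN; first by rewrite -(psX_mulS f) -(psX_mulS g) fg.
by case: i iN => [|i] iN; rewrite ?psX_mul0 ?psX_mulS ?fg.
Qed.

Lemma ps_eqm_exp0 n f g : ps_eqm 1 f 0 -> ps_eqm n g 0 -> ps_eqm n.+1 (f * g) 0.
Proof.
move=> f0 g0 i iN; rewrite psM big_ord_recl f0 // mul0r add0r big1 // => j _.
by rewrite lift0 g0 ?mulr0 //; have := ltn_ord j; lia.
Qed.

End Congruence.

(** * Dynkin's series as a matrix logarithm *)

Section TriangularMatrices.
Variable R : comNzRingType.

Definition tri (a b c d e : R) : 'M[R]_3 :=
  \matrix_(i, j) (nth [::] [:: [:: a; b; c]; [:: 0; e; d]; [:: 0; 0; e]] i)`_j.

Lemma triM a b c d e a' b' c' d' e' :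
  tri a b c d e * tri a' b' c' d' e' =
  tri (a * a') (a * b' + b * e') (a * c' + b * d' + c * e') (e * d' + d * e') (e * e').
Proof.
apply/matrixP => -[[|[|[|i]]] iP] // -[[|[|[|j]]] jP] //;
  rewrite !mxE !big_ord_recl big_ord0 !mxE /=; ring.
Qed.

Lemma triD a b c d e a' b' c' d' e' :
  tri a b c d e + tri a' b' c' d' e' = tri (a + a') (b + b') (c + c') (d + d') (e + e').
Proof.
apply/matrixP => -[[|[|[|i]]] iP] // -[[|[|[|j]]] jP] //;
  rewrite !mxE /=; ring.
Qed.

Lemma triZ x a b c d e :
  x *: tri a b c d e = tri (x * a) (x * b) (x * c) (x * d) (x * e).
Proof.
apply/matrixP => -[[|[|[|i]]] iP] // -[[|[|[|j]]] jP] //;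
  rewrite !mxE /=; ring.
Qed.

Lemma tri0 : tri 0 0 0 0 0 = 0.
Proof. by apply/matrixP => -[[|[|[|i]]] iP] // -[[|[|[|j]]] jP] //; rewrite !mxE. Qed.

Lemma tri1 : tri 1 0 0 0 1 = 1.
Proof. by apply/matrixP => -[[|[|[|i]]] iP] // -[[|[|[|j]]] jP] //; rewrite !mxE. Qed.

Lemma tri_sum I (r : seq I) (a b c d e : I -> R) :
  \sum_(i <- r) tri (a i) (b i) (c i) (d i) (e i) =
  tri (\sum_(i <- r) a i) (\sum_(i <- r) b i) (\sum_(i <- r) c i)
      (\sum_(i <- r) d i) (\sum_(i <- r) e i).
Proof.
elim: r => [|i r IHr]; first by rewrite !big_nil tri0.
by rewrite !big_cons IHr triD.
Qed.

Lemma tri13 a b c d e : tri a b c d e ord0 ord_max = c.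
Proof. by rewrite mxE. Qed.

(** With zero diagonal the lower right 2 x 2 block squares to 0, so from the second power on only
    the first row survives. *)
Lemma tri_pow a b c d k :
  tri a b c d 0 ^+ k.+1 =
  tri (a ^+ k.+1) (a ^+ k * b) (a ^+ k * c + (a ^+ k.-1 * b * d) *+ (0 < k)%N)
      (d *+ (k == 0%N)) 0.
Proof.
elim: k => [|k IHk].
  by rewrite !expr1 !expr0 !mul1r mulr0n addr0 mulr1n.
rewrite exprS IHk triM !mulr0 mulr0n mul0r !addr0 /= mulr1n.
case: k {IHk} => [|k] /=; congr tri; rewrite ?exprS ?mulr1n ?mulr0n; ring.
Qed.

End TriangularMatrices.

Definition mx_eqm n (A B : 'M[ps]_3) : Prop := forall i j, ps_eqm n (A i j) (B i j).

Lemma mx_eqmM n A A' B B' : mx_eqm n A A' -> mx_eqm n B B' -> mx_eqm n (A * B) (A' * B').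
Proof.
by move=> AA' BB' i j; rewrite !mxE; apply: ps_eqm_sum => k _; apply: ps_eqmM.
Qed.

Lemma mx_eqmX n A A' k : mx_eqm n A A' -> mx_eqm n (A ^+ k) (A' ^+ k).
Proof.
by move=> AA'; elim: k => [|k IHk]; rewrite ?exprS //; apply: mx_eqmM.
Qed.

Lemma mx_eqm_tri n a b c d e a' b' c' d' e' :
  ps_eqm n a a' -> ps_eqm n b b' -> ps_eqm n c c' -> ps_eqm n d d' -> ps_eqm n e e' ->
  mx_eqm n (tri a b c d e) (tri a' b' c' d' e').
Proof.
move=> *; case=> [[|[|[|i]]] iP] //; case=> [[|[|[|j]]] jP] //; rewrite !mxE //.
Qed.

Definition ps_homog n (f : ps) : Prop := forall i, i != n -> f i = 0.

Lemma ps_homogE n f : ps_homog n f -> f = ps_const (f n) * psX ^+ n.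
Proof.
move=> fn; apply: psP => i; rewrite psC_mul psX_exp.
by case: eqP => [->|/eqP/fn->]; rewrite ?mulr1 ?mulr0.
Qed.

Lemma ps_homogM m n f g : ps_homog m f -> ps_homog n g -> ps_homog (m + n) (f * g).
Proof.
move=> fm gn i imn; rewrite psM big1 // => j _.
have [jm|/fm->] := eqVneq (j : nat) m; last by rewrite mul0r.
by rewrite gn ?mulr0 //; apply: contra_neq imn => <-; have := ltn_ord j; lia.
Qed.

Lemma ps_homog_const a : ps_homog 0 (ps_const a).
Proof. by move=> [|i]. Qed.

Lemma ps_homog_sum n I (r : seq I) (P : pred I) (F : I -> ps) :
  (forall i, P i -> ps_homog n (F i)) -> ps_homog n (\sum_(i <- r | P i) F i).
Proof. by move=> FP i iN; rewrite ps_sum big1 // => j /FP->. Qed.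

Section Logarithm.
Variable sigma : rat.
Let E := ps_expq sigma.
Let w := ps_const sigma * psX * E.

Definition log_quot n : ps := \sum_(k < n) ps_const ((-1) ^+ k / k.+1%:R) * w ^+ k.

(* The truncated series log(1 + w) / w inverts E, because the equality        *)
(* log(1 + w) = sigma x can be checked on derivatives.                        *)
Lemma log_quotE n : ps_eqm n (log_quot n * E) 1.
Proof.
have wE : 1 + w = ps_exp sigma by rewrite ps_expE.
have dw : ps_deriv w = ps_const sigma * (1 + w).
  by rewrite wE -ps_deriv_exp -wE ps_derivD ps_deriv1 add0r.
have w0 : ps_eqm 1 w 0 by case=> // _; rewrite /w -mulrA psC_mul psX_mul0 mulr0.
(* The argument by derivatives ends by cancelling [sigma], so the case 0 is separate. *)
have [s0|s0] := eqVneq sigma 0.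
  have E1 : E = 1.
    apply: psP => -[|i]; rewrite /E /ps_expq s0 ps1 ?expr0 ?divr1 //.
    by rewrite exprS !mul0r.
  case: n => [//|n]; rewrite E1 mulr1 /log_quot big_ord_recl big1 => [|i _].
    by rewrite addr0 expr0 mulr1 divr1 rmorph1.
  have -> : w = 0 by rewrite /w s0 rmorph0 !mul0r.
  by rewrite lift0 [0 ^+ _]exprS mul0r mulr0.
(* Differentiating the truncated logarithm gives w' times a geometric sum of -w, and w' = sigma (1 +
   w) makes it telescope. *)
have dl : ps_deriv (log_quot n * w) = ps_const sigma * (1 - (- w) ^+ n).
  rewrite -[1 - _]opprB subrX1 -opprB opprK.
  transitivity (\sum_(i < n) ps_const sigma * (1 + w) * (- w) ^+ i); last first.
    by rewrite -mulr_sumr; ring.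
  rewrite /log_quot mulr_suml; elim/big_rec2: _ => [|i y z _ <-].
    exact: ps_deriv_const 0.
  rewrite ps_derivD -mulrA -exprSr ps_derivM ps_deriv_const mul0r add0r.
  rewrite ps_derivXn dw [(- w) ^+ _]exprNn; congr (_ + _).
  have -> : ps_const ((-1) ^+ i / i.+1%:R) = (-1) ^+ i * ps_const (i.+1%:R^-1).
    by rewrite rmorphM rmorphXn rmorphN rmorph1.
  have c1 : ps_const i.+1%:R^-1 * i.+1%:R = 1.
    by rewrite -(rmorph_nat ps_const) -rmorphM mulVf ?rmorph1 // pnatr_eq0.
  by rewrite -[RHS]mulr1 -[X in _ = _ * X]c1; ring.
have wn m : ps_eqm m ((- w) ^+ m) 0.
  elim: m => [//|m IHm]; rewrite exprS; apply: ps_eqm_exp0 => //.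
  by rewrite -oppr0; apply: ps_eqmN.
move=> i iN.
have := dl; move/(congr1 (@^~ i)); rewrite /ps_deriv psC_mul psB wn // ps1.
have -> : log_quot n * w = psX * (ps_const sigma * (log_quot n * E)).
  by rewrite /w; ring.
rewrite psX_mulS psC_mul ps0 subr0.
case: i iN => [|i] iN; first by rewrite mul1r => /(mulfI s0).
by move/eqP; rewrite mulr0 !mulf_eq0 (negPf s0) pnatr_eq0 /= => /eqP.
Qed.

End Logarithm.

(** * Dynkin words as products of matrices *)

Section DynkinSeries.
Variables (A B b1 b2 : rat).

(** Left multiplication by this matrix imitates bracketing with a letter. [A] and [B] will be minus
    the slopes of u and v, and [(b1, b2)] is (1, 0) or (0, 1) according to whether the coefficient
    of [crd u] or of [crd v] is wanted. In the product over a nonempty word, the last column carries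
    x times this coefficient of the nested bracket, then -x times its slope. The opposite signs of
    the two [b] entries reflect [u, u] = 0. *)
Definition dynkin_letter (x : bool) : 'M[ps]_3 :=
  let a := if x then A else B in let b := if x then b1 else b2 in
  tri (ps_const a * psX) (- (ps_const b * psX)) (ps_const b * psX) (ps_const a * psX) 0.

Definition dynkin_word (s : seq bool) : 'M[ps]_3 := \prod_(x <- s) dynkin_letter x.

(** The power of x thus records the length of a bracket, so that the total degree in Dynkin's
    formula can be selected by taking a coefficient. *)
Lemma dynkin_word_homog s i j : ps_homog (size s) (dynkin_word s i j).
Proof.
elim: s i j => [|x s IHs] i j.
  rewrite /dynkin_word big_nil mxE => -[|k] //= _.
  by case: (i == j).
have hx k : ps_homog 1 (dynkin_letter x i k).
  rewrite /dynkin_letter; set a := if x then A else B; set b := if x then b1 else b2.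
  have h (q : rat) : ps_homog 1 (ps_const q * psX).
    by move=> m m1; rewrite psC_mul /psX (negPf m1) mulr0.
  have hN : ps_homog 1 (- (ps_const b * psX)) by move=> m /h; rewrite psN => ->; rewrite oppr0.
  by move: i k; case=> [[|[|[|i]]] iP] //; case=> [[|[|[|k]]] kP] //; rewrite mxE /=; auto.
rewrite /dynkin_word big_cons mxE; apply: ps_homog_sum => k _.
exact: (@ps_homogM 1 (size s)).
Qed.

Lemma dynkin_letterX x i :
  dynkin_letter x ^+ i =
  let a := if x then A else B in let b := if x then b1 else b2 in
  tri ((ps_const a * psX) ^+ i)
      (- (ps_const b * psX * (ps_const a * psX) ^+ i.-1) *+ (0 < i)%N)
      ((ps_const b * psX) *+ (i == 1%N)) ((ps_const a * psX) *+ (i == 1%N))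
      (i == 0%N)%:R.
Proof.
rewrite /=; set a := if x then A else B; set b := if x then b1 else b2.
case: i => [|i]; first by rewrite expr0 !mulr0n -tri1.
rewrite tri_pow eqSS /=; congr tri; rewrite ?mulr1n; first by ring.
by case: i => [|i]; rewrite /= ?mulr1n ?mulr0n ?exprS; ring.
Qed.

Definition exp_letter (x : bool) : 'M[ps]_3 :=
  let a := if x then A else B in let b := if x then b1 else b2 in
  tri (ps_exp a) (- (ps_const b * psX * ps_expq a)) (ps_const b * psX)
      (ps_const a * psX) 1.

Lemma ps_constX_exp a i j : ((ps_const a * psX) ^+ i) j = a ^+ i *+ (j == i).
Proof. by rewrite exprMn -rmorphXn psC_mul psX_exp mulr_natr. Qed.

(** The i-th power of a letter is homogeneous of degree i, so the truncated exponential is exact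
    modulo x^(n+2). The corner entry stops at i = 1, because the brackets [u, [u, ... u]] vanish. *)
Lemma exp_letter_eqm n x :
  mx_eqm n.+2 (\sum_(i < n.+2) ps_const (i`!%:R^-1) *: dynkin_letter x ^+ i) (exp_letter x).
Proof.
under eq_bigr do rewrite dynkin_letterX; rewrite /= /exp_letter.
set a := if x then A else B; set b := if x then b1 else b2.
under eq_bigr do rewrite triZ.
rewrite tri_sum; apply: mx_eqm_tri => j jN; rewrite ps_sum.
- rewrite (bigD1 (Ordinal jN)) //= psC_mul ps_constX_exp eqxx mulr1n big1.
    by rewrite addr0 mulrC.
  move=> i ij; rewrite psC_mul ps_constX_exp.
  by rewrite [_ == _]negbTE ?mulr0n ?mulr0 //; apply: contra_neq ij => ji; apply: val_inj.
- case: j jN => [|j] jN.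
    rewrite psN -mulrA psC_mul psX_mul0 mulr0 oppr0 big1 // => -[[|i] iP] _ /=.
      by rewrite psC_mul mulr0n ps0 mulr0.
    by rewrite psC_mul mulr1n -mulrA psN psC_mul psX_mul0 mulr0 oppr0 mulr0.
  rewrite (bigD1 (Ordinal jN)) //= psC_mul mulr1n psN -!mulrA psC_mul psX_mulS.
  rewrite ps_constX_exp eqxx mulr1n big1 ?addr0.
    by rewrite psN psC_mul psX_mulS /ps_expq; ring.
  move=> [[|i] iP] ij; first by rewrite psC_mul mulr0n ps0 mulr0.
  rewrite psC_mul mulr1n /= -mulrA psN psC_mul psX_mulS ps_constX_exp.
  have -> : (j == i) = false.
    by apply/eqP => ji; move/eqP: ij; apply; apply: val_inj => /=; rewrite ji.
  by rewrite mulr0n mulr0 oppr0 mulr0.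
- rewrite !big_ord_recl /= big1 => [|i _].
    by rewrite addr0 !psC_mul mulr0n mulr1n ps0 mulr0 add0r invr1 mul1r mulr1n psC_mul.
  by rewrite psC_mul mulr0n ps0 mulr0.
- rewrite !big_ord_recl /= big1 => [|i _].
    by rewrite addr0 !psC_mul mulr0n mulr1n ps0 mulr0 add0r invr1 mul1r mulr1n psC_mul.
  by rewrite psC_mul mulr0n ps0 mulr0.
- rewrite big_ord_recl /= big1 => [|i _]; last by rewrite psC_mul mulr0.
  by rewrite psC_mul addr0 fact0 invr1 mul1r.
Qed.

Definition bch_bool_word k n (p : {ffun 'I_k -> 'I_n.+1 * 'I_n.+1}) : seq bool :=
  flatten [seq nseq (p i).1 true ++ nseq (p i).2 false | i <- enum 'I_k].

Lemma size_bch_bool_word k n (p : {ffun 'I_k -> 'I_n.+1 * 'I_n.+1}) :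
  size (bch_bool_word p) = (\sum_(i < k) ((p i).1 + (p i).2))%N.
Proof.
rewrite size_flatten /shape -map_comp sumnE big_map big_enum /=.
by apply: eq_bigr => i _; rewrite size_cat !size_nseq.
Qed.

Lemma dynkin_bool_word k n (p : {ffun 'I_k -> 'I_n.+1 * 'I_n.+1}) :
  dynkin_word (bch_bool_word p) =
  \prod_(i < k) (dynkin_letter true ^+ (p i).1 * dynkin_letter false ^+ (p i).2).
Proof.
rewrite /dynkin_word /bch_bool_word big_flatten big_map.
have -> : enum 'I_k = index_enum _ by rewrite enumT [index_enum _]unlock.
by apply: eq_bigr => i _; rewrite big_cat !big_nseq /= !iter_mulr_1.
Qed.

Definition dynkin_block n : 'M[ps]_3 :=
  \sum_(q : 'I_n.+1 * 'I_n.+1 | (0 < q.1 + q.2)%N)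
    ps_const (q.1`! * q.2`!)%:R^-1 *: (dynkin_letter true ^+ q.1 * dynkin_letter false ^+ q.2).

(** Distributing the power of a sum produces exactly Dynkin's sequences of k nonzero pairs, with no
    constraint yet on their total degree. *)
Lemma dynkin_blockX k n :
  dynkin_block n ^+ k =
  \sum_(p : {ffun 'I_k -> 'I_n.+1 * 'I_n.+1} | [forall i, (0 < (p i).1 + (p i).2)%N])
    ps_const (\prod_(i < k) ((p i).1`! * (p i).2`!))%:R^-1 *: dynkin_word (bch_bool_word p).
Proof.
rewrite -{1}[k]card_ord -prodr_const /dynkin_block bigA_distr_big /=.
rewrite (eq_bigl (fun p : {ffun 'I_k -> 'I_n.+1 * 'I_n.+1} =>
    [forall i, (0 < (p i).1 + (p i).2)%N])); last first.
  by move=> p; apply/ffun_onP/forallP.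
apply: eq_bigr => p _; rewrite dynkin_bool_word natr_prod -prodfV rmorph_prod /=.
elim/big_rec3: _ => [|i a b c _ ->]; first by rewrite scale1r.
by rewrite -scalerAl -scalerAr scalerA.
Qed.

Let S := A + B.
Let X := psX.
Let qA := ps_expq A.
Let qB := ps_expq B.
Let qS := ps_expq S.
Let cA := ps_const A.
Let cB := ps_const B.
Let c1 := ps_const b1.
Let c2 := ps_const b2.
Let w := ps_const S * X * qS.
Let g := - (ps_exp A * c2 * qB + c1 * qA).
Let h := ps_exp A * c2 - c1 * qA * cB * X + c1.

Definition dynkin_tri := tri w (X * g) (X * h) (ps_const S * X) 0.

Lemma exp_letterM : exp_letter true * exp_letter false = 1 + dynkin_tri.
Proof.
rewrite triM -tri1 triD /w -/S -ps_expE /S ps_expD rmorphD /=.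
congr tri; rewrite ?mul1r ?mulr1 ?addr0 ?add0r //;
  rewrite /g /h /qA /qB /cA /cB /c1 /c2 /X; ring.
Qed.

Lemma dynkin_block_eqm n : mx_eqm n.+2 (dynkin_block n.+1) dynkin_tri.
Proof.
have -> : dynkin_tri = exp_letter true * exp_letter false - 1.
  by rewrite exp_letterM addrC addKr.
have -> : dynkin_block n.+1 =
    (\sum_(i < n.+2) ps_const (i`!%:R^-1) *: dynkin_letter true ^+ i) *
    (\sum_(i < n.+2) ps_const (i`!%:R^-1) *: dynkin_letter false ^+ i) - 1.
  (* The pair (0, 0), excluded from the block, is the identity matrix that is subtracted. *)
  rewrite big_distrlr pair_big (bigD1 (ord0, ord0)) //= fact0 invr1 rmorph1 !scale1r.
  rewrite mul1r addrAC subrr add0r /dynkin_block; apply: eq_big => [[i j]|[i j] _] /=.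
    by rewrite addn_gt0 !lt0n -negb_and xpair_eqE.
  by rewrite natrM invfM rmorphM /= -scalerAr -scalerAl scalerA mulrC.
move=> i j; rewrite [X in ps_eqm _ X _]mxE [X in ps_eqm _ _ X]mxE.
apply: ps_eqmD => //; apply: mx_eqmM; apply: exp_letter_eqm.
Qed.

Variable V : ps.
Hypothesis VE : V * ps_expq (A + B) = 1.

(** The closed form of the series: the value for which multiplying first coordinates by [ps_expq] of
    minus the slope turns the BCH product into the product of the model. *)
Definition dynkin_sum : ps := V * (ps_exp A * ps_const b2 * ps_expq B + ps_const b1 * ps_expq A).

(** The left side is the derivative of x [dynkin_sum]; it appears because x d/dx removes the factor
    1/n of Dynkin's formula. *)
Lemma dynkin_sumE :
  dynkin_sum + psX * ps_deriv dynkin_sum = V * h + V * (V - 1) * g.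
Proof.
have VE' : V * qS = 1 by [].
(* Differentiate V qS = 1. Together with the equations below, this replaces every derivative by a
   polynomial in the series, and [ring] can conclude. *)
have dV : X * ps_deriv V = - V ^+ 2 * (ps_exp S - qS).
  rewrite -ps_deriv_expq -/qS; have := congr1 ps_deriv VE'.
  rewrite ps_deriv1 ps_derivM => /(congr1 (fun z => X * V * z)).
  rewrite mulr0 mulrDr => /eqP; rewrite addr_eq0 => /eqP e.
  have -> : X * ps_deriv V = X * V * (ps_deriv V * qS).
    by rewrite -[LHS]mulr1 -VE'; ring.
  by rewrite e /X; ring.
have dA : X * ps_deriv (ps_exp A) = X * cA * ps_exp A by rewrite ps_deriv_exp mulrA.
have dqA : X * ps_deriv qA = ps_exp A - qA by rewrite ps_deriv_expq.
have dqB : X * ps_deriv qB = ps_exp B - qB by rewrite ps_deriv_expq.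
have eS : ps_exp S = 1 + (cA + cB) * X * qS by rewrite ps_expE rmorphD.
have eA : ps_exp A = 1 + cA * X * qA by rewrite ps_expE.
have eB : ps_exp B = 1 + cB * X * qB by rewrite ps_expE.
rewrite /dynkin_sum -/qA -/qB -/c1 -/c2 -/X.
rewrite !(ps_derivM, ps_derivD, ps_deriv_const) !mul0r ?mulr0 ?addr0 ?add0r.
set Z := ps_exp A * c2 * qB + c1 * qA.
transitivity (V * Z + (X * ps_deriv V) * Z + V * ((X * ps_deriv (ps_exp A)) * c2 * qB
    + ps_exp A * c2 * (X * ps_deriv qB) + c1 * (X * ps_deriv qA))); first by ring.
rewrite dV dA dqA dqB eS.
have -> : - V ^+ 2 * (1 + (cA + cB) * X * qS - qS) =
    - V ^+ 2 - V * (cA + cB) * X + V.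
  transitivity (- V ^+ 2 - V * (cA + cB) * X * (V * qS) + V * (V * qS)); first by ring.
  by rewrite VE'; ring.
rewrite /h /g /Z eB eA; ring.
Qed.

(** By [tri_pow], the corner entry of log(1 + N), for N = exp U exp V - 1, only involves log(1 + w)
    / w and the next quotient, where w is the top left entry of N. By [log_quotE] the first is V
    modulo the truncation. *)
Lemma log_dynkin_eqm n :
  ps_eqm n.+2
    ((\sum_(k < n.+1) ps_const ((-1) ^+ k / k.+1%:R) *: dynkin_block n.+1 ^+ k.+1) ord0 ord_max)
    (psX * (dynkin_sum + psX * ps_deriv dynkin_sum)).
Proof.
rewrite summxE dynkin_sumE.
pose F (k : nat) := ps_const ((-1) ^+ k / k.+1%:R).
apply: (@ps_eqm_trans _ _ (\sum_(k < n.+1) F k * (dynkin_tri ^+ k.+1) ord0 ord_max)).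
  apply: ps_eqm_sum => k _; rewrite mxE; apply: ps_eqmM => //.
  exact/mx_eqmX/dynkin_block_eqm.
(* This stands for (log(1 + w) / w - 1) / w, written without division since w vanishes when A + B =
   0. *)
pose mu := \sum_(k < n) F k.+1 * w ^+ k.
have lmu : log_quot S n.+1 = 1 + w * mu.
  rewrite /log_quot big_ord_recl expr0 mulr1 divr1 rmorph1; congr (1 + _).
  rewrite /mu mulr_sumr; apply: eq_bigr => k _.
  by rewrite lift0 -/X -/qS -/w [w ^+ _]exprS mulrCA.
have -> : \sum_(k < n.+1) F k * (dynkin_tri ^+ k.+1) ord0 ord_max =
    X * (log_quot S n.+1 * h + mu * X * ps_const S * g).
  rewrite [RHS]mulrDr.
  under eq_bigr do rewrite /dynkin_tri tri_pow tri13 [F _ * _]mulrDr.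
  rewrite big_split /=; congr (_ + _).
    by rewrite /log_quot mulr_suml mulr_sumr; apply: eq_bigr => k _; rewrite /F -/w; ring.
  rewrite big_ord_recl mulr0n mulr0 add0r /mu !mulr_suml mulr_sumr.
  by apply: eq_bigr => k _; rewrite lift0 mulr1n /= ; ring.
apply/ps_eqm_mulX.
have lV : ps_eqm n.+1 (log_quot S n.+1) V.
  have -> : log_quot S n.+1 = (log_quot S n.+1 * qS) * V.
    by rewrite -mulrA [qS * V]mulrC VE mulr1.
  by rewrite -[X in ps_eqm _ _ X]mul1r; apply: ps_eqmM => //; apply: log_quotE.
apply: ps_eqmD; first exact: ps_eqmM.
apply: ps_eqmM => //.
have -> : mu * X * ps_const S = V * (log_quot S n.+1 - 1).
  rewrite lmu -[LHS]mulr1 -VE -/S -/qS /w; ring.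
by apply: ps_eqmM => //; apply: ps_eqmB.
Qed.

End DynkinSeries.

(** * The Baker-Campbell-Hausdorff product in coordinates *)

(* [crd] and [slope] are the coordinates of Q[[x]] x| Q t.                    *)
Section MetabelianCoordinates.
Variables (L : lieAlgType rat) (crd : L -> ps) (slope : L -> rat).
Hypothesis crdZD : forall a u v, crd (a *: u + v) = ps_const a * crd u + crd v.
Hypothesis slopeZD : forall a u v, slope (a *: u + v) = a * slope u + slope v.
Hypothesis crd_lie : forall u v,
  crd (lie u v) = psX * (ps_const (slope v) * crd u - ps_const (slope u) * crd v).
Hypothesis slope_lie : forall u v, slope (lie u v) = 0.

Lemma crd0 : crd 0 = 0.
Proof. by have := crdZD (-1) 0 0; rewrite scaler0 addr0 rmorphN1 mulN1r addNr. Qed.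

Lemma crdD u v : crd (u + v) = crd u + crd v.
Proof. by rewrite -[u]scale1r crdZD rmorph1 mul1r scale1r. Qed.

Lemma crdZ a u : crd (a *: u) = ps_const a * crd u.
Proof. by rewrite -[a *: u]addr0 crdZD crd0 addr0. Qed.

Lemma crd_sum I (r : seq I) (P : pred I) (F : I -> L) :
  crd (\sum_(i <- r | P i) F i) = \sum_(i <- r | P i) crd (F i).
Proof. exact: (big_morph crd crdD crd0). Qed.

Lemma crdB u v : crd (u - v) = crd u - crd v.
Proof. by rewrite crdD -scaleN1r crdZ rmorphN1 mulN1r. Qed.

Lemma slope0 : slope 0 = 0.
Proof. by have := slopeZD (-1) 0 0; rewrite scaler0 addr0 mulN1r addNr. Qed.

Lemma slopeD u v : slope (u + v) = slope u + slope v.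
Proof. by rewrite -[u]scale1r slopeZD mul1r scale1r. Qed.

Lemma slopeZ a u : slope (a *: u) = a * slope u.
Proof. by rewrite -[a *: u]addr0 slopeZD slope0 addr0. Qed.

Lemma slope_sum I (r : seq I) (P : pred I) (F : I -> L) :
  slope (\sum_(i <- r | P i) F i) = \sum_(i <- r | P i) slope (F i).
Proof. exact: (big_morph slope slopeD slope0). Qed.

Lemma slopeB u v : slope (u - v) = slope u - slope v.
Proof. by rewrite slopeD -scaleN1r slopeZ mulN1r. Qed.

(** The first commutator kills the slope and brings one factor x, and each further one brings
    another x; for n = 0 and 1 the condition is void, as [lie_lcs n] is everything. *)
Definition lcs_coords n u : Prop :=
  ((1 < n)%N -> slope u = 0) /\ ps_eqm n.-1 (crd u) 0.

Lemma lie_lcs_coords n u : lie_lcs n u -> lcs_coords n u.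
Proof.
elim: n u => [|[|n] IHn] u; [by split | by split |].
rewrite lie_lcsS // => uL; apply: uL; split.
  split=> [|a v w [v1 v2] [w1 w2]]; first by split=> [_|]; rewrite ?slope0 ?crd0.
  split=> [n1|]; first by rewrite slopeZD v1 // w1 // mulr0 addr0.
  rewrite crdZD => i iN; rewrite psD psC_mul v2 // w2 //.
  by rewrite mulr0 addr0.
move=> _ [v _ [w /IHn [w1 w2] <-]]; split=> [_|]; first exact: slope_lie.
rewrite crd_lie; case: n {IHn} => [|n] in w1 w2 *.
  by move=> [|i] // _; rewrite psX_mul0.
rewrite w1 // rmorph0 mul0r sub0r -[X in ps_eqm _ _ X](mulr0 psX).
apply/ps_eqm_mulX => i iN.
by rewrite psN psC_mul w2 // mulr0 oppr0.
Qed.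

Variable t : L.
Hypothesis lie_tP : forall u, slope u = 0 -> crd u 0%N = 0 ->
  exists v, [/\ slope v = 0, crd u = psX * crd v & lie v t = u].

(** Division by x is realized by a bracket with t, which lowers n by one. *)
Lemma coords_lie_lcs n u : lcs_coords n u -> lie_lcs n u.
Proof.
elim: n u => [//|[//|n] IHn] u [u1 u2].
have [v [v1 v2 <-]] := lie_tP (u1 isT) (u2 0%N isT).
rewrite lieC; apply/lie_lcsN/lie_lcsR/IHn; split=> // i iN.
by have := u2 i.+1 iN; rewrite v2 psX_mulS.
Qed.

Section BCH.
Variables u v : L.
Let A := - slope u.
Let B := - slope v.
Let letter (x : bool) := if x then u else v.

Let nest s := lie_nest (map letter s).

(** Adding a letter on the left is the formula [crd_lie] written as a row times a column. The slope
    of the rest only intervenes when the rest is a single letter, as slopes of brackets vanish; the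
    full shape of the matrix is carried along for the induction. *)
Lemma lie_nest_dynkin (s : seq bool) : s != [::] ->
  [/\ crd (nest s) * psX = dynkin_word A B 1 0 s ord0 ord_max * crd u +
                    dynkin_word A B 0 1 s ord0 ord_max * crd v,
      slope (nest s) = (if s is [:: x] then slope (letter x) else 0) &
      forall b1 b2, dynkin_word A B b1 b2 s =
        tri (dynkin_word A B b1 b2 s ord0 ord0) (dynkin_word A B b1 b2 s ord0 (inord 1))
         (dynkin_word A B b1 b2 s ord0 ord_max) (- (ps_const (slope (nest s)) * psX)) 0].
Proof.
have A' : ps_const A = - ps_const (slope u) by rewrite rmorphN.
have B' : ps_const B = - ps_const (slope v) by rewrite rmorphN.
elim: s => [//|x [|y s] IHs] _.
  rewrite /nest /= /dynkin_word !big_seq1 /dynkin_letter !tri13; split=> //.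
    by case: x; rewrite ?rmorph1 ?rmorph0 /=; ring.
  move=> b1 b2; rewrite big_seq1 tri13 !mxE /= inordK //=.
  by congr tri; case: x; rewrite ?A' ?B' /=; ring.
have {IHs}[] := IHs isT; rewrite -[nest [:: x, y & s]]/(lie (letter x) (nest (y :: s))).
set w := nest _ => cw sw mw; split=> //; last first.
  move=> b1 b2; rewrite [in LHS]/dynkin_word big_cons -/(dynkin_word _ _ _ _ (y :: s)).
  rewrite [dynkin_word _ _ _ _ (x :: y :: s)]/dynkin_word big_cons.
  rewrite -/(dynkin_word _ _ _ _ (y :: s)) mw triM tri13 !mxE /= inordK //=.
  by rewrite slope_lie rmorph0; congr tri; ring.
have h b1 b2 : dynkin_word A B b1 b2 [:: x, y & s] ord0 ord_max =
    psX * (- ps_const (slope (letter x)) * dynkin_word A B b1 b2 (y :: s) ord0 ord_max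
     + ps_const (if x then b1 else b2) * (ps_const (slope w) * psX)).
  rewrite [in LHS]/dynkin_word big_cons -/(dynkin_word _ _ _ _ (y :: s)).
  rewrite {1}mw triM tri13; case: (x); rewrite ?A' ?B' /letter; ring.
rewrite !h crd_lie.
transitivity (psX * (ps_const (slope w) * psX * crd (letter x)
    - ps_const (slope (letter x)) * (crd w * psX))); first by ring.
by rewrite cw; case: (x); rewrite /letter ?rmorph1 ?rmorph0; ring.
Qed.

Variable V : ps.
Hypothesis VE : V * ps_expq (A + B) = 1.
Let alpha := dynkin_sum A B 1 0 V.
Let beta := dynkin_sum A B 0 1 V.

Lemma crd_bch_term n :
  crd (bch_term n.+1 u v) =
  psX ^+ n * (ps_const (alpha n) * crd u + ps_const (beta n) * crd v).
Proof.
pose D b1 b2 k (p : {ffun 'I_k -> 'I_n.+2 * 'I_n.+2}) :=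
  dynkin_word A B b1 b2 (bch_bool_word p) ord0 ord_max.
pose q k (p : {ffun 'I_k -> 'I_n.+2 * 'I_n.+2}) : rat :=
  (n.+1 * \prod_(i < k) ((p i).1`! * (p i).2`!))%:R^-1.
pose l k : rat := (-1) ^+ k.-1 / k%:R.
pose T b1 b2 := \sum_(1 <= k < n.+2) ps_const (l k) *
  \sum_(p : {ffun 'I_k -> 'I_n.+2 * 'I_n.+2} | bch_index p) ps_const (q k p) * D b1 b2 k p.
(* The coefficients of [crd u] and [crd v] are treated alike; the extra factor x is the one in
   [lie_nest_dynkin]. *)
suff TE b1 b2 : T b1 b2 = ps_const (dynkin_sum A B b1 b2 V n) * psX ^+ n.+1.
  apply: psX_inj; rewrite [LHS]mulrC mulrA -exprS.
  transitivity (T 1 0 * crd u + T 0 1 * crd v); last by rewrite !TE; ring.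
  rewrite /bch_term crd_sum !mulr_suml -big_split !big_nat /=.
  apply: eq_bigr => k /andP[k1 kn]; rewrite crdZ crd_sum -!mulrA -mulrDr; congr (_ * _).
  rewrite !mulr_suml -big_split; apply: eq_bigr => p /andP[p1 p2] /=.
  rewrite crdZ -!mulrA -mulrDr; congr (_ * _).
  have -> : bch_word p u v = map letter (bch_bool_word p).
    rewrite /bch_word /bch_bool_word map_flatten -map_comp; congr flatten.
    by apply: eq_map => i /=; rewrite map_cat !map_nseq.
  have [|-> //] := @lie_nest_dynkin (bch_bool_word p).
  by rewrite -size_eq0 size_bch_bool_word (eqP p2).
have Dn k (p : {ffun 'I_k -> 'I_n.+2 * 'I_n.+2}) :
    ps_homog (\sum_(i < k) ((p i).1 + (p i).2))%N (D b1 b2 k p).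
  by rewrite -(size_bch_bool_word p); apply: dynkin_word_homog.
rewrite [LHS](@ps_homogE n.+1); last first.
  apply: ps_homog_sum => k _; apply: (@ps_homogM 0 n.+1); first exact: ps_homog_const.
  apply: ps_homog_sum => p /andP[_ /eqP pn].
  apply: (@ps_homogM 0 n.+1); first exact: ps_homog_const.
  by move: (Dn k p); rewrite pn.
congr (ps_const _ * _).
have n0 : n.+1%:R != 0 :> rat by rewrite pnatr_eq0.
apply: (mulfI n0).
(* The factor n + 1 cancels Dynkin's denominator; on the closed form it amounts to applying x d/dx
   to x [dynkin_sum]. *)
have -> : n.+1%:R * dynkin_sum A B b1 b2 V n =
    (psX * (dynkin_sum A B b1 b2 V + psX * ps_deriv (dynkin_sum A B b1 b2 V))) n.+1.
  by rewrite psX_mulS psD psX_deriv mulrS mulrDl mul1r.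
rewrite -(@log_dynkin_eqm A B b1 b2 V VE n) // summxE /T !ps_sum.
rewrite big_add1 /= big_mkord mulr_sumr; apply: eq_bigr => k _.
rewrite psC_mul [in RHS]mxE psC_mul mulrCA /l /=; congr (_ * _).
rewrite dynkin_blockX summxE !ps_sum mulr_sumr.
(* Sequences of another total degree give homogeneous entries of another degree, hence nothing in
   x^(n+1). *)
rewrite [RHS](bigID (fun p : {ffun 'I_k.+1 -> 'I_n.+2 * 'I_n.+2} =>
   (\sum_(i < k.+1) ((p i).1 + (p i).2) == n.+1)%N)) /= [X in _ = _ + X]big1 ?addr0.
  apply: eq_bigr => p _; rewrite [in RHS]mxE !psC_mul /q natrM invfM !mulrA mulfV // mul1r.
  by [].
move=> p /andP[_ pn]; rewrite [in LHS]mxE psC_mul.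
by have /(_ n.+1) := Dn k.+1 p; rewrite eq_sym /D => -> //; rewrite mulr0.
Qed.

Lemma slope_bch_term n : slope (bch_term n.+1 u v) = (slope u + slope v) *+ (n == 0%N).
Proof.
case: n => [|n]; last by have [-> //] := lie_lcs_coords (bch_term_lcs n.+2 u v).
rewrite /bch_term big_nat1 divr1 expr0 scale1r slope_sum mulr1n.
pose F (q : 'I_2 * 'I_2) := (q.1`! * q.2`!)%:R^-1 * slope (lie_nest (nseq q.1 u ++ nseq q.2 v)).
(* Viewing the sum over pairs as a product with one factor lets distributivity match it with the sum
   over functions on ['I_1]. *)
transitivity (\prod_(i < 1) \sum_(q : 'I_2 * 'I_2 | (q.1 + q.2 == 1)%N) F q); last first.
  rewrite big_ord1 big_mkcond -(pair_bigA _ (fun i j : 'I_2 =>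
    if (i + j == 1)%N then F (i, j) else 0)) /=.
  rewrite !big_ord_recl !big_ord0 /F /=.
  by rewrite !fact0 !factS !fact0 /= invr1 !mul1r !addr0 !add0r addrC.
rewrite bigA_distr_big /=; apply: eq_big => [p|p _].
  rewrite /bch_index big_ord1; apply/andP/ffun_onP => [[_ p1] i|p1].
    by rewrite (ord1 i).
  split; last exact: p1.
  by apply/forallP => i; rewrite (eqP (p1 i)).
rewrite slopeZ !big_ord1 mul1n /F; congr (_ * slope (lie_nest _)).
have -> : bch_word p u v = flatten [seq nseq (p i).1 u ++ nseq (p i).2 v | i <- [:: ord0]].
  congr (flatten (map _ _)); apply: (inj_map val_inj).
  by rewrite val_enum_ord.
by rewrite /= cats0.
Qed.

Lemma bch_coords w : slope w = slope u + slope v ->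
  crd w = alpha * crd u + beta * crd v -> bch_converges u v w.
Proof.
(* This many terms include the degree one term, which carries the slope, and all terms that reach
   coefficients below [N.-1]. *)
move=> ws wc N; exists N.+1 => m Nm; apply: coords_lie_lcs; split=> [N1|].
  rewrite slopeB slope_sum big_add1 /= big_mkord; case: m Nm => [//|m] Nm.
  rewrite big_ord_recl slope_bch_term big1 ?addr0 ?ws ?mulr1n ?subrr // => i _.
  by rewrite slope_bch_term.
rewrite crdB crd_sum big_add1 /= big_mkord wc => i iN; rewrite psB ps_sum.
have im : (i < m)%N by lia.
have h (a f : ps) : (a * f) i = \sum_(k < m) (psX ^+ k * (ps_const (a k) * f)) i.
  rewrite psM (big_ord_widen _ (fun k => a k * f (i - k)%N) im) [LHS]big_mkcond /=.
  apply: eq_bigr => k _; rewrite psX_exp_mul ltnS [in RHS]ltnNge.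
  by case: leqP; rewrite //= psC_mul.
rewrite psD !h -big_split -sumrB big1 // => k _.
by rewrite crd_bch_term mulrDr psD subrr.
Qed.

End BCH.

Lemma bch_convergesP u v w : slope w = slope u + slope v ->
  crd w * ps_expq (- slope w) =
    ps_expq (- slope u) * crd u + ps_exp (- slope u) * ps_expq (- slope v) * crd v ->
  bch_converges u v w.
Proof.
move=> ws wc; have [V VE] : exists V, V * ps_expq (- slope u + - slope v) = 1.
  by apply: ps_inv; rewrite ps_expq_coef0 oner_neq0.
apply: (bch_coords VE) => //; move: wc; rewrite ws opprD => wc.
rewrite -[LHS]mulr1 -VE mulrCA mulrC wc /dynkin_sum rmorph0 rmorph1.
by rewrite !(mulr0, mul0r, mulr1, mul1r, addr0, add0r); ring.
Qed.

End MetabelianCoordinates.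

(** * Coordinates on the completed lamplighter Lie algebra *)

(** Only density of [crd] is required, so that both the polynomial algebra and its completion
    qualify, and the lower central series of the completion is computed by the same lemmas. *)
Record lamp_coords (L : lieAlgType rat) (crd : L -> ps) (slope : L -> rat) (t : L) : Prop :=
  LampCoords {
    lc_crdZD : forall a u v, crd (a *: u + v) = ps_const a * crd u + crd v;
    lc_slopeZD : forall a u v, slope (a *: u + v) = a * slope u + slope v;
    lc_crd_lie : forall u v,
      crd (lie u v) = psX * (ps_const (slope v) * crd u - ps_const (slope u) * crd v);
    lc_slope_lie : forall u v, slope (lie u v) = 0;
    lc_tP : forall u, slope u = 0 -> crd u 0%N = 0 ->
      exists v, [/\ slope v = 0, crd u = psX * crd v & lie v t = u];
    lc_dense : forall n p s, exists u, ps_eqm n (crd u) p /\ slope u = s }.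

Lemma pi_lieq_lcs (L : lieAlgType rat) n (x y : L) :
  \pi_(lieq L n) x = \pi_(lieq L n) y -> lie_lcs n (x - y).
Proof. by move/eqmodP/asboolP. Qed.

Section CompletionCoordinates.
Variables (L : lieAlgType rat) (crd : L -> ps) (slope : L -> rat) (t : L).
Hypothesis Lc : lamp_coords crd slope t.
Let LE := lie_completion L.
Implicit Types f g : LE.

(** Level n + 2 is the first at which coefficient n is independent of the representative; the slope
    is well defined from level 2. *)
Definition ccrd f : ps := fun n => crd (repr (val f n.+2)) n.
Definition cslope f : rat := slope (repr (val f 2)).

Lemma lcs_coordsP n u v :
  \pi_(lieq L n) u = \pi_(lieq L n) v <->
  ((1 < n)%N -> slope u = slope v) /\ ps_eqm n.-1 (crd u) (crd v).
Proof.
have [cZD sZD cl sl tP _] := Lc.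
split=> [/pi_lieq_lcs/(lie_lcs_coords cZD sZD cl sl)|[uv1 uv2]].
  move=> -[]; rewrite (crdB cZD) (slopeB sZD) => uv1 uv2.
  split=> [/uv1/subr0_eq //|i iN]; have := uv2 i iN.
  by rewrite psB => /subr0_eq.
apply/lieq_eqP/(coords_lie_lcs tP); split=> [n1|i iN].
  by rewrite (slopeB sZD) uv1 ?subrr.
by rewrite (crdB cZD) psB uv2 ?subrr.
Qed.

Lemma val_lie_completion_le f m n x : (m <= n)%N ->
  val f n = \pi_(lieq L n) x -> val f m = \pi_(lieq L m) x.
Proof.
elim: n => [|n IHn]; first by rewrite leqn0 => /eqP->.
rewrite leq_eqVlt => /predU1P[->//|]; rewrite ltnS => mn e; apply: IHn => //.
by rewrite -lie_completionP e lieq_projE.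
Qed.

Lemma ccrd_lift f n x : val f n = \pi_(lieq L n) x ->
  ((1 < n)%N -> cslope f = slope x) /\ ps_eqm n.-1 (ccrd f) (crd x).
Proof.
move=> e; split=> [n1|i iN].
  have := val_lie_completion_le n1 e; rewrite -[LHS]reprK => /lcs_coordsP[h _].
  exact: h.
have iN2 : (i.+2 <= n)%N by lia.
have := val_lie_completion_le iN2 e; rewrite -[LHS]reprK => /lcs_coordsP[_ h].
exact: h.
Qed.

Lemma ccrd_repr f n :
  ((1 < n)%N -> cslope f = slope (repr (val f n))) /\
  ps_eqm n.-1 (ccrd f) (crd (repr (val f n))).
Proof. by apply: ccrd_lift; rewrite reprK. Qed.

Lemma ccrd_inj f g : ccrd f = ccrd g -> cslope f = cslope g -> f = g.
Proof.
move=> fg1 fg2; apply: lie_completion_eqP => n; rewrite -[LHS]reprK -[RHS]reprK.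
have [f1 f2] := ccrd_repr f n; have [g1 g2] := ccrd_repr g n.
apply/lcs_coordsP; split=> [n1|i iN]; first by rewrite -f1 // -g1.
by rewrite -f2 // -g2 // fg1.
Qed.

Lemma ccrd_surj p s : exists f, ccrd f = p /\ cslope f = s.
Proof.
have [x xP] := choice (fun n => lc_dense Lc n p s).
have xc : compatible (@lieq_proj _ L) (fun n => \pi_(lieq L n) (x n)).
  apply/asboolP => n; rewrite lieq_projE; apply/lcs_coordsP.
  have [c1 s1] := xP n; have [c2 s2] := xP n.+1.
  split=> [_|i iN]; first by rewrite s1 s2.
  by rewrite c1 ?c2 //; lia.
pose f : LE := exist _ (fun n => \pi_(lieq L n) (x n)) xc.
exists f; split.
  apply: ps_eqmP => n; have [_ h] := @ccrd_lift f n.+1 (x n.+1) erefl.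
  by apply: ps_eqm_trans h _; have [h _] := xP n.+1; apply: ps_eqm_le h.
have [h _] := @ccrd_lift f 2 (x 2) erefl.
by rewrite h //; have [] := xP 2.
Qed.

Lemma ccrdZD a f g : ccrd (a *: f + g) = ps_const a * ccrd f + ccrd g.
Proof.
apply: ps_eqmP => n.
have e : val (a *: f + g) n.+1 =
    \pi_(lieq L n.+1) (a *: repr (val f n.+1) + repr (val g n.+1)).
  by rewrite pi_lieqZD !reprK.
have [_] := ccrd_lift e; rewrite (lc_crdZD Lc) => h; apply: ps_eqm_trans h _.
have [_ hf] := ccrd_repr f n.+1; have [_ hg] := ccrd_repr g n.+1.
by apply: ps_eqmD; [apply: ps_eqmM => //|]; apply: ps_eqm_sym.
Qed.

Lemma cslopeZD a f g : cslope (a *: f + g) = a * cslope f + cslope g.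
Proof.
have e : val (a *: f + g) 2 = \pi_(lieq L 2) (a *: repr (val f 2) + repr (val g 2)).
  by rewrite pi_lieqZD !reprK.
by have [h _] := ccrd_lift e; rewrite h // (lc_slopeZD Lc).
Qed.

Lemma ccrd_lie f g :
  ccrd (lie f g) = psX * (ps_const (cslope g) * ccrd f - ps_const (cslope f) * ccrd g).
Proof.
apply: ps_eqmP => n; apply: (@ps_eqm_le _ n.+1) => //.
have e : val (lie f g) n.+2 = \pi_(lieq L n.+2) (lie (repr (val f n.+2)) (repr (val g n.+2))).
  by rewrite -pi_lieq_lie !reprK.
have [_] := ccrd_lift e; rewrite (lc_crd_lie Lc) => h; apply: ps_eqm_trans h _.
have [sf hf] := ccrd_repr f n.+2; have [sg hg] := ccrd_repr g n.+2.
rewrite -sf // -sg //; apply: ps_eqmM => //.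
by apply: ps_eqmB; apply: ps_eqmM => //; apply: ps_eqm_sym.
Qed.

Lemma cslope_lie f g : cslope (lie f g) = 0.
Proof.
have e : val (lie f g) 2 = \pi_(lieq L 2) (lie (repr (val f 2)) (repr (val g 2))).
  by rewrite -pi_lieq_lie !reprK.
by have [h _] := ccrd_lift e; rewrite h // (lc_slope_lie Lc).
Qed.

Lemma lie_completion_coords : exists t', lamp_coords ccrd cslope t'.
Proof.
have [t' [t1 t2]] := ccrd_surj 0 1.
exists t'; split.
- exact: ccrdZD.
- exact: cslopeZD.
- exact: ccrd_lie.
- exact: cslope_lie.
- move=> f f1 f2; have [p fp] := ps_divX f2; have [g [g1 g2]] := ccrd_surj p 0.
  exists g; split=> //; first by rewrite g1.
  apply: ccrd_inj; rewrite ?cslope_lie ?f1 // ccrd_lie t1 t2 g1 g2 fp.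
  by rewrite rmorph1 rmorph0 mul1r mul0r subr0.
- by move=> n p s; have [f [<- <-]] := ccrd_surj p s; exists f.
Qed.

(** To be applied to the completion itself: its own lower central series is again x-adic, and Q[[x]]
    is x-adically complete. *)
Lemma coords_pronilpotent :
  (forall p s, exists u, crd u = p /\ slope u = s) ->
  (forall u v, crd u = crd v -> slope u = slope v -> u = v) -> pronilpotent L.
Proof.
move=> cs ci.
have /choice[g gP] f : exists x, to_lie_completion x = f.
  have [x [x1 x2]] := cs (ccrd f) (cslope f); exists x.
  apply: lie_completion_eqP => n /=; rewrite -[RHS]reprK; apply/lcs_coordsP.
  by rewrite x1 x2; apply: ccrd_repr.
exists g => // x; have gx := gP (to_lie_completion x).
have e n : \pi_(lieq L n) (g (to_lie_completion x)) = \pi x.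
  exact: (congr1 (fun f : LE => val f n) gx).
apply: ci; last by have /lcs_coordsP[h _] := e 2; apply: h.
by apply: ps_eqmP => n; have /lcs_coordsP[_ h] := e n.+1.
Qed.

End CompletionCoordinates.

Lemma lamplighter_lie_coords :
  lamp_coords (fun f : lamplighter_lie => (fun n => f.1`_n) : ps) (fun f => f.2) (0, 1).
Proof.
have XE (f : {poly rat}) : (fun n => ('X * f)`_n) = psX * (fun n => f`_n : rat) :> ps.
  by apply: psP => -[|n]; rewrite coefXM ?psX_mul0 ?psX_mulS.
split=> //=.
- by move=> a u v; apply: psP => n; rewrite psD psC_mul coefD coefZ.
- move=> u v; rewrite mulrBr !(mulrCA psX) -!XE.
  by apply: psP => n; rewrite psB !psC_mul coefB !coefZ.
- move=> [u s] /= -> u0; exists (drop_poly 1 u, 0); split=> //=.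
    by rewrite -XE; apply: psP => -[|n]; rewrite coefXM //= coef_drop_poly addn1.
  congr pair => /=; rewrite scale1r scale0r subr0.
  by apply/polyP => -[|n]; rewrite coefXM //= coef_drop_poly addn1.
- move=> n p s; exists (\poly_(i < n) p i, s); split=> // i iN /=.
  by rewrite coef_poly iN.
Qed.

Lemma lamplighter_completion_coords :
  exists (crd : lie_completion lamplighter_lie -> ps)
         (slope : lie_completion lamplighter_lie -> rat),
  [/\ forall p s, exists u, crd u = p /\ slope u = s,
      forall u v, crd u = crd v -> slope u = slope v -> u = v,
      pronilpotent (lie_completion lamplighter_lie) &
      forall u v w, slope w = slope u + slope v ->
        crd w * ps_expq (- slope w) =
          ps_expq (- slope u) * crd u + ps_exp (- slope u) * ps_expq (- slope v) * crd v ->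
        bch u v = w].
Proof.
have Lc := lamplighter_lie_coords.
have [t' Ec] := lie_completion_coords Lc.
have Es := ccrd_surj Lc; have Ei := ccrd_inj Lc.
have Ep : pronilpotent (lie_completion lamplighter_lie).
  exact: (coords_pronilpotent Ec Es Ei).
eexists; eexists; split; [exact: Es | exact: Ei | by [] |].
move=> u v w ws wc; apply/bchP => //; case: Ec => cZD sZD cl sl tP _.
exact: (bch_convergesP cZD sZD cl sl tP).
Qed.

(** * Lower central series, and the model group *)

Section CongruenceModuloLcs.
Local Open Scope group_scope.
Variable gT : groupType.
Implicit Types x y z : gT.

Definition lcs_cong n x y : Prop := glcs n (x^-1 * y).

Lemma lcs_cong_refl n x : lcs_cong n x x.
Proof. by rewrite /lcs_cong mulVg; apply: glcs1. Qed.

Lemma lcs_cong_sym n x y : lcs_cong n x y -> lcs_cong n y x.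
Proof. by move/glcsV; rewrite invgM invgK. Qed.

Lemma lcs_cong_trans n y x z : lcs_cong n x y -> lcs_cong n y z -> lcs_cong n x z.
Proof. by move=> xy yz; have := glcsM xy yz; rewrite -mulgA mulVKg. Qed.

Lemma lcs_congM n x x' y y' :
  lcs_cong n x x' -> lcs_cong n y y' -> lcs_cong n (x * y) (x' * y').
Proof. exact: glcs_congrM. Qed.

Lemma lcs_congV n x x' : lcs_cong n x x' -> lcs_cong n x^-1 x'^-1.
Proof. exact: glcs_congrV. Qed.

Lemma lcs_congX n x x' m : lcs_cong n x x' -> lcs_cong n (x ^+ m) (x' ^+ m).
Proof.
move=> xx'; elim: m => [|m IHm]; first exact: lcs_cong_refl.
by rewrite !expgS; apply: lcs_congM.
Qed.

Lemma lcs_congJ n x x' y : lcs_cong n x x' -> lcs_cong n (x ^ y) (x' ^ y).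
Proof.
by move=> xx'; apply/lcs_congM/lcs_congM => //; apply: lcs_cong_refl.
Qed.

Lemma glcs_le m n : (m <= n)%N -> @glcs gT n `<=` @glcs gT m.
Proof.
move=> /subnK <-; elim: (n - m)%N => [//|k IHk].
by rewrite addSn; apply: subset_trans IHk; apply: glcs_sub.
Qed.

Lemma lcs_cong_le m n x y : (m <= n)%N -> lcs_cong n x y -> lcs_cong m x y.
Proof. by move=> mn; apply: glcs_le. Qed.

Lemma lcs_cong1 n x : lcs_cong n 1 x <-> glcs n x.
Proof. by rewrite /lcs_cong invg1 mul1g. Qed.

Lemma glcs_cong n x y : lcs_cong n x y -> glcs n x -> glcs n y.
Proof. by move=> xy xn; have := glcsM xn xy; rewrite mulVKg. Qed.

Lemma lcs_cong_mulr n x y : glcs n y -> lcs_cong n x (x * y).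
Proof. by rewrite /lcs_cong mulKg. Qed.

Lemma lcs_cong_comm n x y : glcs n y -> lcs_cong n.+1 (x * y) (y * x).
Proof.
move=> yn; rewrite /lcs_cong invgM -mulgA.
have -> : y^-1 * (x^-1 * (y * x)) = [~ y, x] by [].
exact: glcsRl.
Qed.

Lemma lcs_cong_comm2 x y : lcs_cong 2 (x * y) (y * x).
Proof. exact: (@lcs_cong_comm 1). Qed.

(** An element of the n-th term is central modulo the next one. *)
Lemma lcs_cong_expM n x y m : glcs n y -> lcs_cong n.+1 ((x * y) ^+ m) (x ^+ m * y ^+ m).
Proof.
move=> yn; elim: m => [|m IHm]; first by rewrite !expg0 mulg1; apply: lcs_cong_refl.
rewrite !expgS; apply: (@lcs_cong_trans _ (x * y * (x ^+ m * y ^+ m))).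
  by apply: lcs_congM => //; apply: lcs_cong_refl.
rewrite -!mulgA; apply: lcs_congM; first exact: lcs_cong_refl.
rewrite !mulgA; apply: lcs_congM; last exact: lcs_cong_refl.
exact/lcs_cong_sym/lcs_cong_comm.
Qed.

Lemma commMgE x y z : [~ x * y, z] = [~ x, z] ^ y * [~ y, z].
Proof. by rewrite /commg /conjg !invgM -!mulgA !mulVKg. Qed.

Lemma commgME x y z : [~ x, y * z] = [~ x, z] * [~ x, y] ^ z.
Proof. by rewrite -invgR commMgE invgM -conjVg !invgR. Qed.

(** Modulo the term k + 2, commutators with elements of the term k are bimultiplicative. With
    [subgroup_commR] this reduces statements on commutators to generators. *)
Lemma subgroup_commL (B : set gT) k y : is_subgroup B -> @glcs gT k.+2 `<=` B ->
  glcs k y -> is_subgroup [set x | B [~ x, y]].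
Proof.
move=> [B1 BM BV] kB yk.
have BJ u v : glcs k.+1 u -> B u -> B (u ^ v).
  move=> uk uB; have -> : u ^ v = u * [~ u, v] by rewrite mulVKg.
  by apply: BM => //; apply/kB/glcsRl.
split=> [|x x' xB x'B|x xB] /=; first by rewrite comm1g.
  by rewrite commMgE; apply: BM => //; apply: BJ => //; apply: glcsR.
have -> : [~ x^-1, y] = ([~ x, y] ^ x^-1)^-1.
  by apply/esym/mulg1_eq; rewrite -commMgE mulgV comm1g.
by apply/BV/BJ => //; apply: glcsR.
Qed.

Lemma subgroup_commR (B : set gT) k x : is_subgroup B -> @glcs gT k.+2 `<=` B ->
  is_subgroup [set y | glcs k y /\ B [~ x, y]].
Proof.
move=> [B1 BM BV] kB.
have BJ u v : glcs k.+1 u -> B u -> B (u ^ v).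
  move=> uk uB; have -> : u ^ v = u * [~ u, v] by rewrite mulVKg.
  by apply: BM => //; apply/kB/glcsRl.
split=> [|y y' [yk yB] [yk' yB']|y [yk yB]] /=.
- by rewrite commg1; split=> //; apply: glcs1.
- split; first exact: glcsM.
  by rewrite commgME; apply: BM => //; apply: BJ => //; apply: glcsR.
split; first exact: glcsV.
have -> : [~ x, y^-1] = ([~ x, y]^-1) ^ y^-1.
  have e : [~ x, y^-1] * [~ x, y] ^ y^-1 = 1 by rewrite -commgME mulgV commg1.
  by rewrite conjVg -(mulg1_eq e) invgK.
by apply: BJ; [apply/glcsV/glcsR | apply: BV].
Qed.

(** The cyclic group generated by z modulo the next term; the two natural exponents stand for the
    integer exponent n - m. *)
Lemma subgroup_cyclic_mod k z : glcs k z ->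
  is_subgroup [set y | exists m n, lcs_cong k.+1 (z ^+ m * y) (z ^+ n)].
Proof.
move=> zk; have cz := lcs_cong_refl.
split=> [|y y' [m [n e]] [m' [n' e']]|y [m [n e]]].
- by exists 0%N, 0%N; rewrite mulg1; apply: cz.
- exists (m' + m)%N, (n + n')%N; rewrite !expgnDr.
  apply: (@lcs_cong_trans _ (z ^+ m' * (z ^+ n * y'))).
    by rewrite -!mulgA; apply: lcs_congM => //; rewrite mulgA; apply: lcs_congM.
  have zC : z ^+ m' * z ^+ n = z ^+ n * z ^+ m' by apply: commuteX2.
  by rewrite mulgA zC -mulgA; apply: lcs_congM.
- exists n, m; apply: (@lcs_cong_trans _ (z ^+ m * y * y^-1)).
    by apply: lcs_congM => //; apply: lcs_cong_sym.
  by rewrite mulgK; apply: cz.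
Qed.

End CongruenceModuloLcs.

(* Q[[x]] x| Q with s in Q acting on Q[[x]] as e^(-sx)                        *)
Definition lamp_model : Type := ps * rat.

HB.instance Definition _ := Choice.on lamp_model.

Section LamplighterModel.
Implicit Types u v w : lamp_model.

Definition lm_mul u v : lamp_model := (u.1 + ps_exp (- u.2) * v.1, u.2 + v.2).
Definition lm_one : lamp_model := (0, 0).
Definition lm_inv u : lamp_model := (- (ps_exp u.2 * u.1), - u.2).

Lemma lm_mulA : associative lm_mul.
Proof.
move=> u v w; congr pair; rewrite /= ?addrA // opprD ps_expD.
by rewrite mulrDr addrA mulrA.
Qed.
Lemma lm_mul1 : left_id lm_one lm_mul.
Proof. by case=> p s; congr pair; rewrite /= ?add0r // oppr0 ps_exp0 mul1r. Qed.
Lemma lm_1mul : right_id lm_one lm_mul.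
Proof. by case=> p s; congr pair; rewrite /= ?addr0 // mulr0 addr0. Qed.
Lemma lm_mulV : left_inverse lm_one lm_inv lm_mul.
Proof. by move=> u; congr pair; rewrite /= ?addNr // opprK addNr. Qed.
Lemma lm_Vmul : right_inverse lm_one lm_inv lm_mul.
Proof.
move=> u; congr pair; rewrite /= ?addrN // mulrN mulrA.
by rewrite [_ * ps_exp _]mulrC ps_expN mul1r addrN.
Qed.

HB.instance Definition _ := isGroup.Build lamp_model
  lm_mulA lm_mul1 lm_1mul lm_mulV lm_Vmul.

Lemma lm_mulE u v : (u * v)%g = (u.1 + ps_exp (- u.2) * v.1, u.2 + v.2) :> lamp_model.
Proof. by []. Qed.
Lemma lm_invE u : u^-1%g = (- (ps_exp u.2 * u.1), - u.2) :> lamp_model.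
Proof. by []. Qed.
Lemma lm_exp0 p n : (((p, 0) : lamp_model) ^+ n)%g = (p *+ n, 0).
Proof.
elim: n => [//|n IHn]; rewrite expgS IHn lm_mulE /= oppr0 ps_exp0 mul1r addr0.
by rewrite mulrS.
Qed.

Lemma lm_conj0 p q s : (((p, 0) : lamp_model) ^ ((q, s) : lamp_model))%g = (ps_exp s * p, 0).
Proof.
rewrite /conjg lm_invE !lm_mulE /= oppr0 ps_exp0 opprK mul1r add0r addNr.
by congr pair; ring.
Qed.

(* On the subgroup of slope 0, [lm_filt n] is x^(n-1) Q[[x]].                 *)
Definition lm_filt n u : Prop := ((1 < n)%N -> u.2 = 0) /\ ps_eqm n.-1 u.1 0.

Lemma lm_filt_subgroup n : is_subgroup (lm_filt n).
Proof.
split=> [|u v [u1 u2] [v1 v2]|u [u1 u2]]; first by split.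
  split=> [n1|]; first by rewrite /= u1 // v1 // addr0.
  rewrite lm_mulE /= -[X in ps_eqm _ _ X]addr0; apply: ps_eqmD => //.
  by rewrite -[X in ps_eqm _ _ X](mulr0 (ps_exp (- u.2))); apply: ps_eqmM.
split=> [n1|]; first by rewrite /= u1 // oppr0.
rewrite lm_invE /= -[X in ps_eqm _ _ X]oppr0; apply: ps_eqmN.
by rewrite -[X in ps_eqm _ _ X](mulr0 (ps_exp u.2)); apply: ps_eqmM.
Qed.

Lemma lm_commE u v : ([~ u, v]%g).1 =
  (1 - ps_exp u.2) * ps_exp v.2 * v.1 - (1 - ps_exp v.2) * ps_exp u.2 * u.1.
Proof.
rewrite /commg /conjg !lm_mulE !lm_invE /= !opprK.
have Ps := ps_expN u.2; set P := ps_exp u.2 in Ps *; set Q := ps_exp v.2.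
set P' := ps_exp (- u.2) in Ps *.
transitivity (- (P * u.1) + P * (- (Q * v.1) + Q * u.1) + (P * P') * Q * v.1); first by ring.
by rewrite Ps; ring.
Qed.

(** In [lm_commE] the factors 1 - e^(sx) are divisible by x, and the one for the slope of v vanishes
    when n > 1. *)
Lemma lm_filt_comm n u v : lm_filt n v -> lm_filt n.+1 [~ u, v]%g.
Proof.
move=> [v1 v2]; split=> [_|]; first by rewrite /= addrCA addKr addNr.
case: n v1 v2 => [//|n] v1 v2; rewrite [n.+2.-1]/= lm_commE.
have P1 s : ps_eqm 1 (1 - ps_exp s) 0.
  by case=> // _; rewrite psB ps1 ps_exp_coef0 subrr.
rewrite -[X in ps_eqm _ _ X](subrr 0); apply: ps_eqmB.
  rewrite -mulrA; apply: ps_eqm_exp0 => //.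
  by rewrite -[X in ps_eqm _ _ X](mulr0 (ps_exp v.2)); apply: ps_eqmM.
case: n v1 v2 => [|n] v1 v2; last first.
  by rewrite v1 // ps_exp0 subrr !mul0r.
by rewrite -mulrA -[X in ps_eqm _ _ X](mul0r (ps_exp u.2 * u.1)); apply: ps_eqmM.
Qed.

Lemma lm_filt_glcs (gT : groupType) (f : {multiplicative gT -> lamp_model}) n x :
  glcs n x -> lm_filt n (f x).
Proof.
elim: n x => [|n IHn] x; first by split.
case: n IHn => [|n] IHn; first by split.
rewrite glcsS // => xn; have [f1 fM fV] := lm_filt_subgroup n.+2.
apply: (xn (f @^-1` lm_filt n.+2)); split.
  split=> [|y z|y]; rewrite /preimage /= ?group_morph1 ?gmulfM ?group_morphV.
  - exact: f1.
  - exact: fM.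
  - exact: fV.
move=> _ [y _ [z /IHn zn <-]]; rewrite /preimage /= !gmulfM !group_morphV.
exact: lm_filt_comm.
Qed.

End LamplighterModel.

(** * Homomorphisms out of a presented group *)

Section PresentationMap.
Local Open Scope group_scope.
Variables (X : choiceType) (rels : set (gword X)) (hT : groupType) (gen : X -> hT).

Definition word_val (w : gword X) : hT :=
  \prod_(l <- w) (if l.2 then gen l.1 else (gen l.1)^-1).

Lemma word_val_cat u v : word_val (u ++ v) = word_val u * word_val v.
Proof. exact: big_cat. Qed.

Lemma word_val_inv u : word_val (gword_inv u) = (word_val u)^-1.
Proof.
elim: u => [|[x e] u IHu]; first by rewrite /word_val !big_nil invg1.
rewrite -cat1s gword_inv_cat !word_val_cat IHu invgM; congr (_ * _).
by rewrite /gword_inv /= /word_val !big_seq1 /=; case: e; rewrite ?invgK.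
Qed.

Hypothesis gen_rels : forall r, rels r -> word_val r = 1.

Lemma word_val_pres u v : pres_eq rels u v -> word_val u = word_val v.
Proof.
elim=> {u v} [//|u v _ ->//|u v w _ -> _ ->//|u u' v v' _ IHu _ IHv|x e|r rr].
- by rewrite !word_val_cat IHu IHv.
- by rewrite /word_val !big_cons !big_nil mulg1; case: e; rewrite /= ?mulgV ?mulVg.
- by rewrite gen_rels // /word_val big_nil.
Qed.

Definition pres_map (c : presented rels) : hT := word_val (repr c).

Lemma pres_mapE u : pres_map (\pi_(presented rels) u) = word_val u.
Proof. exact/word_val_pres/pres_repr. Qed.

Lemma pres_mapM : {morph pres_map : x y / x * y}.
Proof.
elim/quotW=> u; elim/quotW=> v.
have -> : \pi_(presented rels) u * \pi v = \pi_(presented rels) (u ++ v).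
  exact: pres_mulE.
by rewrite !pres_mapE word_val_cat.
Qed.

End PresentationMap.

Section PresentationInduction.
Local Open Scope group_scope.
Variables (X : choiceType) (rels : set (gword X)).

Lemma presented_ind (H : set (presented rels)) : is_subgroup H ->
  (forall x, H (\pi [:: (x, true)])) -> forall g, H g.
Proof.
move=> [H1 HM HV] Hx; elim/quotW=> u; elim: u => [|[x e] u IHu]; first exact: H1.
have -> : \pi_(presented rels) ((x, e) :: u) = \pi_(presented rels) [:: (x, e)] * \pi u.
  by apply/esym; apply: pres_mulE.
apply: HM => //; case: e => //.
have -> : \pi_(presented rels) [:: (x, false)] = (\pi_(presented rels) [:: (x, true)])^-1.
  by apply/esym; apply: pres_invE.
exact: HV.
Qed.

End PresentationInduction.

(** * The lamplighter group *)

Definition lamp_a : lamplighter := \pi_(presented lamplighter_rels) word_a.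
Definition lamp_b : lamplighter := \pi_(presented lamplighter_rels) [:: (false, true)].

Definition lamp_gen (x : bool) : lamp_model := if x then (1, 0) else (0, 1).

Lemma lm_commute0 (p q : ps) : commute ((p, 0) : lamp_model) ((q, 0) : lamp_model).
Proof. by rewrite /commute !lm_mulE /= oppr0 ps_exp0 !mul1r addrC. Qed.

Lemma lamp_gen_rels r : lamplighter_rels r -> word_val lamp_gen r = 1%g.
Proof.
case=> i _ <-; rewrite /word_comm /word_conj !(word_val_cat, word_val_inv).
have -> : word_val lamp_gen word_a = (1, 0) by rewrite /word_val big_seq1.
case: (word_val _ (word_b_exp i)) => q s.
set c := (X in (_ * (X^-1 * (_ * X)))%g).
have -> : c = (ps_exp s * 1, 0) by rewrite /c -(lm_conj0 1 q s).
by have /eqP := introT commgP (lm_commute0 1 (ps_exp s * 1)).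
Qed.

Definition lamp_map : lamplighter -> lamp_model := pres_map (rels := lamplighter_rels) lamp_gen.

Lemma lamp_mapM : {morph lamp_map : x y / (x * y)%g}.
Proof. exact: (pres_mapM lamp_gen_rels). Qed.

HB.instance Definition _ := isMultiplicative.Build lamplighter lamp_model lamp_map lamp_mapM.

Lemma lamp_map_a : lamp_map lamp_a = (1, 0).
Proof. by rewrite [LHS](pres_mapE lamp_gen_rels) /word_val big_seq1. Qed.

Lemma lamp_map_b : lamp_map lamp_b = (0, 1).
Proof. by rewrite [LHS](pres_mapE lamp_gen_rels) /word_val big_seq1. Qed.

Lemma lamp_ind (H : set lamplighter) : is_subgroup H -> H lamp_a -> H lamp_b ->
  forall g, H g.
Proof. by move=> Hg Ha Hb; apply: (presented_ind Hg) => -[]. Qed.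

Section LamplighterGroup.
Local Open Scope group_scope.
Implicit Types g h : lamplighter.

Definition lamp_ai (i : int) : lamplighter :=
  lamp_a ^ (\pi_(presented lamplighter_rels) (word_b_exp i) : lamplighter).

Lemma pi_lamp_cat (u v : gword bool) :
  (\pi_(presented lamplighter_rels) (u ++ v) : lamplighter) =
  (\pi u : lamplighter) * (\pi v : lamplighter).
Proof. by apply/esym; apply: pres_mulE. Qed.

Lemma pi_lamp_inv (u : gword bool) :
  (\pi_(presented lamplighter_rels) (gword_inv u) : lamplighter) = (\pi u : lamplighter)^-1.
Proof. by apply/esym; apply: pres_invE. Qed.

Lemma lamp_aiS (i : int) : lamp_ai (i + 1)%R = lamp_ai i ^ lamp_b.
Proof.
rewrite /lamp_ai -conjgM; congr (_ ^ _); case: i => n /=.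
  by rewrite -[lamp_b]/(\pi _) -pi_lamp_cat nseqD.
case: n => [|n].
  by rewrite -[lamp_b]/(\pi _) -pi_lamp_cat; apply/esym/eqmodP/asboolP/pres_cancel.
have -> : (Negz n.+1 + 1)%R = Negz n by rewrite !NegzE; lia.
have -> : word_b_exp (Negz n) = nseq n.+1 (false, false) by [].
have -> : (false, false) :: nseq n.+1 (false, false) = nseq n.+1 (false, false) ++ [:: (false, false)].
  by rewrite -(nseqD n.+1 1) addn1.
rewrite pi_lamp_cat -mulgA -[lamp_b]/(\pi _) -[X in _ * X]pi_lamp_cat.
have -> : \pi_(presented lamplighter_rels) ([:: (false, false)] ++ [:: (false, true)]) = 1 :> lamplighter.
  by apply/eqmodP/asboolP/(pres_cancel _ false false).
by rewrite mulg1.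
Qed.

(** Conjugation by b shifts both indices, which reduces to i = 0, where the claim is a relator. *)
Lemma lamp_ai_comm i k : commute (lamp_ai i) (lamp_ai k).
Proof.
have conj_commute (x y z : lamplighter) : commute x y -> commute (x ^ z) (y ^ z).
  by rewrite /commute -!conjMg => ->.
have aS (j : int) : lamp_ai j = lamp_ai (j - 1)%R ^ lamp_b by rewrite -lamp_aiS subrK.
have aP (j : int) : lamp_ai j = lamp_ai (j + 1)%R ^ lamp_b^-1 by rewrite lamp_aiS conjgK.
elim/int_rec: i k => [k|n IHn k|n IHn k].
- have -> : lamp_ai 0 = lamp_a.
    by rewrite /lamp_ai; apply: conjg1.
  apply/commgP/eqP; rewrite /lamp_ai /commg /conjg.
  transitivity (\pi_(presented lamplighter_rels)
      (word_comm word_a (word_conj word_a (word_b_exp k))) : lamplighter).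
    by rewrite /word_comm /word_conj !(pi_lamp_cat, pi_lamp_inv).
  by apply/eqmodP/asboolP/pres_relator; exists k.
- rewrite -addn1 PoszD lamp_aiS (aS k); exact: conj_commute.
- have -> : (- n.+1%:Z)%R = (- n%:Z - 1)%R by lia.
  by rewrite (aP (_ - 1)%R) subrK (aP k); apply: conj_commute.
Qed.

(** [zcent] is the center of the centralizer of all conjugates of a. It replaces their normal
    closure: it contains a, and it is visibly abelian and normal. *)
Let cent g : Prop := forall i, commute g (lamp_ai i).
Let zcent g : Prop := cent g /\ forall h, cent h -> commute g h.

Lemma lamp_ai0 : lamp_ai 0 = lamp_a. Proof. exact: conjg1. Qed.

Lemma centJ g : cent g -> cent (g ^ lamp_b) /\ cent (g ^ lamp_b^-1).
Proof.
move=> gc; split=> i.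
  have -> : lamp_ai i = lamp_ai (i - 1)%R ^ lamp_b by rewrite -lamp_aiS subrK.
  by rewrite /commute -!conjMg gc.
have -> : lamp_ai i = lamp_ai (i + 1)%R ^ lamp_b^-1 by rewrite lamp_aiS conjgK.
by rewrite /commute -!conjMg gc.
Qed.

Lemma zcent_a : zcent lamp_a.
Proof.
rewrite -lamp_ai0; split=> [i|h hc]; first exact: lamp_ai_comm.
exact/commute_sym.
Qed.

Lemma zcent_subgroup : is_subgroup [set g | zcent g].
Proof.
split=> [|g h [g1 g2] [h1 h2]|g [g1 g2]]; split.
- by move=> i; apply/commute_sym/commute1.
- by move=> h _; apply/commute_sym/commute1.
- by move=> i; apply/commute_sym/commuteM; apply/commute_sym.
- by move=> k kc; apply/commute_sym/commuteM; apply/commute_sym; [apply: g2 | apply: h2].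
- by move=> i; apply/commute_sym/commuteV/commute_sym.
- by move=> k kc; apply/commute_sym/commuteV/commute_sym/g2.
Qed.

Lemma zcentJ g h : zcent g -> zcent (g ^ h).
Proof.
move: g.
(* Both h and its inverse are required so that the condition on h defines a subgroup. *)
apply: (@lamp_ind [set h | (forall g, zcent g -> zcent (g ^ h)) /\
   (forall g, zcent g -> zcent (g ^ h^-1))] _ _ _ h).1.
- split=> [|x y [x1 x2] [y1 y2]|x [x1 x2]] /=.
  + by split=> g; rewrite ?invg1 conjg1.
  + by split=> g gz; rewrite ?invgM conjgM; [apply/y1/x1 | apply/x2/y2].
  + by rewrite invgK; split.
- by split=> g [g1 g2]; rewrite (_ : g ^ _ = g) // -[RHS]conjg1 /conjg;
  have := g1 0%R; rewrite lamp_ai0 => ga; rewrite ?(commuteV ga) ?ga ?mulKg ?mulgA ?mulVg ?mulgK; 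
  rewrite invg1 mul1g mulg1.
- split=> g [g1 g2]; split.
  + by have [] := centJ g1.
  + move=> k kc; have [_ kb] := centJ kc.
    by have := g2 _ kb; rewrite -{2}[k](conjgKV lamp_b) /commute -!conjMg => ->; rewrite conjMg conjgKV.
  + by have [] := centJ g1.
  + move=> k kc; have [kb _] := centJ kc.
    by have := g2 _ kb; rewrite -{2}[k](conjgK lamp_b) /commute -!conjMg => ->; rewrite conjMg conjgK.
Qed.

(** The quotient by the abelian normal subgroup is generated by b; two natural exponents avoid
    negative powers. *)
Lemma lamp_decomp g : exists x m n, zcent x /\ g * lamp_b ^+ m = x * lamp_b ^+ n.
Proof.
have [z1 zM zV] := zcent_subgroup.
have bC m n : commute (lamp_b ^+ m) (lamp_b ^+ n) by apply: commuteX2.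
apply: (@lamp_ind [set g | exists x m n, zcent x /\ g * lamp_b ^+ m = x * lamp_b ^+ n] _ _ _ g).
- split=> [|g1 g2 [x1 [m1 [n1 [z1' e1]]]] [x2 [m2 [n2 [z2 e2]]]]|g1 [x1 [m1 [n1 [z1' e1]]]]] /=.
  + by exists 1, 0%N, 0%N.
  + exists (x2 ^ g1^-1 * x1), (m2 + m1)%N, (n1 + n2)%N; split.
      by apply: zM => //; apply: zcentJ.
    transitivity (g1 * (x2 * lamp_b ^+ n2) * lamp_b ^+ m1).
      by rewrite -e2 expgnDr !mulgA.
    transitivity (x2 ^ g1^-1 * (x1 * lamp_b ^+ n1) * lamp_b ^+ n2).
      by rewrite -e1 /conjg invgK -!mulgA mulKg (bC m1 n2).
    by rewrite expgnDr !mulgA.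
  + exists (x1^-1 ^ g1), n1, m1; split; first by apply: zcentJ; apply: zV.
    by rewrite /conjg -!mulgA e1 mulKg.
- by exists lamp_a, 0%N, 0%N; split; first exact: zcent_a.
- by exists 1, 0%N, 1%N; rewrite !mul1g !mulg1.
Qed.

Lemma lamp_map_bX n : lamp_map (lamp_b ^+ n) = (0, n%:R)%R.
Proof.
elim: n => [|n IHn]; first exact: group_morph1.
by rewrite expgS lamp_mapM lamp_map_b IHn lm_mulE /= mulr0 addr0 mulrS.
Qed.

Lemma zcent_slope x : zcent x -> (lamp_map x).2 = 0%R.
Proof.
case=> /(_ 0%R); rewrite lamp_ai0 => /(congr1 lamp_map).
rewrite !lamp_mapM lamp_map_a; case: (lamp_map x) => p s; rewrite !lm_mulE /=.
case=> /(congr1 (fun f : ps => f 1%N)) + _.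
rewrite !psD oppr0 ps_exp0 mulr1 mul1r ps1 /= add0r -[RHS]addr0 => /addrI.
by rewrite /ps_exp expr1 divr1 => /eqP; rewrite oppr_eq0 => /eqP.
Qed.

(** Slope 0 forces equal exponents of b in [lamp_decomp], so that both elements lie in [zcent]. *)
Lemma slope0_commute g h : (lamp_map g).2 = 0%R -> (lamp_map h).2 = 0%R -> commute g h.
Proof.
have sP k : (lamp_map k).2 = 0%R -> zcent k.
  have [x [m [n [xz e]]]] := lamp_decomp k; move=> ks.
  have := congr1 (fun z : lamp_model => z.2) (congr1 lamp_map e).
  rewrite !lamp_mapM !lm_mulE /= ks (zcent_slope xz) !add0r !lamp_map_bX /= => /eqP.
  by rewrite eqr_nat => /eqP mn; move: e; rewrite mn => /mulIg->.
by move=> /sP[_ gz] /sP[hz _]; apply: gz.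
Qed.

(** The image in the model is (1 - e^x)^k, which starts with x^k up to sign. *)
Fixpoint lamp_z k : lamplighter :=
  if k is m.+1 then [~ lamp_b, lamp_z m] else lamp_a.

Lemma lamp_z_glcs k : glcs k.+1 (lamp_z k).
Proof. by elim: k => [//|k IHk]; apply: glcsR. Qed.

Lemma lamp_map_z k : lamp_map (lamp_z k) = ((- (psX * ps_expq 1)) ^+ k, 0)%R.
Proof.
elim: k => [|k IHk]; first exact: lamp_map_a.
have -> : lamp_map (lamp_z k.+1) = [~ lamp_map lamp_b, lamp_map (lamp_z k)].
  by rewrite /= !lamp_mapM !group_morphV.
rewrite lamp_map_b IHk [LHS]surjective_pairing lm_commE; congr pair.
rewrite /= ps_exp0 subrr !mul0r subr0 mulr1.
by rewrite ps_expE rmorph1 mul1r exprS; congr (_ * _)%R; ring.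
Qed.

Lemma lamp_z_coef k : (lamp_map (lamp_z k)).1 k = ((-1) ^+ k)%R.
Proof.
rewrite lamp_map_z [(_, _).1]/= (exprNn (psX * ps_expq 1)) exprMn mulrCA psX_exp_mul ltnn subnn psM0.
have -> : ((-1) ^+ k)%R = ps_const ((-1) ^+ k)%R by rewrite rmorphXn rmorphN1.
have -> : (ps_expq 1 ^+ k)%R 0%N = 1%R.
  elim: (k) => [//|m IHm]; by rewrite exprS psM0 IHm ps_expq_coef0 mul1r.
by rewrite mulr1.
Qed.

(** By induction, commutators of the generators with the previous generator suffice: b gives the
    next one, and a commutes with everything of slope 0. The case k = 0 is excluded because the
    abelianization has rank 2. *)
Lemma lamp_glcs_cyclic k g : (0 < k)%N -> glcs k.+1 g ->
  exists m n, lcs_cong k.+2 (lamp_z k ^+ m * g) (lamp_z k ^+ n).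
Proof.
elim: k g => [//|k IHk] g _.
pose B k := [set y | exists m n, lcs_cong k.+2 (lamp_z k ^+ m * y) (lamp_z k ^+ n)].
have Bg l : is_subgroup (B l) by apply/subgroup_cyclic_mod/lamp_z_glcs.
have Bz l : B l (lamp_z l).
  by exists 0%N, 1%N; rewrite mul1g; apply: lcs_cong_refl.
have Bk l : @glcs lamplighter l.+2 `<=` B l.
  by move=> y yl; exists 0%N, 0%N; rewrite mul1g expg0; apply/lcs_cong_sym/lcs_cong1.
have [B1 BM BV] := Bg k.+1.
rewrite glcsS // => /(_ (B k.+1)); apply; split=> // _ [x _ [y yk <-]].
have bB : B k.+1 [~ lamp_b, y].
  case: k => [|k] in IHk Bg Bz Bk B1 BM BV yk *.
    apply: (lamp_ind (H := [set y | glcs 1 y /\ B 1%N [~ lamp_b, y]]) _ _ _ y).2.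
    - exact: subgroup_commR.
    - by split=> //; apply: Bz.
    - by split=> //; rewrite commgg.
  have [m [n e]] := IHk y isT yk.
  have [S1 SM SV] := subgroup_commR (k := k.+2) lamp_b (Bg k.+2) (Bk k.+2).
  have Sz l : (fun y => glcs k.+2 y /\ B k.+2 [~ lamp_b, y]) (lamp_z k.+1 ^+ l).
    elim: l => [//|l IHl]; rewrite expgS; apply: SM => //.
    by split; [apply: lamp_z_glcs | apply: (Bz k.+2)].
  have -> : y = (lamp_z k.+1 ^+ m)^-1 * (lamp_z k.+1 ^+ n * ((lamp_z k.+1 ^+ n)^-1 * (lamp_z k.+1 ^+ m * y))).
    by rewrite mulVKg mulKg.
  apply: (SM _ _ (SV _ (Sz m)) (SM _ _ (Sz n) _)).2.
  have e' : glcs k.+3 ((lamp_z k.+1 ^+ n)^-1 * (lamp_z k.+1 ^+ m * y)) by exact: lcs_cong_sym e.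
  by split; [apply: glcs_sub | apply/Bk/glcsR].
apply: (lamp_ind (subgroup_commL (Bg k.+1) (Bk k.+1) yk)) => //=.
case: k => [|k] in IHk Bg Bz Bk B1 BM BV yk bB *.
  apply: (lamp_ind (H := [set y | glcs 1 y /\ B 1%N [~ lamp_a, y]]) _ _ _ y).2.
  - exact: subgroup_commR.
  - by split=> //; rewrite commgg.
  - by split=> //; rewrite -invgR; apply/BV/Bz.
have /commgP/eqP -> // : commute lamp_a y.
apply: slope0_commute; first by rewrite lamp_map_a.
by have [-> //] := lm_filt_glcs lamp_map yk.
Qed.

Lemma lamp_cong_filt n g h : lcs_cong n g h -> lm_filt n ((lamp_map g)^-1 * lamp_map h).
Proof. by move=> /(lm_filt_glcs lamp_map); rewrite gmulfM group_morphV. Qed.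

Lemma lamp_abelianization g : exists p q r t,
  lcs_cong 2 (lamp_a ^+ p * lamp_b ^+ q * g) (lamp_a ^+ r * lamp_b ^+ t).
Proof.
have cr := @lcs_cong_refl lamplighter 2; have cC := @lcs_cong_comm2 lamplighter.
pose D := [set y | exists p q r t,
  lcs_cong 2 (lamp_a ^+ p * lamp_b ^+ q * y) (lamp_a ^+ r * lamp_b ^+ t)].
have abM p q r t : lcs_cong 2 (lamp_a ^+ p * lamp_b ^+ q * (lamp_a ^+ r * lamp_b ^+ t))
    (lamp_a ^+ (p + r) * lamp_b ^+ (q + t)).
  rewrite !expgnDr -!mulgA; apply: lcs_congM => //; rewrite !mulgA.
  by apply: lcs_congM.
apply: (@lamp_ind D _ _ _ g).
- split=> [|y y' [p [q [r [t e]]]] [p' [q' [r' [t' e']]]]|y [p [q [r [t e]]]]].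
  + by exists 0%N, 0%N, 0%N, 0%N; rewrite !mulg1; apply: cr.
  + exists (p' + p)%N, (q' + q)%N, (r + r')%N, (t + t')%N.
    apply: lcs_cong_trans (abM _ _ _ _).
    apply: (@lcs_cong_trans _ _ (lamp_a ^+ r * lamp_b ^+ t * (lamp_a ^+ p' * lamp_b ^+ q') * y')).
      rewrite mulgA; apply: lcs_congM => //.
      apply: lcs_cong_trans (cC _ _).
      apply: (@lcs_cong_trans _ _ (lamp_a ^+ p' * lamp_b ^+ q' * (lamp_a ^+ p * lamp_b ^+ q) * y)).
        by apply: lcs_congM => //; apply: lcs_cong_sym.
      by rewrite -mulgA; apply: lcs_congM.
    by rewrite -mulgA; apply: lcs_congM.
  + exists r, t, p, q; apply: (@lcs_cong_trans _ _ (lamp_a ^+ p * lamp_b ^+ q * y * y^-1)).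
      by apply: lcs_congM => //; apply: lcs_cong_sym.
    by rewrite mulgK; apply: cr.
- by exists 0%N, 0%N, 1%N, 0%N; rewrite !mul1g mulg1; apply: cr.
- by exists 0%N, 0%N, 0%N, 1%N; rewrite !mul1g; apply: cr.
Qed.

Lemma lamp_map_aX n : lamp_map (lamp_a ^+ n) = ((n%:R)%R, 0%R).
Proof.
elim: n => [|n IHn]; first exact: group_morph1.
rewrite expgS lamp_mapM lamp_map_a IHn lm_mulE /= oppr0 ps_exp0 mul1r addr0.
by rewrite mulrS.
Qed.

Lemma lamp_map_zX k n : lamp_map (lamp_z k ^+ n) = ((lamp_map (lamp_z k)).1 *+ n, 0)%R.
Proof.
elim: n => [|n IHn]; first exact: group_morph1.
rewrite expgS lamp_mapM IHn lm_mulE [(lamp_map (lamp_z k)).2](_ : _ = 0%R).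
  by rewrite oppr0 ps_exp0 mul1r mulrS addr0.
by rewrite lamp_map_z.
Qed.

Lemma psMn (f : ps) n i : (f *+ n)%R i = (f i *+ n)%R.
Proof. by elim: n => [//|n IHn]; rewrite !mulrS psD IHn. Qed.

Lemma psnat0 n : (n%:R : ps)%R 0%N = (n%:R)%R.
Proof. by rewrite psMn ps1. Qed.

Lemma lm_mul_coef0 (u v : lamp_model) : ((u * v)%g.1 0%N = u.1 0%N + v.1 0%N)%R.
Proof. by rewrite lm_mulE /= psD psM0 ps_exp_coef0 mul1r. Qed.

Lemma lm_inv_coef0 (u : lamp_model) : ((u^-1)%g.1 0%N = - u.1 0%N)%R.
Proof. by rewrite lm_invE /= psN psM0 ps_exp_coef0 mul1r. Qed.

(** The generator of each graded piece has a nonzero leading coefficient in the model, so an element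
    that vanishes there to the next order has exponent 0 in this piece. In the abelianization,
    constant coefficient and slope give the exponents of a and b. *)
Lemma lamp_filt_glcs n g : lm_filt n (lamp_map g) -> glcs n g.
Proof.
elim: n => [//|n IHn] gn; case: n IHn gn => [//|n] IHn [g1 g2].
have gs := g1 isT; case: n IHn g1 g2 => [|n] IHn g1 g2.
  have [p [q [r [t e]]]] : exists p q r t,
      lcs_cong 2 (lamp_a ^+ p * lamp_b ^+ q * g) (lamp_a ^+ r * lamp_b ^+ t).
    exact: lamp_abelianization.
  have [/(_ isT) e1 e2] := lamp_cong_filt e.
  have e3 := e2 0%N isT.
  move: e1 e3; rewrite lm_mul_coef0 lm_inv_coef0 !lamp_mapM !lm_mul_coef0.
  rewrite !lamp_map_aX !lamp_map_bX g2 //= gs !ps0 psnat0 !(addr0, add0r).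
  rewrite [(- _ + _)%R]addrC [(- _ + _)%R in X in _ -> X -> _]addrC psnat0.
  move=> /subr0_eq/eqP; rewrite eqr_nat => /eqP tq /subr0_eq/eqP; rewrite eqr_nat => /eqP rp.
  apply/lcs_cong1; move: e; rewrite tq rp => e; apply: lcs_cong_sym.
  have := lcs_congM (lcs_cong_refl 2 (lamp_a ^+ p * lamp_b ^+ q)^-1) e.
  by rewrite mulKg mulVg.
have gn : glcs n.+2 g.
  by apply: IHn; split=> // i iN; apply: g2; apply: leq_trans iN _.
have [p [q e]] := lamp_glcs_cyclic (k := n.+1) isT gn.
suff pq : p = q.
  move: e; rewrite pq => e; apply/lcs_cong1/lcs_cong_sym.
  have := lcs_congM (lcs_cong_refl n.+3 (lamp_z n.+1 ^+ q)^-1) e.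
  by rewrite mulKg mulVg.
have [_ /(_ n.+1 (ltnSn _))] := lamp_cong_filt e.
rewrite lamp_mapM !lamp_map_zX; have := lamp_z_coef n.+1.
move: (lamp_map (lamp_z n.+1)).1 => f fn.
rewrite (surjective_pairing (lamp_map g)) gs lm_mulE lm_invE /=.
rewrite !(oppr0, addr0, ps_exp0, mul1r) opprD !psD !psN g2 // oppr0 addr0 !psMn fn.
have : ((-1) ^+ n.+1 != 0 :> rat)%R by rewrite signr_eq0.
move: ((-1) ^+ n.+1)%R => c c0; rewrite ps0 addrC => /subr0_eq/eqP.
rewrite -(mulr_natr c p) -(mulr_natr c q) => /eqP/(mulfI c0)/eqP.
by rewrite eqr_nat => /eqP.
Qed.

End LamplighterGroup.

(** * Malcev groups *)

Section RationalScaling.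
Variables (B : zmodType) (sc : rat -> B -> B).
Hypothesis scP : rat_scaling sc.

Lemma rat_scaling0 b : sc 0 b = 0.
Proof. by apply: (addrI (sc 0 b)); rewrite -(rat_scalingDl scP) !addr0. Qed.

Lemma rat_scaling_nat n q b : sc (n%:R * q) b = sc q b *+ n.
Proof.
elim: n => [|n IHn]; first by rewrite mul0r rat_scaling0.
by rewrite mulrS mulrDl mul1r (rat_scalingDl scP) IHn mulrS.
Qed.

Lemma rat_scaling_int (z : int) b : sc z%:~R b = b *~ z.
Proof.
have scn n : sc n%:R b = b *+ n.
  by rewrite -[n%:R]mulr1 rat_scaling_nat (rat_scaling1 scP).
case: z => n; first by rewrite -pmulrn scn.
apply/eqP; rewrite NegzE mulrNz -addr_eq0 -pmulrn -scn -(rat_scalingDl scP).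
by rewrite addNr rat_scaling0.
Qed.

Lemma rat_scaling_torsion (b : B) n : (0 < n)%N -> b *+ n = 0 -> b = 0.
Proof.
move=> n0 bn; have n0' : n%:R != 0 :> rat by rewrite pnatr_eq0 -lt0n.
rewrite -(rat_scaling1 scP b) -[1](mulVf n0') -(rat_scalingA scP).
rewrite -[X in sc _ (sc X _)]mulr1 rat_scaling_nat (rat_scaling1 scP) bn.
by apply: (addrI (sc n%:R^-1 0)); rewrite -(rat_scalingDr scP) !addr0.
Qed.

Lemma rat_scaling_div (b : B) n : (0 < n)%N -> exists c : B, c *+ n = b.
Proof.
move=> n0; have n0' : n%:R != 0 :> rat by rewrite pnatr_eq0 -lt0n.
by exists (sc n%:R^-1 b); rewrite -rat_scaling_nat mulfV // (rat_scaling1 scP).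
Qed.

Variables (A : zmodType) (f : A -> B).
Hypothesis fD : {morph f : a b / a + b}.
Hypothesis fbij : bijective (tensor_lift sc f).

(** The pure tensor of a and 1 has image f a = 0, so it is zero, and [phi] extends to the tensor
    product. *)
Lemma tensor_lift_ker (phi : A -> rat) a : {morph phi : a b / a + b} ->
  f a = 0 -> phi a = 0.
Proof.
move=> phiD fa0.
have rP : rat_scaling (fun q r : rat => q * r).
  by split=> [q r b|b|q b c|q r b]; rewrite ?mulrA ?mul1r ?mulrDr ?mulrDl.
have e : \pi_(tensorQ A) [:: (a, 1)] = \pi_(tensorQ A) [::].
  apply: (bij_inj fbij); rewrite !tensor_liftE // big_seq1 big_nil /=.
  by rewrite (rat_scaling1 scP).
have := congr1 (tensor_lift (fun q r : rat => q * r) phi) e.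
by rewrite !tensor_liftE // big_seq1 big_nil /= mul1r.
Qed.

(** Clear the denominators in a tensor that maps to b. *)
Lemma tensor_lift_surj b : exists m a, (0 < m)%N /\ (b *+ m = f a)%R.
Proof.
have [g _ gK] := fbij; rewrite -(gK b) -[g b]reprK tensor_liftE //.
have f0 : f 0 = 0 by apply: (addrI (f 0)); rewrite -fD !addr0.
have fn a n : f (a *+ n) = f a *+ n.
  by elim: n => [//|n IHn]; rewrite !mulrS fD IHn.
have fN a : f (- a) = - f a by apply/eqP; rewrite -addr_eq0 -fD addNr f0.
have fz a (z : int) : f (a *~ z) = f a *~ z.
  by case: z => n; [exact: fn | rewrite NegzE !mulrNz fN; congr (- _); exact: fn].
elim: (repr (g b)) => [|[a q] s [m [c [m0 e]]]].
  by exists 1%N, 0; rewrite big_nil f0 mul0rn.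
exists (`|denq q| * m)%N, (a *~ (numq q * m) + c *+ `|denq q|).
split; first by rewrite muln_gt0 m0 absz_gt0 denq_neq0.
rewrite big_cons mulrnDl fD fn -e -mulrnA [(m * _)%N]mulnC; congr (_ + _).
rewrite /= fz -rat_scaling_int -rat_scaling_nat; congr (sc _ _).
rewrite natrM mulrAC rmorphM /= -pmulrn; congr (_ * _).
by rewrite natr_absz ger0_norm ?denq_ge0 // mulrC numqE.
Qed.

End RationalScaling.

Lemma group_morphX (gT hT : groupType) (f : {multiplicative gT -> hT}) x m :
  (f (x ^+ m) = f x ^+ m)%g.
Proof. by elim: m => [|m IHm]; [exact: group_morph1 | rewrite !expgS gmulfM IHm]. Qed.

Lemma glcsX (gT : groupType) n m (x : gT) : glcs n x -> glcs n (x ^+ m)%g.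
Proof.
by move=> xn; elim: m => [|m IHm]; [exact: glcs1 | rewrite expgS; apply: glcsM].
Qed.

Section GradedPieces.
Local Open Scope group_scope.
Variables (gT : groupType) (n : nat).
Implicit Types x y : glcs_type gT n.

Lemma gr_eqP x y : \pi_(gr gT n) x = \pi y <-> lcs_cong n.+1 (val x) (val y).
Proof. by split=> [/eqmodP/asboolP|h]; last exact/eqmodP/asboolP. Qed.

Lemma gr_expE x m : exists x',
  val x' = val x ^+ m /\ \pi_(gr gT n) x' = ((\pi_(gr gT n) x : gr gT n) *+ m)%R.
Proof.
elim: m => [|m [x' [x'E x'P]]]; first by exists (glcs_elt (@glcs1 gT n)).
exists (glcs_elt (glcsM (glcs_typeP x) (glcs_typeP x'))); split.
  by rewrite /= x'E expgS.
by rewrite mulrS -x'P; apply/esym/gr_addE.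
Qed.

Lemma gr_eq0P x : \pi_(gr gT n) x = 0%R <-> glcs n.+1 (val x).
Proof.
rewrite -lcs_cong1; split=> [e|e]; last by apply/gr_eqP/lcs_cong_sym.
by apply/lcs_cong_sym/(gr_eqP x (glcs_elt (@glcs1 gT n))).
Qed.

End GradedPieces.

Section MalcevGroup.
Local Open Scope group_scope.
Variable gT : groupType.
Hypothesis gTm : malcev_group gT.
Implicit Types x y z : gT.

Lemma malcev_torsion n x m : (0 < n)%N -> (0 < m)%N -> glcs n x ->
  glcs n.+1 (x ^+ m) -> glcs n.+1 x.
Proof.
move=> n0 m0 xn xm; have [sc scP] := gTm.1 n n0.
apply/(gr_eq0P (glcs_elt xn))/(rat_scaling_torsion scP m0).
have [x' [x'E <-]] := gr_expE (glcs_elt xn) m.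
by apply/gr_eq0P; rewrite x'E.
Qed.

Lemma malcev_div n x m : (0 < n)%N -> (0 < m)%N -> glcs n x ->
  exists y, glcs n y /\ lcs_cong n.+1 (y ^+ m) x.
Proof.
move=> n0 m0 xn; have [sc scP] := gTm.1 n n0.
have [] := rat_scaling_div scP (\pi_(gr gT n) (glcs_elt xn)) m0.
elim/quotW=> y e; exists (val y); split; first exact: glcs_typeP.
have [y' [<- y'P]] := gr_expE y m.
by apply/(gr_eqP y' (glcs_elt xn)); rewrite y'P.
Qed.

(** By induction x and y differ by an element central modulo the next term; its m-th power is
    trivial there, and graded pieces have no torsion. *)
Lemma lcs_cong_root n x y m : (0 < m)%N -> lcs_cong n (x ^+ m) (y ^+ m) -> lcs_cong n x y.
Proof.
move=> m0; elim: n => [//|[//|n] IHn] e.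
have xy : glcs n.+1 (y^-1 * x) by apply/lcs_cong_sym/IHn/(lcs_cong_le _ e).
apply: lcs_cong_sym; apply: (@malcev_torsion n.+1 _ m) => //.
have h := lcs_cong_expM y m xy; rewrite mulVKg in h.
have := lcs_congM (lcs_cong_refl n.+2 (y ^+ m)^-1) (lcs_cong_trans (lcs_cong_sym h) e).
by rewrite mulKg mulVg => /lcs_cong_sym/lcs_cong1.
Qed.

Lemma glcs_root n x m : (0 < m)%N -> glcs n (x ^+ m) -> glcs n x.
Proof.
move=> m0 /lcs_cong1 xm; apply/lcs_cong1/(lcs_cong_root m0).
by rewrite expg1n.
Qed.

Lemma malcev_sep x y : (forall n, lcs_cong n x y) -> x = y.
Proof.
move=> xy; apply: (bij_inj gTm.2); apply: val_inj => /=.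
by apply: functional_extensionality_dep => n; apply/eqmodP; apply/asboolP; apply: xy.
Qed.

Lemma malcev_complete (u : nat -> gT) : (forall n, lcs_cong n (u n) (u n.+1)) ->
  exists y, forall n, lcs_cong n y (u n).
Proof.
move=> uc; have uC : compatible (@gquot_proj gT) (fun n => \pi_(gquot gT n) (u n)).
  by apply/asboolP => n; rewrite gquot_projE; apply/eqmodP/asboolP/lcs_cong_sym.
have [g _ gK] := gTm.2; pose f : gcompletion gT := exist _ (fun n => \pi_(gquot gT n) (u n)) uC.
exists (g f) => n; have := congr1 (fun h : gcompletion gT => val h n) (gK f).
by move/eqmodP/asboolP.
Qed.

End MalcevGroup.

(** * Comparing the lamplighter group with its completion *)

Section Completion.
Local Open Scope group_scope.
Variables (gT : groupType) (iota : {multiplicative lamplighter -> gT}).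
Hypothesis iotaP : malcev_completion iota.
Let gTm : malcev_group gT := iotaP.1.
Implicit Types (x y z : gT) (g h : lamplighter).

Lemma lm_filt_mul n (u v : lamp_model) : lm_filt n.+1 v ->
  ((u * v)%g.1 n = u.1 n + v.1 n)%R.
Proof.
case=> _ v0; rewrite lm_mulE /= psD psM big_ord_recl subn0 ps_exp_coef0 mul1r.
rewrite big1 ?addr0 // => i _; rewrite v0 ?mulr0 // lift0 /=.
by have := ltn_ord i; lia.
Qed.

(** The leading coefficient and the slope in the model are additive maps from the graded piece to Q.
    They vanish on whatever dies in the graded piece of Ghat, and [lamp_filt_glcs] concludes. *)
Lemma iota_inj n g : glcs n (iota g) -> glcs n g.
Proof.
elim: n => [//|[//|n] IHn] ign; have gn := IHn (glcs_sub ign).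
have [sc scP] := gTm.1 n.+1 isT; have bij := iotaP.2 n.+1 isT sc scP.
have g0 : gr_map iota (\pi_(gr lamplighter n.+1) (glcs_elt gn)) = 0%R.
  by rewrite gr_mapE; apply/gr_eq0P.
pose ell (c : gr lamplighter n.+1) : rat := (lamp_map (val (repr c))).1 n.
pose slo (c : gr lamplighter n.+1) : rat := (lamp_map (val (repr c))).2.
have rC (x : glcs_type lamplighter n.+1) :
    lm_filt n.+2 ((lamp_map (val (repr (\pi_(gr lamplighter n.+1) x))))^-1 * lamp_map (val x)).
  exact: lamp_cong_filt (gr_repr x).
have fP (x : glcs_type lamplighter n.+1) : lm_filt n.+1 (lamp_map (val x)).
  exact/lm_filt_glcs/glcs_typeP.
have ellE (x : glcs_type lamplighter n.+1) : ell (\pi x) = (lamp_map (val x)).1 n.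
  have [h1 h2] := rC x; rewrite /ell; move: h1 h2; move: (lamp_map (val (repr _))) => r h1 h2.
  have -> : lamp_map (val x) = r * (r^-1 * lamp_map (val x)) by rewrite mulVKg.
  rewrite lm_filt_mul; last by split=> [_|i iN]; [apply: h1 | apply/h2/ltnW].
  by rewrite h2 // addr0.
have sloE (x : glcs_type lamplighter n.+1) : slo (\pi x) = (lamp_map (val x)).2.
  have [h1 h2] := rC x; rewrite /slo; move: h1 h2; move: (lamp_map (val (repr _))) => r h1 h2.
  have -> : lamp_map (val x) = r * (r^-1 * lamp_map (val x)) by rewrite mulVKg.
  by rewrite -[RHS]/(r.2 + (r^-1 * lamp_map (val x))%g.2)%R h1 // addr0.
have grD (x y : glcs_type lamplighter n.+1) := @gr_addE lamplighter n.+1 x y.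
have ellD : {morph ell : c d / (c + d)%R}.
  elim/quotW=> x; elim/quotW=> y; rewrite [X in ell X](grD x y) !ellE.
  rewrite -[val (glcs_elt _)]/(val x * val y) lamp_mapM lm_filt_mul //; exact: fP.
have sloD : {morph slo : c d / (c + d)%R}.
  by elim/quotW=> x; elim/quotW=> y; rewrite [X in slo X](grD x y) !sloE /= lamp_mapM.
have e1 := tensor_lift_ker scP (@gr_mapD _ _ iota n.+1) bij ellD g0.
have s1 := tensor_lift_ker scP (@gr_mapD _ _ iota n.+1) bij sloD g0.
apply: lamp_filt_glcs; split=> [_|i]; first by rewrite -(sloE (glcs_elt gn)).
rewrite [n.+2.-1]/= ltnS leq_eqVlt => /predU1P[->|iN].
  by rewrite -(ellE (glcs_elt gn)).
by have [_ h] := fP (glcs_elt gn); apply: h.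
Qed.

Lemma iota_surj n y : (0 < n)%N -> glcs n y ->
  exists m g, [/\ (0 < m)%N, glcs n g & lcs_cong n.+1 (y ^+ m) (iota g)].
Proof.
move=> n0 yn; have [sc scP] := gTm.1 n n0; have bij := iotaP.2 n n0 sc scP.
have [m [a [m0 e]]] := tensor_lift_surj scP (@gr_mapD _ _ iota n) bij
  (\pi_(gr gT n) (glcs_elt yn)).
move: e; elim/quotW: a => a e; exists m, (val a); split=> //; first exact: glcs_typeP.
have [y' [y'E y'P]] := gr_expE (glcs_elt yn) m.
rewrite -[y ^+ m]y'E; apply/(gr_eqP y' (glcs_elt (glcs_morph iota (glcs_typeP a)))).
rewrite y'P e.
rewrite -(gr_mapE iota (glcs_typeP a)); congr (gr_map _ (\pi _)).
exact: val_inj.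
Qed.

(** The error at one level is central modulo the next, so after a further power it is absorbed by
    another element of the image. *)
Lemma iota_root k n y : (0 < k)%N -> glcs k y ->
  exists m g, [/\ (0 < m)%N, glcs k g & lcs_cong (k + n) (y ^+ m) (iota g)].
Proof.
move=> k0 yk; elim: n => [|n [m [g [m0 gk e]]]].
  exists 1%N, 1; split=> //; first exact: glcs1.
  by rewrite addn0 group_morph1; apply/lcs_cong_sym/lcs_cong1.
have cn : glcs (k + n) ((iota g)^-1 * y ^+ m) by apply: lcs_cong_sym.
have [m' [g' [m'0 g'k e']]] := iota_surj (ltn_addr n k0) cn.
exists (m * m')%N, (g ^+ m' * g'); split; first by rewrite muln_gt0 m0.
  apply: glcsM; last exact: glcs_le (leq_addr _ _) _ g'k.
  exact: glcsX.
rewrite addnS gmulfM; have := lcs_cong_expM (iota g) m' cn.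
rewrite mulVKg expgnA => h; apply: lcs_cong_trans h _; apply: lcs_congM => //.
by rewrite group_morphX; apply: lcs_cong_refl.
Qed.

End Completion.

(** * Coordinates on the Malcev completion *)

Section LampModelPowers.
Implicit Types u v w : lamp_model.

Lemma lm_slopeX u n : (u ^+ n)%g.2 = u.2 *+ n.
Proof. by elim: n => [//|n IHn]; rewrite expgS mulrS /= IHn. Qed.

Lemma lm_crdX u n : u.2 = 0 -> (u ^+ n)%g.1 = u.1 *+ n.
Proof. by case: u => p s /= ->; rewrite lm_exp0. Qed.

Lemma lm_crdM u v : u.2 = 0 -> (u * v)%g.1 = u.1 + v.1.
Proof. by move=> u0; rewrite lm_mulE /= u0 oppr0 ps_exp0 mul1r. Qed.

Lemma ps_eqm_mulrn n m (f g : ps) : (0 < m)%N -> ps_eqm n (f *+ m) (g *+ m) -> ps_eqm n f g.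
Proof.
move=> m0 fg i iN; have := fg i iN; rewrite !psMn => /eqP.
by rewrite -subr_eq0 -mulrnBl mulrn_eq0 -[(m == 0)%N]negbK -lt0n m0 subr_eq0 => /eqP.
Qed.

Lemma ps_eqmMn n m (f g : ps) : ps_eqm n f g -> ps_eqm n (f *+ m) (g *+ m).
Proof. by move=> fg i iN; rewrite !psMn fg. Qed.

End LampModelPowers.

Section Coordinate.
Local Open Scope group_scope.
Variables (gT : groupType) (iota : {multiplicative lamplighter -> gT}).
Hypothesis iotaP : malcev_completion iota.
Let gTm : malcev_group gT := iotaP.1.
Implicit Types (x y z : gT) (g h : lamplighter) (p q : ps).

Let crd g := (lamp_map g).1.
Let slp g := (lamp_map g).2.

(* The rational span of the conjugates of a, closed in the pronilpotent       *)
(* topology                                                                   *)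
Definition in_base y : Prop := forall n, exists m g,
  [/\ (0 < m)%N, slp g = 0%R & lcs_cong n (y ^+ m) (iota g)].

Definition base_coord y p : Prop := forall n, exists m g,
  [/\ (0 < m)%N, slp g = 0%R, lcs_cong n (y ^+ m) (iota g) & ps_eqm n.-1 (crd g) (p *+ m)%R].

Lemma base_coord_in y p : base_coord y p -> in_base y.
Proof. by move=> yp n; have [m [g [m0 g0 e _]]] := yp n; exists m, g. Qed.

Lemma iota_cong n g h : lcs_cong n (iota g) (iota h) -> lcs_cong n g h.
Proof. by rewrite /lcs_cong -group_morphV -gmulfM => /(iota_inj iotaP). Qed.

Lemma iota_congP n g h : lcs_cong n g h -> lcs_cong n (iota g) (iota h).
Proof. by rewrite /lcs_cong -group_morphV -gmulfM; apply: glcs_morph. Qed.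

Lemma crd_cong n g h : slp g = 0%R -> slp h = 0%R -> lcs_cong n (iota g) (iota h) ->
  ps_eqm n.-1 (crd g) (crd h).
Proof.
move=> g0 h0 /iota_cong/lamp_cong_filt[_].
rewrite lm_crdM; last by rewrite /= [(lamp_map g).2]g0 oppr0.
rewrite lm_invE /= [(lamp_map g).2]g0 ps_exp0 mul1r => e i iN.
by have := e i iN; rewrite psD psN addrC => /subr0_eq.
Qed.

Lemma crd_congP n g h : slp g = 0%R -> slp h = 0%R -> ps_eqm n.-1 (crd g) (crd h) ->
  lcs_cong n (iota g) (iota h).
Proof.
move=> g0 h0 e; apply/iota_congP/lamp_filt_glcs; rewrite lamp_mapM group_morphV.
split=> [_|]; first by rewrite /= [(lamp_map g).2]g0 [(lamp_map h).2]h0 oppr0 addr0.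
rewrite lm_crdM; last by rewrite /= [(lamp_map g).2]g0 oppr0.
rewrite lm_invE /= [(lamp_map g).2]g0 ps_exp0 mul1r => i iN.
by rewrite psD psN [X in (- X)%R](e i iN) addNr.
Qed.

Lemma slpX g m : slp (g ^+ m) = (slp g *+ m)%R.
Proof. by rewrite /slp group_morphX lm_slopeX. Qed.

Lemma slpM g h : slp (g * h) = (slp g + slp h)%R.
Proof. by rewrite /slp lamp_mapM. Qed.

Lemma crdX g m : slp g = 0%R -> crd (g ^+ m) = (crd g *+ m)%R.
Proof. by move=> g0; rewrite /crd group_morphX lm_crdX. Qed.

Lemma crdM g h : slp g = 0%R -> crd (g * h) = (crd g + crd h)%R.
Proof. by move=> g0; rewrite /crd lamp_mapM lm_crdM. Qed.

Lemma base_coord_uniq y p q : base_coord y p -> base_coord y q -> p = q.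
Proof.
move=> yp yq; apply: ps_eqmP => n.
have [m [g [m0 g0 e eg]]] := yp n.+1; have [m' [g' [m'0 g'0 e' eg']]] := yq n.+1.
apply: (@ps_eqm_mulrn _ (m * m')); first by rewrite muln_gt0 m0.
rewrite mulrnA [(m * m')%N]mulnC [X in ps_eqm _ _ X]mulrnA.
apply: ps_eqm_trans (ps_eqmMn m' (ps_eqm_sym eg)) _.
apply: ps_eqm_trans (ps_eqmMn m eg'); rewrite -!crdX //.
apply: (@crd_cong n.+1); rewrite ?slpX ?g0 ?g'0 ?mul0rn //.
rewrite !group_morphX; apply: lcs_cong_trans (lcs_congX m' (lcs_cong_sym e)) _.
by rewrite expgnAC; apply: lcs_congX.
Qed.

Lemma base_coord_ex y : in_base y -> exists p, base_coord y p.
Proof.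
move=> yb; have /choice[m /choice[g mg]] := yb.
(* Approximation modulo the term i + 2 is what determines coefficient i. *)
pose p : ps := fun i => ((crd (g i.+2)) i / (m i.+2)%:R)%R.
have pE n i : (i.+1 < n)%N -> p i = ((crd (g n)) i / (m n)%:R)%R.
  move=> iN; have [m0 g0 e] := mg i.+2; have [m1 g1 e1] := mg n.
  have h : ps_eqm i.+1 (crd (g i.+2 ^+ m n)) (crd (g n ^+ m i.+2)).
    apply: (@crd_cong i.+2); rewrite ?slpX ?g0 ?g1 ?mul0rn // !group_morphX.
    apply: lcs_cong_trans (lcs_congX _ (lcs_cong_sym e)) _; rewrite expgnAC.
    by apply: lcs_congX; apply: lcs_cong_le e1.
  have := h i (ltnSn i); rewrite !crdX // !psMn /p => e2.
  have n0 k : (0 < k)%N -> (k%:R != 0 :> rat)%R by rewrite pnatr_eq0 -lt0n.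
  apply/eqP; rewrite eqr_div ?n0 //.
  by rewrite !mulr_natr e2.
exists p => n; have [m0 g0 e] := mg n; exists (m n), (g n); split=> // i iN.
rewrite psMn (pE n); last by case: (n) iN.
by rewrite -[RHS]mulr_natr divfK // pnatr_eq0 -lt0n.
Qed.

Definition theta y : ps := xget 0%R [set p | base_coord y p].

Lemma thetaP y : in_base y -> base_coord y (theta y).
Proof.
by move=> /base_coord_ex[p yp]; rewrite /theta; case: xgetP => // /(_ p).
Qed.

Lemma thetaE y p : base_coord y p -> theta y = p.
Proof.
by move=> yp; apply: (base_coord_uniq (thetaP (base_coord_in yp)) yp).
Qed.

(** Powers of y and z commute modulo each term, since elements of slope 0 do; uniqueness of roots
    passes this on to y and z. *)
Lemma base_commute y z : in_base y -> in_base z -> commute y z.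
Proof.
move=> yb zb; apply: (malcev_sep gTm) => n.
have [m [g [m0 g0 e]]] := yb n; have [k [h [k0 h0 f]]] := zb n.
have gh : lcs_cong n (y ^+ m * z ^+ k) (z ^+ k * y ^+ m).
  apply: lcs_cong_trans (lcs_congM e f) _.
  rewrite -gmulfM (slope0_commute g0 h0) gmulfM.
  by apply: lcs_congM; apply: lcs_cong_sym.
have yJ : lcs_cong n (y ^ (z ^+ k)) y.
  apply: (lcs_cong_root gTm m0); rewrite -conjXg /conjg.
  have := lcs_congM (lcs_cong_refl n (z ^+ k)^-1) gh.
  by rewrite mulKg.
have zJ : lcs_cong n (z ^ y) z.
  apply: (lcs_cong_root gTm k0); rewrite -conjXg.
  have := lcs_congM (lcs_cong_refl n y^-1) (lcs_congM (lcs_cong_refl n (z ^+ k)) yJ).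
  by rewrite -conjgC mulKg => /lcs_cong_sym.
have := lcs_congM (lcs_cong_refl n y) zJ.
by rewrite /conjg mulVKg => /lcs_cong_sym.
Qed.

Lemma base_coordM y z p q : base_coord y p -> base_coord z q -> base_coord (y * z) (p + q)%R.
Proof.
move=> yp zq n; have [m [g [m0 g0 e eg]]] := yp n; have [k [h [k0 h0 f fh]]] := zq n.
have yz : commute y z by apply: base_commute; apply: base_coord_in; eassumption.
exists (m * k)%N, (g ^+ k * h ^+ m); rewrite muln_gt0 m0 k0; split=> //.
- by rewrite slpM !slpX g0 h0 !mul0rn addr0.
- rewrite (expgMn _ yz) expgnA mulnC expgnA gmulfM !group_morphX.
  by apply: lcs_congM; apply: lcs_congX.
- rewrite crdM ?slpX ?g0 ?mul0rn // !crdX // mulrnDl; apply: ps_eqmD.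
    by rewrite mulrnA; apply: ps_eqmMn.
  by rewrite mulnC mulrnA; apply: ps_eqmMn.
Qed.

Lemma in_baseM y z : in_base y -> in_base z -> in_base (y * z).
Proof. by move=> /thetaP yp /thetaP zp; apply: base_coord_in (base_coordM yp zp). Qed.

Lemma thetaM y z : in_base y -> in_base z -> theta (y * z) = (theta y + theta z)%R.
Proof. by move=> /thetaP yp /thetaP zp; apply/thetaE/base_coordM. Qed.

Lemma in_base_root y m : (0 < m)%N -> in_base (y ^+ m) -> in_base y.
Proof.
move=> m0 yb n; have [k [g [k0 g0 e]]] := yb n.
by exists (m * k)%N, g; rewrite muln_gt0 m0 k0 expgnA; split.
Qed.

Lemma glcs2_base y : glcs 2 y -> in_base y.
Proof.
move=> y2 n; have [m [g [m0 g2 e]]] := iota_root iotaP n (isT : (0 < 2)%N) y2.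
exists m, g; split=> //; last exact: lcs_cong_le (leq_addl _ _) e.
by have [h _] := lm_filt_glcs lamp_map g2; apply: h.
Qed.

Lemma base_coord_iota g : slp g = 0%R -> base_coord (iota g) (crd g).
Proof. by move=> g0 n; exists 1%N, g; split=> //; apply: lcs_cong_refl. Qed.

Lemma base1 : base_coord 1 0%R.
Proof.
have := base_coord_iota (g := 1); rewrite group_morph1 /slp /crd group_morph1.
exact.
Qed.

Lemma base_coordV y p : base_coord y p -> base_coord y^-1 (- p)%R.
Proof.
move=> yp n; have [m [g [m0 g0 e eg]]] := yp n.
exists m, g^-1; split=> //.
- by rewrite /slp group_morphV /= [(lamp_map g).2]g0 oppr0.
- by rewrite group_morphV expVgn; apply: lcs_congV.
- rewrite /crd group_morphV lm_invE /= [(lamp_map g).2]g0 ps_exp0 mul1r mulNrn.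
  exact: ps_eqmN.
Qed.

Lemma in_baseV y : in_base y -> in_base y^-1.
Proof. by move=> /thetaP/base_coordV; apply: base_coord_in. Qed.

Lemma thetaV y : in_base y -> theta y^-1 = (- theta y)%R.
Proof. by move=> /thetaP/base_coordV/thetaE. Qed.

Lemma in_baseX y m : in_base y -> in_base (y ^+ m).
Proof.
move=> yb; elim: m => [|m IHm]; first exact: base_coord_in base1.
by rewrite expgS; apply: in_baseM.
Qed.

Lemma thetaX y m : in_base y -> theta (y ^+ m) = (theta y *+ m)%R.
Proof.
move=> yb; elim: m => [|m IHm]; first exact: thetaE base1.
by rewrite expgS thetaM ?IHm ?mulrS //; apply: in_baseX.
Qed.

Lemma in_baseJ y z : in_base y -> in_base (y ^ z).
Proof.
move=> yb; have -> : y ^ z = y * [~ y, z] by rewrite mulVKg.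
by apply: in_baseM => //; apply: glcs2_base; apply: (@glcsR _ 1).
Qed.

Lemma thetaJ_iota y h : in_base y -> theta (y ^ iota h) = (ps_exp (slp h) * theta y)%R.
Proof.
move=> /thetaP yp; apply: thetaE => n; have [m [g [m0 g0 e eg]]] := yp n.
have jE : lamp_map (g ^ h) = (ps_exp (slp h) * crd g, 0)%R.
  have -> : lamp_map (g ^ h) = lamp_map g ^ lamp_map h.
    by rewrite /conjg !lamp_mapM group_morphV.
  rewrite (surjective_pairing (lamp_map g)) [(lamp_map g).2]g0.
  by rewrite (surjective_pairing (lamp_map h)) lm_conj0.
exists m, (g ^ h); split=> //; first by rewrite /slp jE.
- rewrite -conjXg /conjg !gmulfM group_morphV; exact: lcs_congJ.
- by rewrite /crd jE /= -mulrnAr; apply: ps_eqmM.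
Qed.

Lemma theta_glcs n y : in_base y -> glcs n y <-> ps_eqm n.-1 (theta y) 0%R.
Proof.
move=> /thetaP/(_ n)[m [g [m0 g0 e eg]]].
have c1 : crd 1 = 0%R by rewrite /crd group_morph1.
have s1 : slp 1 = 0%R by rewrite /slp group_morph1.
have i1 : iota 1 = 1 by apply: group_morph1.
split=> [yn|y0].
  apply: (ps_eqm_mulrn m0); rewrite mul0rn; apply: ps_eqm_trans (ps_eqm_sym eg) _.
  rewrite -c1; apply: crd_cong => //; rewrite i1; apply: lcs_cong_sym.
  by apply/lcs_cong1/(glcs_cong e)/glcsX.
apply: (glcs_root gTm m0); apply: (glcs_cong (lcs_cong_sym e)); apply/lcs_cong1.
rewrite -i1; apply: crd_congP => //; rewrite c1; apply: ps_eqm_sym.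
by apply: ps_eqm_trans eg _; rewrite -[X in ps_eqm _ _ X](mul0rn _ m); apply: ps_eqmMn.
Qed.

Lemma theta_inj y z : in_base y -> in_base z -> theta y = theta z -> y = z.
Proof.
move=> yb zb yz; apply: (malcev_sep gTm) => n; apply/theta_glcs.
  by apply: in_baseM => //; apply: in_baseV.
by rewrite thetaM ?thetaV //; [rewrite yz addNr | apply: in_baseV].
Qed.

(** Take a root of [iota (lamp_z i)] of order the denominator of q, then a power, then possibly the
    inverse. *)
Lemma theta_digit i (q : rat) : exists z, [/\ in_base z, glcs i.+1 z & theta z i = q].
Proof.
pose z0 := lamp_z i.
have s0 : slp z0 = 0%R by rewrite /slp /z0 lamp_map_z.
have c0 : crd z0 i = ((-1) ^+ i)%R by rewrite /crd lamp_z_coef.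
have z0i : glcs i.+1 (iota z0) by apply/glcs_morph/lamp_z_glcs.
have d0 : (0 < `|denq q|)%N by rewrite absz_gt0 denq_neq0.
have [z1 [z1i e]] := malcev_div gTm (isT : (0 < i.+1)%N) d0 z0i.
have c2 : glcs 2 ((iota z0)^-1 * z1 ^+ `|denq q|).
  by apply/(glcs_le _ (lcs_cong_sym e)).
have b0 : in_base (iota z0) by apply: base_coord_in (base_coord_iota s0).
have z1E : z1 ^+ `|denq q| = iota z0 * ((iota z0)^-1 * z1 ^+ `|denq q|).
  by rewrite mulVKg.
have z1b : in_base z1.
  apply: (in_base_root d0); rewrite z1E; apply: in_baseM => //; exact: glcs2_base.
have t1 : (theta z1 i *+ `|denq q| = (-1) ^+ i)%R.
  rewrite -psMn -thetaX // z1E thetaM //; last exact: glcs2_base.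
  rewrite psD (thetaE (base_coord_iota s0)) c0.
  have /(theta_glcs i.+2 (glcs2_base c2))/(_ i (ltnSn i)) -> : glcs i.+2 ((iota z0)^-1 * z1 ^+ `|denq q|).
    exact: lcs_cong_sym e.
  by rewrite addr0.
pose z2 := z1 ^+ `|numq q|.
have z2b : in_base z2 by apply: in_baseX.
(* Comparing squares disposes at once of the sign of q and of the sign (-1)^i. *)
have t2 : (theta z2 i ^+ 2 = q ^+ 2)%R.
  rewrite thetaX // psMn.
  have dr : (`|denq q|%:R = (denq q)%:~R :> rat)%R.
    by rewrite natr_absz ger0_norm ?denq_ge0.
  have d1 : ((denq q)%:~R != 0 :> rat)%R by rewrite intr_eq0 denq_neq0.
  have nr : (`|numq q|%:R ^+ 2 = (numq q)%:~R ^+ 2 :> rat)%R.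
    by rewrite natr_absz intr_norm real_normK // num_real.
  have t1' : (theta z1 i = (-1) ^+ i / (denq q)%:~R)%R.
    by rewrite -t1 -[X in (X / _)%R]mulr_natr dr mulfK.
  rewrite t1' -[X in (X ^+ 2)%R]mulr_natr exprMn nr exprMn sqrr_sign mul1r exprVn.
  by rewrite -{3}[q]divq_num_den expr_div_n mulrC.
have /orP[/eqP t3|/eqP t3] : (theta z2 i == q) || (theta z2 i == - q)%R.
  by rewrite -eqf_sqr t2.
  by exists z2; split=> //; apply: glcsX.
exists z2^-1; split; [exact: in_baseV | by apply/glcsV/glcsX |].
by rewrite thetaV // psN t3 opprK.
Qed.

Lemma theta_surj p : exists y, in_base y /\ theta y = p.
Proof.
(* Each step corrects one coefficient. The hypotheses stand under the existential so that [choice]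
   yields a total function. *)
have step (ny : nat * gT) : exists y', in_base ny.2 -> ps_eqm ny.1 (theta ny.2) p ->
    [/\ in_base y', ps_eqm ny.1.+1 (theta y') p & lcs_cong ny.1.+1 ny.2 y'].
  case: ny => n y /=; have [z [zb zn tz]] := theta_digit n (p n - theta y n)%R.
  exists (y * z) => yb yp; split; [exact: in_baseM | | exact: lcs_cong_mulr].
  rewrite thetaM // => i; rewrite ltnS leq_eqVlt => /predU1P[->|iN].
    by rewrite psD tz addrC subrK.
  rewrite psD yp //; have /(theta_glcs n.+1 zb)/(_ i iN) -> := zn.
  by rewrite addr0.
have /choice[F FP] := step; pose u := fix u n := if n is m.+1 then F (m, u m) else 1.
have uP n : in_base (u n) /\ ps_eqm n (theta (u n)) p.
  elim: n => [|n [ub up]]; first by split=> //; apply: base_coord_in base1.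
  by have [] := FP (n, u n) ub up.
have uc n : lcs_cong n (u n) (u n.+1).
  by have [ub up] := uP n; have [_ _] := FP (n, u n) ub up; apply: lcs_cong_le.
have [y yu] := malcev_complete gTm uc.
have yp : base_coord y p.
  move=> n; have [ub up] := uP n; have [m [g [m0 g0 e eg]]] := thetaP ub n.
  exists m, g; split=> //; first by apply: lcs_cong_trans (lcs_congX m (yu n)) e.
  by apply: ps_eqm_trans eg (ps_eqmMn m _); apply: ps_eqm_le up; apply: leq_pred.
by exists y; split; [apply: base_coord_in yp | apply: thetaE].
Qed.

(* The exponent of b, read off in the abelianization                          *)
Definition slope_rel y (s : rat) : Prop := exists m g,
  [/\ (0 < m)%N, lcs_cong 2 (y ^+ m) (iota g) & slp g = (s * m%:R)%R].

Lemma slope_rel_ex y : exists s, slope_rel y s.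
Proof.
have [m [g [m0 _ e]]] := @iota_surj _ iota iotaP 1 y isT I.
exists (slp g / m%:R)%R, m, g; split=> //.
by rewrite divfK // pnatr_eq0 -lt0n.
Qed.

Lemma iota_cong_slope g h : lcs_cong 2 (iota g) (iota h) -> slp g = slp h.
Proof.
move=> /iota_cong/lamp_cong_filt[/(_ isT)] /= /eqP.
by rewrite addrC subr_eq0 eq_sym => /eqP.
Qed.

Lemma slope_rel_uniq y s r : slope_rel y s -> slope_rel y r -> s = r.
Proof.
move=> [m [g [m0 e gs]]] [k [h [k0 f hr]]].
have : slp (g ^+ k) = slp (h ^+ m).
  apply: iota_cong_slope; rewrite !group_morphX.
  apply: lcs_cong_trans (lcs_congX k (lcs_cong_sym e)) _.
  by rewrite expgnAC; apply: lcs_congX.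
rewrite !slpX gs hr -[LHS]mulr_natr -[RHS]mulr_natr -!mulrA [(k%:R * m%:R)%R]mulrC.
apply: mulIf; rewrite mulf_neq0 // pnatr_eq0 -lt0n //.
Qed.

Definition gslope y : rat := xget 0%R [set s | slope_rel y s].

Lemma gslopeP y : slope_rel y (gslope y).
Proof. by have [s ys] := slope_rel_ex y; rewrite /gslope; case: xgetP => // /(_ s). Qed.

Lemma gslopeE y s : slope_rel y s -> gslope y = s.
Proof. exact/slope_rel_uniq/gslopeP. Qed.

Lemma lcs_cong2_expM y z m : lcs_cong 2 ((y * z) ^+ m) (y ^+ m * z ^+ m).
Proof. exact: (@lcs_cong_expM _ 1). Qed.

Lemma gslopeM y z : gslope (y * z) = (gslope y + gslope z)%R.
Proof.
apply: gslopeE; have [m [g [m0 e gs]]] := gslopeP y; have [k [h [k0 f hr]]] := gslopeP z.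
exists (m * k)%N, (g ^+ k * h ^+ m); split; first by rewrite muln_gt0 m0.
  apply: lcs_cong_trans (lcs_cong2_expM _ _ _) _.
  rewrite gmulfM !group_morphX expgnA mulnC expgnA.
  by apply: lcs_congM; apply: lcs_congX.
rewrite slpM !slpX gs hr -[X in (X + _)%R]mulr_natr -[X in (_ + X)%R]mulr_natr natrM.
by ring.
Qed.

(** If the slope is 0, some power of y is an element of slope 0 from the image times an element of
    the second term, and both factors are in the base. *)
Lemma gslope0 y : gslope y = 0%R <-> in_base y.
Proof.
split=> [y0|yb].
  have [m [g [m0 e]]] := gslopeP y; rewrite y0 mul0r => gs; apply: (in_base_root m0).
  have -> : y ^+ m = iota g * ((iota g)^-1 * y ^+ m) by rewrite mulVKg.
  apply: in_baseM; first exact: base_coord_in (base_coord_iota gs).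
  by apply: glcs2_base; exact: lcs_cong_sym e.
have [m [g [m0 g0 e]]] := yb 2; apply: gslopeE; exists m, g; split=> //.
by rewrite mul0r.
Qed.

Lemma gslopeV y : gslope y^-1 = (- gslope y)%R.
Proof.
apply/eqP; rewrite -addr_eq0 -gslopeM mulVg; apply/eqP/gslope0.
exact: base_coord_in base1.
Qed.

Lemma slpV g : slp g^-1 = (- slp g)%R.
Proof. by rewrite /slp group_morphV. Qed.

Lemma gslope_surj s : exists y, gslope y = s.
Proof.
have d0 : (0 < `|denq s|)%N by rewrite absz_gt0 denq_neq0.
have [h hs] : exists h, slp h = (numq s)%:~R%R.
  case: (numq s) => n.
    by exists (lamp_b ^+ n); rewrite /slp lamp_map_bX.
  exists (lamp_b ^+ n.+1)^-1; rewrite slpV /slp lamp_map_bX.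
  by rewrite NegzE mulrNz.
have [y [_ e]] := @malcev_div _ gTm 1 (iota h) _ isT d0 I.
exists y; apply: gslopeE; exists `|denq s|%N, h; split=> //.
by rewrite hs numqE natr_absz ger0_norm ?denq_ge0.
Qed.

End Coordinate.

(** * The action by conjugation *)

Section PowerSeriesRigidity.
Implicit Types f g p q : ps.

Lemma psX0_exp f n : f 0%N = 1 -> (f ^+ n) 0%N = 1.
Proof.
by move=> f0; elim: n => [//|n IHn]; rewrite exprS psM0 f0 IHn mulr1.
Qed.

(** The cofactor of f - g in f^m - g^m has constant coefficient m, so it can be cancelled. *)
Lemma ps_root_uniq m f g : (0 < m)%N -> f 0%N = 1 -> g 0%N = 1 -> f ^+ m = g ^+ m -> f = g.
Proof.
move=> m0 f0 g0 fg; apply/subr0_eq.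
have := subrXX f g m; rewrite fg subrr mulrC => e.
apply: (ps_unit_inj _ (esym (etrans (mulr0 _) e))).
rewrite ps_sum (eq_bigr (fun=> 1)) => [|i _]; last by rewrite psM0 !psX0_exp ?mulr1.
by rewrite sumr_const card_ord pnatr_eq0 -lt0n.
Qed.

Lemma ps_expMn s n : ps_exp (s * n%:R) = ps_exp s ^+ n.
Proof.
elim: n => [|n IHn]; first by rewrite mulr0 ps_exp0.
by rewrite [n.+1%:R]mulrS mulrDr mulr1 ps_expD IHn exprS.
Qed.

(* e^x - 1 is a uniformizer, so commuting with e^x forces linearity.          *)
Lemma ps_map_linear (R : ps -> ps) :
  (forall p q, R (p + q) = R p + R q) ->
  (forall p, R (ps_exp 1 * p) = ps_exp 1 * R p) -> forall p, R p = p * R 1.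
Proof.
move=> RD Re.
have R0 : R 0 = 0 by apply: (addrI (R 0)); rewrite -RD !addr0.
have RN p : R (- p) = - R p by apply/eqP; rewrite -addr_eq0 -RD addNr R0.
have Rn p n : R (p *+ n) = R p *+ n.
  by elim: n => [//|n IHn]; rewrite !mulrS RD IHn.
have Rz p (z : int) : R (p *~ z) = R p *~ z.
  by case: z => n; [exact: Rn | rewrite NegzE !mulrNz RN; congr (- _); exact: Rn].
have Rc a p : R (ps_const a * p) = ps_const a * R p.
  have h q : (ps_const a * q) *+ `|denq a| = q *~ numq a.
    rewrite -[RHS]mulrzl -(rmorph_int ps_const) numqE /=.
    rewrite -[LHS]mulr_natl mulrA -(rmorph_nat ps_const) -rmorphM /=.
    by rewrite natr_absz ger0_norm ?denq_ge0 // mulrC [(_ * a)%R]mulrC [LHS]mulrC.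
  apply: ps_eqmP => n; apply: (@ps_eqm_mulrn _ `|denq a|).
    by rewrite absz_gt0 denq_neq0.
  by rewrite -Rn !h Rz.
pose w := psX * ps_expq 1.
have eE : ps_exp 1 = 1 + w by rewrite ps_expE rmorph1 mul1r.
have Rw p : R (w * p) = w * R p.
  have -> : w * p = ps_exp 1 * p + - p by rewrite eE; ring.
  by rewrite RD RN Re eE; ring.
have [v vE] : exists v, v * ps_expq 1 = 1 by apply: ps_inv; rewrite ps_expq_coef0 oner_neq0.
move=> p; apply: ps_eqmP => n; elim: n p => [//|n IHn] p.
have [r rE] : exists r, p - ps_const (p 0%N) = psX * r.
  by apply: ps_divX; rewrite psB subrr.
(* With w = e^x - 1 in place of x, R is known on the constant, and the factor w gains one order of
   precision in the induction. *)
have -> : p = ps_const (p 0%N) * 1 + w * (v * r).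
  transitivity (ps_const (p 0%N) + psX * r * (v * ps_expq 1)); last by rewrite /w; ring.
  by rewrite vE mulr1 -rE addrC subrK.
rewrite RD Rc Rw mulr1 [X in ps_eqm _ _ X]mulrDl; apply: ps_eqmD => //.
rewrite /w -!mulrA; apply/ps_eqm_mulX/ps_eqmM => //.
by have := IHn (v * r); rewrite -mulrA.
Qed.

End PowerSeriesRigidity.

Section Action.
Local Open Scope group_scope.
Variables (gT : groupType) (iota : {multiplicative lamplighter -> gT}).
Hypothesis iotaP : malcev_completion iota.
Implicit Types (x y z : gT) (p q : ps).
Local Notation theta := (theta iota).
Local Notation base := (in_base iota).
Local Notation slope := (gslope iota).
Local Notation beta := (iota lamp_b).

Lemma slope_b : (lamp_map lamp_b).2 = 1%R. Proof. by rewrite lamp_map_b. Qed.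

Lemma base_conj_glcs2 nu y c : base nu -> glcs 2 c -> nu ^ (y * c) = nu ^ y.
Proof.
move=> nub c2; rewrite conjgM; apply/conjg_fixP/commgP.
by apply: (base_commute iotaP); [apply: in_baseJ | apply: glcs2_base].
Qed.

Lemma theta_coef0 c : glcs 2 c -> theta c 0%N = 0%R.
Proof. by move=> c2; have /(theta_glcs iotaP 2 (glcs2_base iotaP c2))/(_ 0%N isT) := c2. Qed.

Lemma thetaJ nu y : base nu -> theta (nu ^ y) = (ps_exp (slope y) * theta nu)%R.
Proof.
have /choice[t tP] := theta_surj iotaP.
(* Conjugation by y transported to Q[[x]] along [theta]. *)
pose R p := theta (t p ^ y).
have tb p : base (t p) by have [] := tP p.
have tE p : theta (t p) = p by have [] := tP p.
have RE mu : base mu -> theta (mu ^ y) = R (theta mu).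
  by move=> mub; rewrite /R (theta_inj iotaP (tb (theta mu)) mub) // tE.
have RD p q : R (p + q)%R = (R p + R q)%R.
  rewrite -[(R p + R q)%R]/(theta (t p ^ y) + theta (t q ^ y))%R.
  rewrite -(thetaM iotaP (in_baseJ iotaP y (tb p)) (in_baseJ iotaP y (tb q))).
  by rewrite -conjMg RE ?(thetaM iotaP) ?tE //; apply: in_baseM.
have Rb p : R (ps_exp 1 * p)%R = (ps_exp 1 * R p)%R.
  have := thetaJ_iota iotaP lamp_b (in_baseJ iotaP y (tb p)); rewrite slope_b => <-.
  have := thetaJ_iota iotaP lamp_b (tb p); rewrite slope_b tE => <-.
  rewrite -RE; last exact: in_baseJ.
  (* The two orders of conjugation differ by a commutator, which acts trivially on the base. *)
  by rewrite -!conjgM [beta * y]commgC base_conj_glcs2 //; apply: (@glcsR _ 1).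
have R1 : R 1%R 0%N = 1%R.
  rewrite /R; have -> : t 1%R ^ y = t 1%R * [~ t 1%R, y] by rewrite mulVKg.
  have c2 : glcs 2 [~ t 1%R, y] by apply: (@glcsR _ 1).
  by rewrite thetaM // ?psD ?tE ?theta_coef0 ?addr0 //; apply: glcs2_base.
have Rl := ps_map_linear RD Rb.
have RX m mu : base mu -> theta (mu ^ (y ^+ m)) = (R 1 ^+ m * theta mu)%R.
  elim: m mu => [|m IHm] mu mub; first by rewrite conjg1 mul1r.
  rewrite expgS conjgM IHm; last exact: in_baseJ.
  by rewrite RE // (Rl (theta mu)) exprSr; ring.
(* A power of y acts as an element of the image does, that is by an exponential; roots with constant
   coefficient 1 are unique. *)
have rho : R 1%R = ps_exp (slope y).
  have [m [g [m0 e gs]]] := gslopeP iotaP y.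
  apply: (ps_root_uniq m0 R1); first exact: ps_exp_coef0.
  have := RX m _ (tb 1%R); rewrite tE mulr1 => <-.
  have -> : y ^+ m = iota g * ((iota g)^-1 * y ^+ m) by rewrite mulVKg.
  have c2 : glcs 2 ((iota g)^-1 * y ^+ m) by exact: lcs_cong_sym e.
  rewrite (base_conj_glcs2 _ (tb 1%R) c2) (thetaJ_iota iotaP g (tb 1%R)) tE mulr1.
  by rewrite gs ps_expMn.
by move=> nub; rewrite RE // (Rl (theta nu)) rho mulrC.
Qed.

(** This is y b y^-1 b^-1. It lies in the second term, so [theta] applies to it for every y; in the
    model, y = (p, s) gives (1 - e^(-x)) p. *)
Definition kappa y : gT := [~ y^-1, beta^-1].

Lemma kappa_glcs y : glcs 2 (kappa y). Proof. exact: (@glcsR _ 1). Qed.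

Lemma kappa_coef0 y : theta (kappa y) 0%N = 0%R.
Proof. by apply: theta_coef0; apply: kappa_glcs. Qed.

(** The cocycle identity: [theta (kappa y)] and the slope multiply together as in [lamp_model]. *)
Lemma theta_kappaM y z : theta (kappa (y * z)) =
  (theta (kappa y) + ps_exp (- slope y) * theta (kappa z))%R.
Proof.
have kb x := glcs2_base iotaP (kappa_glcs x).
rewrite {1}/kappa invgM commMgE -/(kappa y) -/(kappa z) thetaM //; last exact: in_baseJ.
by rewrite thetaJ // gslopeV // addrC.
Qed.

Lemma theta_kappa_base nu : base nu ->
  theta (kappa nu) = (psX * ps_expq (-1) * theta nu)%R.
Proof.
move=> nub; have nuV := in_baseV iotaP nub.
have -> : kappa nu = nu * (nu^-1 ^ iota lamp_b^-1).
  by rewrite /kappa /commg invgK group_morphV.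
rewrite thetaM //; last exact: in_baseJ.
rewrite thetaJ_iota // thetaV // group_morphV /= slope_b.
by rewrite ps_expE rmorphN1; ring.
Qed.

(** Equal slopes place y z^-1 in the base, where the cocycle is multiplication by 1 - e^(-x), an
    injective map. *)
Lemma gslope_kappa_inj y z : slope y = slope z -> theta (kappa y) = theta (kappa z) -> y = z.
Proof.
move=> syz kyz; have yE : y = y * z^-1 * z by rewrite mulgVK.
have yzb : base (y * z^-1).
  by apply/(gslope0 iotaP); rewrite gslopeM // gslopeV // syz addrN.
have s0 := iffRL (gslope0 iotaP _) yzb.
have := kyz; rewrite {1}yE theta_kappaM s0 oppr0 ps_exp0 mul1r theta_kappa_base //.
rewrite -{2}[theta (kappa z)]add0r => /addIr; rewrite -mulrA -(mulr0 psX) => /psX_inj.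
rewrite -(mulr0 (ps_expq (-1))) => /ps_unit_inj; rewrite ps_expq_coef0 oner_neq0 => /(_ isT) t0.
have b1 : base 1 := base_coord_in (base1 iota).
have : y * z^-1 = 1 by apply: (theta_inj iotaP yzb b1); rewrite t0 (thetaE iotaP (base1 iota)).
exact: divg1_eq.
Qed.

Lemma gslope_kappa_surj s p : p 0%N = 0%R -> exists y, slope y = s /\ theta (kappa y) = p.
Proof.
move=> p0; have [y0 y0s] := gslope_surj iotaP s.
have [r rE] : exists r, (p - theta (kappa y0))%R = (psX * r)%R.
  by apply: ps_divX; rewrite psB p0 kappa_coef0 subrr.
have [v vE] : exists v, (v * ps_expq (-1))%R = 1%R.
  by apply: ps_inv; rewrite ps_expq_coef0 oner_neq0.
have [nu [nub nuE]] := theta_surj iotaP (v * r)%R.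
have s0 := iffRL (gslope0 iotaP _) nub.
exists (nu * y0); split; first by rewrite gslopeM // s0 add0r.
rewrite theta_kappaM s0 oppr0 ps_exp0 mul1r theta_kappa_base // nuE.
transitivity (psX * r * (v * ps_expq (-1)) + theta (kappa y0))%R; first by ring.
by rewrite vE mulr1 -rE subrK.
Qed.

End Action.

(** * The isomorphism *)

Theorem theorem1 (Ghat : groupType) (iota : {multiplicative lamplighter -> Ghat})
    (Ghat_completion : malcev_completion iota) :
  malcev_lie_algebra Ghat (lie_completion lamplighter_lie).
Proof.
have [crd [slope [Es Ei Ep Eb]]] := lamplighter_completion_coords.
have iotaP := Ghat_completion; split=> //.
(* This is 1 - e^(-x), the factor by which [kappa] distorts the first coordinate. *)
pose K := psX * ps_expq (-1).
have KI p q : K * p = K * q -> p = q.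
  rewrite /K -!mulrA => /psX_inj/ps_unit_inj; apply.
  by rewrite ps_expq_coef0 oner_neq0.
(* The image w of y has the same slope, and its first coordinate, rescaled by [ps_expq] as on the
   Lie side, is that of y in the model. *)
have rel y : exists w, slope w = gslope iota y /\
    theta iota (kappa iota y) = K * (ps_expq (- slope w) * crd w).
  have [r rE] := ps_divX (kappa_coef0 iotaP y).
  have [v vE] : exists v, v * ps_expq (-1) = 1.
    by apply: ps_inv; rewrite ps_expq_coef0 oner_neq0.
  have [v' vE'] : exists v', v' * ps_expq (- gslope iota y) = 1.
    by apply: ps_inv; rewrite ps_expq_coef0 oner_neq0.
  have [w [w1 w2]] := Es (v' * (v * r)) (gslope iota y).
  exists w; split=> //; rewrite rE w1 w2 /K.
  transitivity (psX * r * (v * ps_expq (-1)) * (v' * ps_expq (- gslope iota y))).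
    by rewrite vE vE' !mulr1.
  by ring.
have [phi phiP] := choice rel.
have phi_inj : injective phi.
  move=> y z yz; have [y1 y2] := phiP y; have [z1 z2] := phiP z.
  by apply: (gslope_kappa_inj iotaP); [rewrite -y1 -z1 yz | rewrite y2 z2 yz].
have phi_surj w : exists y, phi y = w.
  have [|y [y1 y2]] := @gslope_kappa_surj _ _ iotaP (slope w) (K * (ps_expq (- slope w) * crd w)).
    by rewrite /K -mulrA psX_mul0.
  exists y; have [p1 p2] := phiP y; apply: Ei; last by rewrite p1 y1.
  have := p2; rewrite y2 p1 y1 => /KI/ps_unit_inj -> //.
have [psi psiK] := choice phi_surj.
exists phi; split; first by exists psi => // y; apply: phi_inj; rewrite psiK.
move=> y z; apply/esym; have [w1 w2] := phiP (y * z)%g.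
have [y1 y2] := phiP y; have [z1 z2] := phiP z.
(* After multiplication by K, the condition that characterizes the BCH product is the cocycle
   identity. *)
apply: Eb; first by rewrite w1 y1 z1 gslopeM.
apply: KI; rewrite mulrDr [crd _ * _]mulrC -w2 theta_kappaM // y2 z2 y1; ring.
Qed.
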